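(* Let $\lambda>0$ and let $\rho\in L^{1}_{loc}[0,\infty)$ be a real-valued function such that its Laplace transform $\mathcal{L}\{\rho;s\}=\int_{0}^{\infty}\rho(x)e^{-sx}\,\mathrm{d}x$ is convergent on the half-plane $\Re e\, s>0$. If there is a constant $b$ such that $$\frac{\mathcal{L}\{\rho;s\}-b}{s},\qquad \Re e\, s>0,$$ has local pseudofunction boundary behavior on $(-i\lambda,i\lambda)$, then $$\limsup_{x\to\infty}\left|\int_{0}^{x}\rho(u)\,\mathrm{d}u-b\right|\leq \frac{\pi}{\lambda}\max\left\{-\liminf_{x\to\infty}\rho(x),0\right\}.$$ The constant $\pi$ is best possible: for no constant $\mathfrak{K}<\pi$ does the inequality with $\pi$ replaced by $\mathfrak{K}$ hold for all $\lambda,\rho,b$ satisfying the hypotheses.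
   Context: Here $\liminf_{x\to\infty}\rho(x)$ is the essential limit inferior (a value in $[-\infty,\infty]$; if it is $-\infty$ the right-hand side is $+\infty$). Convergence of the Laplace transform means convergence of the improper integral $\lim_{A\to\infty}\int_0^A\rho(x)e^{-sx}\,\mathrm{d}x$. Fourier transforms are normalized as $\hat{\varphi}(t)=\int_{-\infty}^{\infty}e^{-itx}\varphi(x)\,\mathrm{d}x$ and interpreted in the sense of tempered distributions when needed. A (global) pseudomeasure is an element of $PM(\mathbb{R})=\mathcal{F}(L^{\infty}(\mathbb{R}))$; $f\in PM(\mathbb{R})$ is a global pseudofunction if additionally $\lim_{|x|\to\infty}\hat f(x)=0$. For $U\subseteq\mathbb{R}$ open, a Schwartz distribution $g\in\mathcal{D}'(U)$ is a local pseudofunction on $U$, written $g\in PF_{loc}(U)$, if every point of $U$ has a neighborhood on which $g$ coincides with a global pseudofunction; equivalently, $\lim_{|x|\to\infty}\widehat{\varphi g}(x)=0$ for every $\varphi\in\mathcal{D}(U)$ (smooth functions compactly supported in $U$). An analytic function $G$ on $\Re e\, s>0$ has local pseudofunction boundary behavior on $iU$ if there is $g\in PF_{loc}(U)$ with $\lim_{\sigma\to0^{+}}\int_{-\infty}^{\infty}G(\sigma+it)\varphi(t)\,\mathrm{d}t=\langle g,\varphi\rangle$ for each $\varphi\in\mathcal{D}(U)$. On the segment $(-i\lambda,i\lambda)$ means $U=(-\lambda,\lambda)$. *)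

(* Defs.v *)
From HB Require Import structures.
From mathcomp Require Import all_boot all_order all_algebra.
From mathcomp Require Import complex.
From mathcomp Require Import all_classical all_reals all_analysis.
From mathcomp Require Import ess_sup_inf.

Set Implicit Arguments.
Unset Strict Implicit.
Unset Printing Implicit Defensive.

Import Order.TTheory GRing.Theory Num.Theory.
Import numFieldNormedType.Exports.

Local Open Scope classical_set_scope.
Local Open Scope ring_scope.
Local Open Scope complex_scope.

(* [R[i]] carries no [R]-normed module structure in the library, so limits,
   integrals and derivatives are taken on real and imaginary parts. *)

Definition cabs (R : realType) (z : R[i]) : R := ComplexField.Normc.normc z.

Definition cexp (R : realType) (z : R[i]) : R[i] :=
  (expR (complex.Re z) * cos (complex.Im z)) +i*
  (expR (complex.Re z) * sin (complex.Im z)).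

Definition cint (R : realType) (D : set R) (f : R -> R[i]) : R[i] :=
  (\int[lebesgue_measure]_(x in D) complex.Re (f x)) +i*
  (\int[lebesgue_measure]_(x in D) complex.Im (f x)).

Definition ccvg (R : realType) (F : set_system R) (f : R -> R[i]) (l : R[i]) :
    Prop :=
  (complex.Re (f x) @[x --> F] --> complex.Re l) /\
  (complex.Im (f x) @[x --> F] --> complex.Im l).

Definition clim (R : realType) (F : set_system R) (f : R -> R[i]) : R[i] :=
  lim (complex.Re (f x) @[x --> F]) +i* lim (complex.Im (f x) @[x --> F]).

Definition smooth (R : realType) (phi : R -> R[i]) : Prop :=
  forall (n : nat) (x : R),
    derivable (derive1n n (fun y => complex.Re (phi y))) x 1 /\
    derivable (derive1n n (fun y => complex.Im (phi y))) x 1.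

Definition cderiv (R : realType) (n : nat) (phi : R -> R[i]) (x : R) : R[i] :=
  derive1n n (fun y => complex.Re (phi y)) x +i*
  derive1n n (fun y => complex.Im (phi y)) x.

(* A functional is a total map on all functions [R -> R[i]]; only its values
   on the relevant test functions are meaningful. *)

Definition supported_in (R : realType) (K : set R) (phi : R -> R[i]) : Prop :=
  forall x, ~ K x -> phi x = 0.

Definition test_function (R : realType) (U : set R) (phi : R -> R[i]) : Prop :=
  smooth phi /\
  exists K : set R, [/\ compact K, K `<=` U & supported_in K phi].

Definition linear_on (R : realType) (P : (R -> R[i]) -> Prop)
    (g : (R -> R[i]) -> R[i]) : Prop :=
  forall (a : R[i]) (phi psi : R -> R[i]), P phi -> P psi ->
    g (fun x => a * phi x + psi x) = a * g phi + g psi.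

(* Continuity is the usual seminorm estimate; quantifying over every common
   upper bound [M] of the seminorms stands for their maximum. *)
Definition distribution (R : realType) (U : set R) (g : (R -> R[i]) -> R[i]) :
    Prop :=
  linear_on (test_function U) g /\
  forall K : set R, compact K -> K `<=` U ->
    exists (C : R) (N : nat), forall (phi : R -> R[i]) (M : R),
      smooth phi -> supported_in K phi ->
      (forall (n : nat) (x : R), (n <= N)%N -> cabs (cderiv n phi x) <= M) ->
      cabs (g phi) <= C * M.

Definition schwartz (R : realType) (phi : R -> R[i]) : Prop :=
  smooth phi /\
  forall j k : nat, exists M : R, forall x : R,
    `|x| ^+ j * cabs (cderiv k phi x) <= M.

Definition tempered (R : realType) (f : (R -> R[i]) -> R[i]) : Prop :=
  linear_on (@schwartz R) f /\
  exists (C : R) (N : nat), forall (phi : R -> R[i]) (M : R),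
    schwartz phi ->
    (forall (j k : nat) (x : R), (j <= N)%N -> (k <= N)%N ->
       `|x| ^+ j * cabs (cderiv k phi x) <= M) ->
    cabs (f phi) <= C * M.

Definition eq_tempered (R : realType) (f1 f2 : (R -> R[i]) -> R[i]) : Prop :=
  forall phi, schwartz phi -> f1 phi = f2 phi.

Definition regular (R : realType) (h : R -> R[i]) (phi : R -> R[i]) : R[i] :=
  cint setT (fun x => h x * phi x).

Definition fourier (R : realType) (phi : R -> R[i]) (t : R) : R[i] :=
  cint setT (fun x => cexp (0 -i* (t * x)) * phi x).

Definition fourier_dist (R : realType) (f : (R -> R[i]) -> R[i])
    (phi : R -> R[i]) : R[i] :=
  f (fourier phi).

Definition Linfty (R : realType) (h : R -> R[i]) : Prop :=
  [/\ measurable_fun setT (fun x => complex.Re (h x)),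
      measurable_fun setT (fun x => complex.Im (h x)) &
      exists M : R, {ae lebesgue_measure, forall x, cabs (h x) <= M}].

Definition ess_vanishes_at_infinity (R : realType) (h : R -> R[i]) : Prop :=
  forall e : R, 0 < e -> exists A : R,
    {ae lebesgue_measure, forall x, A <= `|x| -> cabs (h x) <= e}.

Definition pseudomeasure (R : realType) (f : (R -> R[i]) -> R[i]) : Prop :=
  tempered f /\
  exists2 h : R -> R[i], Linfty h & eq_tempered f (fourier_dist (regular h)).

(* The Fourier transform of a pseudomeasure is an [L^infty] function, defined
   up to null sets: its limit at infinity is an essential one. *)
Definition global_pseudofunction (R : realType) (f : (R -> R[i]) -> R[i]) :
    Prop :=
  pseudomeasure f /\
  exists k : R -> R[i],
    [/\ Linfty k, eq_tempered (fourier_dist f) (regular k) &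
        ess_vanishes_at_infinity k].

Definition local_pseudofunction (R : realType) (U : set R)
    (g : (R -> R[i]) -> R[i]) : Prop :=
  distribution U g /\
  forall t : R, U t ->
    exists V : set R, [/\ open V, V t, V `<=` U &
      exists2 f, global_pseudofunction f &
        forall phi, test_function V phi -> g phi = f phi].

(* Only the values of [G] on the half-plane [Re s > 0] matter. Analyticity is not
   required here: a Laplace transform convergent on the half-plane has it. *)
Definition local_pseudofunction_boundary (R : realType) (U : set R)
    (G : R[i] -> R[i]) : Prop :=
  exists2 g, local_pseudofunction U g &
    forall phi, test_function U phi ->
      ccvg (0 : R)^'+
        (fun sigma => cint setT (fun t => G (sigma +i* t) * phi t)) (g phi).

(* For [rho] on [[0, oo)]: values on the negative half-line never matter. *)
Definition L1loc_nneg (R : realType) (rho : R -> R) : Prop :=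
  forall A : R, lebesgue_measure.-integrable `[0, A] (EFin \o rho).

Definition laplace_partial (R : realType) (rho : R -> R) (s : R[i]) (A : R) :
    R[i] :=
  cint `[0, A] (fun x => (rho x)%:C * cexp (- s * x%:C)).

Definition laplace_converges (R : realType) (rho : R -> R) (s : R[i]) : Prop :=
  exists l : R[i], ccvg +oo (laplace_partial rho s) l.

Definition laplace (R : realType) (rho : R -> R) (s : R[i]) : R[i] :=
  clim +oo (laplace_partial rho s).

Definition ess_liminf (R : realType) (rho : R -> R) : \bar R :=
  ereal_sup (range (fun A : R =>
    ess_inf (mrestr lebesgue_measure (measurable_itv `[A, +oo[))
            (EFin \o rho))).

Definition tauberian_hypotheses (R : realType) (lambda : R) (rho : R -> R)
    (b : R[i]) : Prop :=
  [/\ 0 < lambda,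
      L1loc_nneg rho,
      forall s : R[i], 0 < complex.Re s -> laplace_converges rho s &
      local_pseudofunction_boundary `]- lambda, lambda[
        (fun s => (laplace rho s - b) / s)].

Definition tauberian_inequality (R : realType) (K lambda : R) (rho : R -> R)
    (b : R[i]) : Prop :=
  (limf_esup
     (fun x : R =>
        (cabs ((\int[lebesgue_measure]_(u in `[0%R, x]) rho u)%:C - b))%:E)
     +oo%R
   <= (K / lambda)%:E * maxe (- ess_liminf rho) 0)%E.

(* Main.v *)
From HB Require Import structures.
Require Import Defs.
From mathcomp Require Import all_boot all_order all_algebra.
From mathcomp Require Import complex.
From mathcomp Require Import all_classical all_reals all_analysis.
From mathcomp Require Import ess_sup_inf measurable_realfun ring lra.

Set Implicit Arguments.
Unset Strict Implicit.
Unset Printing Implicit Defensive.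

Import Order.TTheory GRing.Theory Num.Theory.
Import numFieldNormedType.Exports.

Local Open Scope classical_set_scope.
Local Open Scope ring_scope.

(** Put S(x) = int_0^x rho and write b = beta + i gamma.  By parts, the function
    (L(s) - b)/s is the Laplace transform of S - b, so testing its boundary values
    on the imaginary axis against a wave packet phi(t - t0) e^{iht} amounts to
    averaging S - b near the point h against cos (t0 (x - h)) K(x - h) and
    sin (t0 (x - h)) K(x - h), where K is the Fourier transform of phi.  Local
    pseudofunction behavior makes these averages tend to 0 as h -> oo for every
    |t0| < lambda.

    The frequency t0 = 0 forces gamma = 0.  With K >= 0, monotone convergence and
    the slow decrease S(y) - S(x) >= - M (y - x) it also shows that r = S - beta is
    bounded.  All frequencies together say that the translates of r become
    orthogonal to every L^1 function whose Fourier transform lives in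
    [-lambda, lambda].  Beurling's majorant of the Heaviside step differs from the
    step by a nonnegative function of integral 1/2 (on the scale lambda = 2 pi);
    subtracting two translates of it gives a band-limited function close to an
    indicator, and comparing r with it under the one-sided Lipschitz condition
    bounds |r| by pi M / lambda in the limit.

    For sharpness take lambda = 1, b = 0 and rho = F - 1 with F the Fejer kernel of
    order N, so that rho >= - 1: since F has mean 1 and concentrates at 0, the
    periodic function S comes as close to pi as desired near 0. *)

(** * Integrals and smooth functions *)

(** The axis is approached with no a priori bound on S, so letting the abscissa tend to 0 under the
    integral is the main obstacle. At frequency 0 a nonnegative kernel and an added linear function
    make the integrands monotone; at other frequencies oscillation forbids this, and the passage is
    dominated only once r is known to be bounded. The neighborhood given by local pseudofunction
    behavior depends on the frequency; compactness makes its size uniform on [-l, l] for l < lambda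
    only. So the bound is proved for every such l and every slope slightly above max(- liminf rho,
    0), and both losses are absorbed at the end. The constant comes from scaling: with slope M and
    frequencies up to 2 pi the integral 1/2 gives M / 2, and dilation by 2 pi / l turns this into pi
    M / l. A reflection brings both signs of r under the same one-sided hypothesis. Beurling's
    function is not integrable, hence the difference of two translates. In the example the
    frequencies are nonzero integers, so the singularities on the imaginary axis are nonzero
    multiples of i, outside (-i, i). *)

Section L1_toolbox.
Context {R : realType}.
Notation mu := (@lebesgue_measure R).
Implicit Types f g : R -> R.

Definition L1 f := mu.-integrable setT (EFin \o f).

Lemma L1_measurable f : L1 f -> measurable_fun setT f.
Proof. by case/integrableP => /measurable_EFinP. Qed.

Lemma L1_le f g : measurable_fun setT f -> L1 g ->
  (forall x, `|f x| <= g x) -> L1 f.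
Proof.
move=> mf ig fg; apply: (le_integrable measurableT _ _ ig).
  exact/measurable_EFinP.
by move=> x _ /=; rewrite lee_fin (le_trans (fg x))// ler_norm.
Qed.

Lemma L1D f g : L1 f -> L1 g -> L1 (fun x => f x + g x).
Proof.
move=> lf lg; rewrite /L1; have := integrableD measurableT lf lg.
by apply: eq_integrable.
Qed.

Lemma L1B f g : L1 f -> L1 g -> L1 (fun x => f x - g x).
Proof.
move=> lf lg; rewrite /L1; have := integrableB measurableT lf lg.
by apply: eq_integrable.
Qed.

Lemma L1Z c f : L1 f -> L1 (fun x => c * f x).
Proof.
move=> lf; rewrite /L1; have := integrableZl measurableT c lf.
by apply: eq_integrable.
Qed.

Lemma L1_norm f : L1 f -> L1 (fun x => `|f x|).
Proof. by move=> lf; rewrite /L1; exact: (integrable_norm lf). Qed.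

Lemma L10 : L1 (fun=> 0).
Proof. by have := @integrable0 _ _ _ mu setT; apply: eq_integrable. Qed.

Lemma L1_bdd f g (C : R) : L1 f -> measurable_fun setT g ->
  (forall x, `|g x| <= C) -> L1 (fun x => f x * g x).
Proof.
move=> lf mg gC; apply: (@L1_le _ (fun x => C * `|f x|)).
- by apply: measurable_funM => //; exact: L1_measurable.
- exact/L1Z/L1_norm.
- by move=> x; rewrite normrM mulrC ler_wpM2r.
Qed.

Lemma intD f g : L1 f -> L1 g ->
  \int[mu]_x (f x + g x) = \int[mu]_x f x + \int[mu]_x g x.
Proof. by move=> *; rewrite RintegralD. Qed.

Lemma intB f g : L1 f -> L1 g ->
  \int[mu]_x (f x - g x) = \int[mu]_x f x - \int[mu]_x g x.
Proof. by move=> *; rewrite RintegralB. Qed.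

Lemma intZ c f : L1 f -> \int[mu]_x (c * f x) = c * \int[mu]_x f x.
Proof. by move=> *; rewrite RintegralZl. Qed.

Lemma int_le f g : L1 f -> L1 g -> (forall x, f x <= g x) ->
  \int[mu]_x f x <= \int[mu]_x g x.
Proof. by move=> lf lg fg; apply: le_Rintegral => // x _; exact: fg. Qed.

Lemma int_norm f : L1 f -> `|\int[mu]_x f x| <= \int[mu]_x `|f x|.
Proof. by move=> *; exact: le_normr_Rintegral. Qed.

Lemma int_norm_le f g : L1 f -> L1 g -> (forall x, `|f x| <= g x) ->
  `|\int[mu]_x f x| <= \int[mu]_x g x.
Proof.
move=> lf lg fg; apply: le_trans (int_norm lf) _.
by apply: int_le => //; exact: L1_norm.
Qed.

Lemma eq_int f g : (forall x, f x = g x) -> \int[mu]_x f x = \int[mu]_x g x.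
Proof. by move=> fg; apply: eq_Rintegral => x _. Qed.

Lemma eq_L1 f g : (forall x, f x = g x) -> L1 f -> L1 g.
Proof. by move=> /funext ->. Qed.

Lemma dct (f_ : nat -> R -> R) f g :
  (forall n, measurable_fun setT (f_ n)) -> measurable_fun setT f ->
  (forall x, f_ n x @[n --> \oo] --> f x) ->
  L1 g -> (forall n x, `|f_ n x| <= g x) ->
  L1 f /\ \int[mu]_x f_ n x @[n --> \oo] --> \int[mu]_x f x.
Proof.
move=> mf_ mf fc lg fg.
have [||||lf _ hc] := @dominated_convergence _ _ _ mu setT measurableT
  (fun n => EFin \o f_ n) (EFin \o f) (EFin \o g) _ _ _ lg.
- by move=> n; apply: (measurable_EFinP _ _).2; exact: mf_.
- by apply: (measurable_EFinP _ _).2; exact: mf.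
- by apply: aeW => x _; apply: cvg_EFin; [exact: nearW | exact: fc].
- by apply: aeW => x n _; rewrite lee_fin.
split => //; apply: fine_cvg; rewrite /= fineK; first exact: hc.
exact: integrable_fin_num.
Qed.

Lemma intE (D : set R) f : \int[mu]_(x in D) f x = \int[mu]_x (f x * \1_D x).
Proof.
rewrite Rintegral_mkcond; apply: eq_Rintegral => x _.
by rewrite patchE indicE; case: ifPn => _ /=; rewrite ?mulr1 ?mulr0.
Qed.

Lemma L1_on (D : set R) f : measurable D ->
  mu.-integrable D (EFin \o f) <-> L1 (fun x => f x * \1_D x).
Proof.
move=> mD.
have E : (EFin \o f) \_ D = EFin \o (fun x => f x * \1_D x).
  apply/funext => x /=; rewrite patchE indicE.
  by case: ifPn => _ /=; rewrite ?mulr1 ?mulr0.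
by rewrite /L1 -E -(integrable_restrict mu mD measurableT) setTI.
Qed.

Lemma L1_indic f (D : set R) : measurable D -> L1 f -> L1 (fun x => f x * \1_D x).
Proof.
move=> mD lf; apply: (@L1_bdd _ _ 1) => // x.
by rewrite indicE; case: (_ \in _); rewrite ?normr1 ?normr0.
Qed.

Lemma L1_cts_itv f (a b : R) : continuous f -> L1 (fun x => f x * \1_`[a, b] x).
Proof.
move=> cf; apply/(@L1_on `[a, b]%classic); first exact: measurable_itv.
apply: continuous_compact_integrable; first exact: segment_compact.
exact: continuous_subspaceT.
Qed.

Lemma cts_measurable f : continuous f -> measurable_fun setT f.
Proof. by move=> cf; exact: continuous_measurable_fun. Qed.

Lemma affine_measurable (a c : R) : measurable_fun setT (fun x : R => a * x + c).
Proof. by apply: measurable_funD => //; exact: measurable_funM. Qed.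

(** By uniqueness of Lebesgue measure it suffices to compare the two sides on half-open intervals;
    for [a < 0] the preimage is closed at the other end, which leaves its length unchanged. *)
Lemma lebesgue_measure_affine (a c : R) (a0 : a != 0) (A : set R) :
  measurable A ->
  let h : R -> measurableTypeR R := fun x => a * x + c in
  mu A = (`|a|%:E * pushforward mu h A)%E.
Proof.
move=> mA h.
have ma := affine_measurable a c.
have ma' : measurable_fun (setT : set (measurableTypeR R)) h by exact: ma.
have a0' : 0 <= `|a| by [].
pose nu : {measure set (measurableTypeR R) -> \bar R} :=
  mscale (NngNum a0') (pushforward mu h).
rewrite (@lebesgue_measure_unique R (nu ma')) //.
move=> _ [[x y] /= _ <-]; rewrite /nu /= /mscale /= /pushforward.
have [xy|xy] := ltP x y; last first.
  rewrite set_itv_ge ?bnd_simp -?leNgt //.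
  by rewrite preimage_set0 !measure0 mule0.
have [a_gt|a_lt|/eqP] := ltgtP a 0; last by rewrite (negbTE a0).
- have -> : (fun t : R => a * t + c) @^-1` `]x, y] =
     `[((y - c) / a), ((x - c) / a)[%classic.
    apply/seteqP; split => t /=; rewrite !in_itv /=.
      move=> /andP[h1 h2]; rewrite ler_ndivrMr ?ltr_ndivlMr // ?[_ * a]mulrC; lra.
    rewrite ler_ndivrMr ?ltr_ndivlMr // ?[_ * a]mulrC; lra.
  rewrite !lebesgue_measure_itv /= !lte_fin xy ltr_ndivrMr // divfK // ltrD2r xy.
  rewrite -!EFinB -EFinM ltr0_norm //; congr EFin; field; exact/ltr0_neq0.
- have -> : (fun t : R => a * t + c) @^-1` `]x, y] =
     `](x - c) / a, (y - c) / a]%classic.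
    apply/seteqP; split => t /=; rewrite !in_itv /=.
      move=> /andP[h1 h2]; rewrite ltr_pdivrMr ?ler_pdivlMr // ?[_ * a]mulrC; lra.
    rewrite ltr_pdivrMr ?ler_pdivlMr // ?[_ * a]mulrC; lra.
  rewrite !lebesgue_measure_itv /= !lte_fin xy ltr_pM2r ?invr_gt0 // ltrD2r xy.
  rewrite -!EFinB -EFinM gtr0_norm //; congr EFin; field; exact/lt0r_neq0.
Qed.

Lemma ge0_integral_affine (a c : R) (a0 : a != 0) (f : R -> \bar R) :
  measurable_fun (setT : set (measurableTypeR R)) f -> (forall x, (0 <= f x)%E) ->
  (\int[mu]_x f x = `|a|%:E * \int[mu]_x f (a * x + c)%R)%E.
Proof.
move=> mf f0.
have ma := affine_measurable a c.
pose h : R -> measurableTypeR R := fun x => a * x + c.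
have ma' : measurable_fun (setT : set (measurableTypeR R)) h by exact: ma.
have a0' : 0 <= `|a| by [].
pose nu : {measure set (measurableTypeR R) -> \bar R} :=
  mscale (NngNum a0') (pushforward mu h).
rewrite (@eq_measure_integral _ _ _ setT (nu ma') mu); last first.
  by move=> A mA _; exact: (lebesgue_measure_affine c a0 mA).
rewrite ge0_integral_mscale //=; congr *%E.
by rewrite (ge0_integral_pushforward ma') //= preimage_setT.
Qed.

Lemma L1_affine (a c : R) f : a != 0 -> L1 f -> L1 (fun x => f (a * x + c)).
Proof.
move=> a0 lf; have mf := L1_measurable lf.
have mfa : measurable_fun setT (fun x => f (a * x + c)).
  by apply: (measurableT_comp mf); exact: affine_measurable.
apply/integrableP; split; first by apply: (measurable_EFinP _ _).2.
case/integrableP: lf => _.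
rewrite (ge0_integral_affine c a0) //; last first.
  by apply: measurableT_comp => //; apply: (measurable_EFinP _ _).2.
have X0 : (0 <= \int[mu]_x `|(EFin \o f) (a * x + c)%R|)%E by apply: integral_ge0.
rewrite /comp; move: X0; case: (\int[mu]_x _)%E => [r| |] //.
  by move=> _ _; rewrite ltry.
by rewrite gt0_muley // lte_fin normr_gt0.
Qed.

Lemma int_affine (a c : R) f : a != 0 -> L1 f ->
  \int[mu]_x f (a * x + c) = `|a|^-1 * \int[mu]_x f x.
Proof.
move=> a0 lf.
have main g : L1 g -> (forall x, 0 <= g x) ->
    \int[mu]_x g (a * x + c) = `|a|^-1 * \int[mu]_x g x.
  move=> lg g0; rewrite /Rintegral [in RHS](ge0_integral_affine c a0) //; last first.
    by apply: (measurable_EFinP _ _).2; exact: L1_measurable.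
  rewrite fineM //; last by apply: integrable_fin_num => //; exact: (L1_affine c a0 lg).
  by rewrite /= mulrA mulVf ?mul1r // normr_eq0.
(* Both [g] and [|f|] are nonnegative, and [f] is their difference. *)
pose g x := `|f x| + f x.
have lg : L1 g by apply: L1D => //; exact: L1_norm.
have ln := L1_norm lf.
have gE x : f x = g x - `|f x| by rewrite /g; ring.
under eq_Rintegral do rewrite gE.
under [in RHS]eq_Rintegral do rewrite gE.
rewrite (@intB (fun x => g (a * x + c)) (fun x => `|f (a * x + c)|)).
- rewrite (intB lg ln) mulrBr -!main //.
  by move=> x; rewrite /g; have := ler_norm (- f x); rewrite normrN; lra.
- exact: L1_affine.
- exact: (L1_affine c a0 ln).
Qed.

(** The product [f x * w t] is integrable on the plane, so a bounded kernel [u] allows the exchange.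
    Trigonometric kernels give Fourier duality, indicator kernels integration by parts. *)
Lemma fubini_mul f (w : R -> R) (u : R -> R -> R) (C : R) :
  L1 f -> L1 w -> measurable_fun setT (fun z : R * R => u z.1 z.2) ->
  (forall x t, `|u x t| <= C) ->
  \int[mu]_x (f x * \int[mu]_t (w t * u x t)) =
  \int[mu]_t (w t * \int[mu]_x (f x * u x t)).
Proof.
move=> lf lw mu_ uC.
have mf := L1_measurable lf; have mw := L1_measurable lw.
pose nn := (mu \x mu)%E.
have mfw : measurable_fun setT (fun z : R * R => f z.1 * w z.2).
  apply: measurable_funM.
    exact: (measurableT_comp mf).
  exact: (measurableT_comp mw).
have ifw : nn.-integrable setT (fun z : R * R => (f z.1 * w z.2)%:E).
  apply/(integrable12ltyP mu mu); first exact: (measurable_EFinP _ _).2.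
  have -> : (\int[mu]_x \int[mu]_y `|(f (x, y).1 * w (x, y).2)%:E| =
             \int[mu]_x (\int[mu]_y `|(w y)%:E| * `|(f x)%:E|))%E.
    apply: eq_integral => x _ /=; rewrite muleC -ge0_integralZl //=.
    - by apply: eq_integral => y _; rewrite normrM EFinM.
    - by apply: (measurable_EFinP _ _).2; exact: measurableT_comp mw.
  rewrite ge0_integralZl //=.
  - by apply: lte_mul_pinfty => //;
     [exact: integral_ge0 | exact: integrable_fin_num (integrable_abse lw)
     | case/integrableP: lf].
  - by apply: (measurable_EFinP _ _).2; exact: measurableT_comp mf.
  - by apply: integral_ge0.
have iF : nn.-integrable setT (fun z : R * R => (f z.1 * w z.2 * u z.1 z.2)%:E).
  have iC := integrableZl measurableT C (integrable_abse ifw).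
  apply: (le_integrable measurableT _ _ iC).
    by apply: (measurable_EFinP _ _).2; exact: measurable_funM.
  move=> z _ /=; rewrite lee_fin normrM mulrC [leRHS]ger0_norm.
    by rewrite ler_wpM2r.
  by rewrite mulr_ge0 // (le_trans _ (uC 0 0)).
have := Fubini iF.
have E1 x : (\int[mu]_y ((f (x, y).1 * w (x, y).2 * u (x, y).1 (x, y).2)%:E) =
   (f x * \int[mu]_t (w t * u x t))%:E)%E.
  have lwu : L1 (fun t => w t * u x t).
    apply: (L1_bdd lw _ (uC x)).
    exact: (measurable_fun_pair2 x mu_).
  rewrite -intZ // /Rintegral fineK.
    by apply: eq_integral => y _ /=; rewrite mulrA.
  by apply: integrable_fin_num => //; exact: (L1Z (f x) lwu).
have E2 y : (\int[mu]_x ((f (x, y).1 * w (x, y).2 * u (x, y).1 (x, y).2)%:E) =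
   (w y * \int[mu]_x (f x * u x y))%:E)%E.
  have lwu : L1 (fun x => f x * u x y).
    apply: (L1_bdd lf _ (uC ^~ y)).
    exact: (measurable_fun_pair1 y mu_).
  rewrite -intZ // /Rintegral fineK.
    by apply: eq_integral => x _ /=; rewrite mulrA [w y * _]mulrC.
  by apply: integrable_fin_num => //; exact: (L1Z (w y) lwu).
under eq_integral do rewrite E1.
under [in X in _ = X -> _]eq_integral do rewrite E2.
by rewrite /Rintegral => ->.
Qed.

End L1_toolbox.

(** * Fundamental theorem of calculus and explicit transforms *)

Section calculus.
Context {R : realType}.
Notation mu := (@lebesgue_measure R).
Implicit Types f g F : R -> R.

Lemma is_derive_continuous F f : (forall x : R, is_derive x 1 F (f x)) -> continuous F.
Proof.
move=> dF x; apply: differentiable_continuous; apply/derivable1_diffP.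
by have [] := dF x.
Qed.

Lemma ftc_itv F f (a b : R) : a <= b -> (forall x : R, is_derive x 1 F (f x)) ->
  continuous f -> \int[mu]_(x in `[a, b]) f x = F b - F a.
Proof.
move=> ab dF cf; have cF := is_derive_continuous dF.
move: ab; rewrite le_eqVlt => /predU1P[->|ab].
  by rewrite set_itv1 Rintegral_set1 subrr.
rewrite /Rintegral (@continuous_FTC2 _ f F) //.
- exact: continuous_subspaceT.
- split; last 2 first.
  + by apply: cvg_at_right_filter; exact: cF.
  + by apply: cvg_at_left_filter; exact: cF.
  by move=> x _; have [] := dF x.
- by move=> x _; rewrite derive1E; have [_ ->] := dF x.
Qed.

Lemma int_FTC_ge0 F f (l : R) : (forall x : R, is_derive x 1 F (f x)) ->
  continuous f -> (forall x, 0 <= x -> 0 <= f x) -> F x @[x --> +oo] --> l ->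
  L1 (fun x => f x * \1_`[0, +oo[ x) /\
  \int[mu]_x (f x * \1_`[0, +oo[ x) = l - F 0.
Proof.
move=> dF cf f0 Fl; have cF := is_derive_continuous dF.
have E : (\int[mu]_(x in `[0%R, +oo[) (f x)%:E = l%:E - (F 0)%:E)%E.
  apply: ge0_continuous_FTC2y => //.
  - exact: continuous_subspaceT.
  - by apply: cvg_at_right_filter; exact: cF.
  - by move=> x _; rewrite derive1E; have [_ ->] := dF x.
split; last by rewrite -intE /Rintegral E.
apply/(@L1_on _ `[0, +oo[%classic); first exact: measurable_itv.
apply/integrableP; split.
  apply: (measurable_EFinP _ _).2; apply: measurable_funTS.
  exact: cts_measurable.
rewrite (_ : (\int[mu]_(x in `[0%R, +oo[) _)%E = (l%:E - (F 0)%:E)%E) ?ltry //.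
rewrite -E; apply: eq_integral => x /set_mem /=; rewrite in_itv /= andbT => x0.
by rewrite ger0_norm // f0.
Qed.

(** The integrand may change sign: finite intervals are treated by the fundamental theorem, and
    integrability supplies the domination for the limit. *)
Lemma int_FTC F f (l : R) : (forall x : R, is_derive x 1 F (f x)) ->
  continuous f -> L1 (fun x => f x * \1_`[0, +oo[ x) -> F x @[x --> +oo] --> l ->
  \int[mu]_x (f x * \1_`[0, +oo[ x) = l - F 0.
Proof.
move=> dF cf lf Fl.
have [||x|||_ c] := @dct _ (fun n x => f x * \1_`[0, n%:R] x)
  (fun x => f x * \1_`[0, +oo[ x) (fun x => `|f x * \1_`[0, +oo[ x|).
- by move=> n; apply: L1_measurable; exact: L1_cts_itv.
- exact: L1_measurable.
- apply: cvg_near_cst; near=> n.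
  have xn : x <= n%:R by near: n; exact: nbhs_infty_ger.
  by rewrite !indicE !mem_setE !in_itv /= xn andbT.
- exact: L1_norm.
- move=> n x; rewrite !normrM ler_wpM2l // !indicE !mem_setE !in_itv /= andbT.
  by case: (0 <= x); case: (x <= _); rewrite //= ?normr0 ?normr1.
apply: (cvg_unique _ c) => //.
have -> : (fun n => \int[mu]_x (f x * \1_`[0, n%:R] x)) = (fun n => F n%:R - F 0).
  by apply/funext => n; rewrite -intE (ftc_itv _ dF).
apply: cvgB; last exact: cvg_cst.
exact: (cvg_comp _ _ (@cvgr_idn R) Fl).
Unshelve. all: by end_near.
Qed.

Lemma is_derive_expR_lin (c x : R) :
  is_derive x 1 (fun x => expR (c * x)) (c * expR (c * x)).
Proof. by apply: is_derive_eq; rewrite /GRing.scale /=; ring. Qed.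

Lemma is_derive_cos_lin (c x : R) :
  is_derive x 1 (fun x => cos (c * x)) (- c * sin (c * x)).
Proof. by apply: is_derive_eq; rewrite /GRing.scale /=; ring. Qed.

Lemma is_derive_sin_lin (c x : R) :
  is_derive x 1 (fun x => sin (c * x)) (c * cos (c * x)).
Proof. by apply: is_derive_eq; rewrite /GRing.scale /=; ring. Qed.

Lemma int_even f : (forall x, f (- x) = f x) -> L1 (fun x => f x * \1_`[0, +oo[ x) ->
  L1 f /\ \int[mu]_x f x = 2 * \int[mu]_x (f x * \1_`[0, +oo[ x).
Proof.
move=> fE lf.
have l1 : L1 (fun x => f (-1 * x + 0) * \1_`[0, +oo[ (-1 * x + 0)).
  by apply: (L1_affine 0 _ lf); rewrite oppr_eq0 oner_eq0.
have l2 : L1 (fun x => f x * \1_`]0, +oo[ x).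
  have := L1_indic (measurable_itv `]0, +oo[) lf.
  congr L1; apply/funext => x; rewrite -mulrA !indicE !mem_setE !in_itv /= !andbT.
  by case: ltP => [/ltW ->|]; rewrite ?mulr1 ?mulr0.
have fD x : f x = f (-1 * x + 0) * \1_`[0, +oo[ (-1 * x + 0) + f x * \1_`]0, +oo[ x.
  rewrite mulN1r addr0 fE !indicE !mem_setE !in_itv /= !andbT oppr_ge0.
  by case: leP; rewrite ?mulr1 ?mulr0 ?addr0 ?add0r.
split; first by have := L1D l1 l2; congr L1; apply/funext => x; rewrite -fD.
rewrite (eq_int fD) intD //.
rewrite (@int_affine _ (-1) 0 (fun x => f x * \1_`[0, +oo[ x)) ?oppr_eq0 ?oner_eq0 //.
rewrite normrN1 invr1 mul1r -!intE Rintegral_itv_obnd_cbnd; first by ring.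
exact/(@L1_on _ `]0, +oo[%classic).
Qed.

Lemma poisson_int : L1 (fun x : R => (1 + x ^+ 2)^-1) /\
  \int[mu]_x ((1 + x ^+ 2)^-1) = pi.
Proof.
have d0 (x : R) : 1 + x ^+ 2 != 0 by rewrite gt_eqF // ltr_pwDl ?sqr_ge0.
have c : continuous (fun x : R => (1 + x ^+ 2)^-1).
  move=> x; apply: cvgV => //; apply: cvgD; first exact: cvg_cst.
  exact: exprn_continuous.
have [||l1 l2] := @int_FTC_ge0 (@atan R) (fun x => (1 + x ^+ 2)^-1) (pi / 2) _ c.
- by move=> x _; rewrite invr_ge0 addr_ge0 ?sqr_ge0.
- exact: cvgy_atan.
have [|//|-> ->] := @int_even (fun x => (1 + x ^+ 2)^-1).
  by move=> x; rewrite sqrrN.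
by split => //; rewrite l2 atan0; field.
Qed.

Lemma cvg_mul_pinfty (e : R) : 0 < e -> e * x @[x --> +oo] --> +oo.
Proof.
move=> e0; apply/cvgryPge => A; near=> x.
by rewrite -ler_pdivrMl //; near: x; exact: nbhs_pinfty_ge.
Unshelve. all: by end_near.
Qed.

Lemma expR_lin_cvg0 (e : R) : 0 < e -> expR (- e * x) @[x --> +oo] --> (0 : R).
Proof.
move=> e0; have := cvg_comp _ _ (cvg_mul_pinfty e0) (@cvgr_expR R).
by apply: cvg_trans; rewrite /comp /=; under [X in X @ _]eq_fun do rewrite mulNr.
Qed.

Lemma L1_exp (e : R) : 0 < e -> L1 (fun x => expR (- e * x) * \1_`[0, +oo[ x).
Proof.
move=> e0.
have dF (x : R) : is_derive x 1 (fun x => - e^-1 * expR (- e * x)) (expR (- e * x)).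
  apply: is_derive_eq; rewrite /GRing.scale /=; field; exact: lt0r_neq0.
have [|||//] := @int_FTC_ge0 (fun x => - e^-1 * expR (- e * x)) _ 0 dF.
- exact: is_derive_continuous (is_derive_expR_lin (- e)).
- by move=> x _; exact: expR_ge0.
- by rewrite -[X in _ --> X](mulr0 (- e^-1)); apply: cvgMl_tmp; exact: expR_lin_cvg0.
Qed.

Lemma continuous_cos_lin (c : R) : continuous (fun x => cos (c * x)).
Proof. exact: is_derive_continuous (is_derive_cos_lin c). Qed.

Lemma continuous_sin_lin (c : R) : continuous (fun x => sin (c * x)).
Proof. exact: is_derive_continuous (is_derive_sin_lin c). Qed.

Lemma norm_cos_le1 (x : R) : `|cos x| <= 1.
Proof. by rewrite ler_norml cos_le1 cos_geN1. Qed.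

Lemma norm_sin_le1 (x : R) : `|sin x| <= 1.
Proof. by rewrite ler_norml sin_le1 sin_geN1. Qed.

Lemma L1_cos f (c : R) : L1 f -> L1 (fun x => f x * cos (c * x)).
Proof.
move=> lf; apply: (L1_bdd lf) (fun x => norm_cos_le1 _).
by apply: cts_measurable; exact: continuous_cos_lin.
Qed.

Lemma L1_sin f (c : R) : L1 f -> L1 (fun x => f x * sin (c * x)).
Proof.
move=> lf; apply: (L1_bdd lf) (fun x => norm_sin_le1 _).
by apply: cts_measurable; exact: continuous_sin_lin.
Qed.

Lemma bounded_mul_cvg0 (T : Type) (F : set_system T) {FF : Filter F} (f g : T -> R) (C : R) :
  f x @[x --> F] --> (0 : R) -> (forall x, `|g x| <= C) ->
  f x * g x @[x --> F] --> (0 : R).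
Proof.
move=> f0 gC; apply/cvgr0Pnorm_lt => e e0.
have C1 : 0 < `|C| + 1 by rewrite ltr_pwDr.
move/cvgr0Pnorm_lt : f0 => /(_ _ (divr_gt0 e0 C1)).
apply: filterS => x; rewrite ltr_pdivlMr //.
apply: le_lt_trans; rewrite normrM ler_wpM2l //.
by rewrite (le_trans (gC x)) // (le_trans (ler_norm _)) // lerDl.
Qed.

Lemma laplace_cos_sin (e t : R) : 0 < e ->
  \int[mu]_x (expR (- e * x) * \1_`[0, +oo[ x * cos (t * x)) = e / (e ^+ 2 + t ^+ 2) /\
  \int[mu]_x (expR (- e * x) * \1_`[0, +oo[ x * sin (t * x)) = t / (e ^+ 2 + t ^+ 2).
Proof.
move=> e0.
have d0 : e ^+ 2 + t ^+ 2 != 0 by rewrite gt_eqF // ltr_pwDl ?sqr_ge0 ?exprn_gt0.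
have ce : continuous (fun x => expR (- e * x)).
  exact: is_derive_continuous (is_derive_expR_lin (- e)).
have dC (x : R) : is_derive x 1 (fun x => (e ^+ 2 + t ^+ 2)^-1 *
    (expR (- e * x) * (t * sin (t * x) - e * cos (t * x)))) (expR (- e * x) * cos (t * x)).
  by apply: is_derive_eq; rewrite /GRing.scale /=; field.
have dS (x : R) : is_derive x 1 (fun x => (e ^+ 2 + t ^+ 2)^-1 *
    (expR (- e * x) * (- e * sin (t * x) - t * cos (t * x)))) (expR (- e * x) * sin (t * x)).
  by apply: is_derive_eq; rewrite /GRing.scale /=; field.
have lim0 (u v : R) : (e ^+ 2 + t ^+ 2)^-1 *
    (expR (- e * x) * (u * sin (t * x) - v * cos (t * x))) @[x --> +oo] --> (0 : R).
  rewrite -[X in _ --> X](mulr0 (e ^+ 2 + t ^+ 2)^-1); apply: cvgMl_tmp.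
  apply: (@bounded_mul_cvg0 _ _ _ _ _ (`|u| + `|v|)); first exact: expR_lin_cvg0.
  move=> x; rewrite (le_trans (ler_normB _ _)) // !normrM lerD // ler_piMr //.
  - exact: norm_sin_le1.
  - exact: norm_cos_le1.
have lC := L1_cos t (L1_exp e0); have lS := L1_sin t (L1_exp e0).
have E (f : R -> R) x : expR (- e * x) * \1_`[0, +oo[ x * f x =
  expR (- e * x) * f x * \1_`[0, +oo[ x by ring.
split.
- rewrite (eq_int (E (fun x => cos (t * x)))) (int_FTC dC _ _ (lim0 t e)).
  + by rewrite !mulr0 expR0 sin0 cos0; field.
  + by move=> x; apply: cvgM; [exact: ce|exact: continuous_cos_lin].
  + exact: eq_L1 (E (fun x => cos (t * x))) lC.
- rewrite (eq_int (E (fun x => sin (t * x)))) (int_FTC dS _ _ (lim0 (- e) t)).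
  + by rewrite !mulr0 expR0 sin0 cos0; field.
  + by move=> x; apply: cvgM; [exact: ce|exact: continuous_sin_lin].
  + exact: eq_L1 (E (fun x => sin (t * x))) lS.
Qed.

Lemma measurable_cos_prod : measurable_fun setT (fun z : R * R => cos (z.2 * z.1)).
Proof.
apply: (@measurableT_comp _ _ _ _ _ _ (@cos R)).
  by apply: cts_measurable; exact: continuous_cos.
exact: measurable_funM.
Qed.

Lemma abel_kernel (e : R) : 0 < e ->
  L1 (fun x => expR (- e * `|x|)) /\
  forall u, \int[mu]_x (expR (- e * `|x|) * cos (u * x)) = 2 * (e / (e ^+ 2 + u ^+ 2)).
Proof.
move=> e0.
have E x : expR (- e * x) * \1_`[0, +oo[ x = expR (- e * `|x|) * \1_`[0, +oo[ x.
  rewrite !indicE !mem_setE !in_itv /= andbT; case: leP => x0; last by rewrite !mulr0.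
  by rewrite ger0_norm.
split.
  apply: (int_even _ _).1; first by move=> x; rewrite normrN.
  exact: eq_L1 E (L1_exp e0).
move=> u; have [lc _] := laplace_cos_sin u e0.
have F x : expR (- e * x) * \1_`[0, +oo[ x * cos (u * x) =
    expR (- e * `|x|) * cos (u * x) * \1_`[0, +oo[ x by rewrite E; ring.
have [||_ ->] := @int_even (fun x => expR (- e * `|x|) * cos (u * x)).
- by move=> x; rewrite normrN mulrN cosN.
- exact: eq_L1 F (L1_cos u (L1_exp e0)).
- by rewrite -lc (eq_int F).
Qed.

Lemma cvg_inv_nat : ((n.+1%:R)^-1 : R) @[n --> \oo] --> (0 : R).
Proof. exact: cvg_harmonic. Qed.

(** Abel summation: the factor [expR (- e |x|)] makes Fubini applicable and turns the left side into
    the integral of [phi] against [2 e / (e ^ 2 + u ^ 2)], a Poisson kernel of mass [2 pi]. The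
    substitution [u = e v] fixes the kernel, and dominated convergence in [e] leaves [phi 0]. *)
Lemma cos_transform_int (phi : R -> R) (C : R) :
  L1 phi -> (forall x, `|phi x| <= C) -> {for 0, continuous phi} ->
  L1 (fun x => \int[mu]_u (phi u * cos (u * x))) ->
  \int[mu]_x (\int[mu]_u (phi u * cos (u * x))) = 2 * pi * phi 0.
Proof.
move=> lphi phiC cphi lPhi; set Phi := fun x => _ in lPhi *.
have mphi := L1_measurable lphi; have mPhi := L1_measurable lPhi.
pose e n : R := n.+1%:R^-1.
have e0 n : 0 < e n by rewrite invr_gt0.
have ecvg : e n @[n --> \oo] --> 0 by exact: cvg_inv_nat.
have [lP iP] := poisson_int.
have main n : \int[mu]_x (Phi x * expR (- e n * `|x|)) =
    \int[mu]_v (phi (e n * v) * (2 * (1 + v ^+ 2)^-1)).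
  have [la ia] := abel_kernel (e0 n).
  transitivity (\int[mu]_x (expR (- e n * `|x|) * Phi x)).
    by apply: eq_int => x; rewrite mulrC.
  rewrite (fubini_mul la lphi measurable_cos_prod (fun x t => norm_cos_le1 _)).
  have en0 : e n != 0 by rewrite lt0r_neq0.
  have lk : L1 (fun u => phi u * (2 * (e n / (e n ^+ 2 + u ^+ 2)))).
    apply: (@L1_bdd _ _ _ (2 / e n) lphi).
      apply: cts_measurable => x; apply: cvgM; first exact: cvg_cst.
      apply: cvgM; first exact: cvg_cst.
      apply: cvgV; first by rewrite gt_eqF // ltr_pwDl ?sqr_ge0 ?exprn_gt0.
      by apply: cvgD; [exact: cvg_cst | exact: exprn_continuous].
    move=> x; rewrite ger0_norm; last first.
      by rewrite mulr_ge0 // divr_ge0 ?addr_ge0 ?sqr_ge0 // ltW.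
    rewrite ler_pM2l // ler_pdivrMr ?ltr_pwDl ?sqr_ge0 ?exprn_gt0 //.
    by rewrite mulrDr expr2 mulKf // lerDl mulr_ge0 ?sqr_ge0 // invr_ge0 ltW.
  have := int_affine 0 en0 lk; rewrite gtr0_norm // => /(congr1 ( *%R (e n))).
  rewrite mulVKf // => E.
  rewrite (@eq_int _ _ (fun u => phi u * (2 * (e n / (e n ^+ 2 + u ^+ 2))))); last first.
    by move=> u; rewrite ia.
  rewrite -E -intZ; last exact: (L1_affine 0 en0 lk).
  apply: eq_int => v; rewrite addr0.
  have d1 : 1 + v ^+ 2 != 0 by rewrite gt_eqF // ltr_pwDl ?sqr_ge0.
  have d2 : e n ^+ 2 + (e n * v) ^+ 2 != 0.
    by rewrite gt_eqF // ltr_pwDl ?sqr_ge0 ?exprn_gt0.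
  field; rewrite d1 /=.
  by rewrite (_ : e n ^+ 2 + _ = e n ^+ 2 + (e n * v) ^+ 2) //; ring.
have c1 : \int[mu]_x (Phi x * expR (- e n * `|x|)) @[n --> \oo] --> \int[mu]_x Phi x.
  apply: (dct _ mPhi _ (L1_norm lPhi) _).2.
  - move=> n; apply: measurable_funM => //.
    by apply: L1_measurable; have [] := abel_kernel (e0 n).
  - move=> x; rewrite -[X in _ --> X]mulr1; apply: cvgM; first exact: cvg_cst.
    rewrite -(@expR0 R); apply: continuous_cvg; first exact: continuous_expR.
    rewrite -(mul0r `|x|); apply: cvgM; last exact: cvg_cst.
    by rewrite -oppr0; apply: cvgN.
  - move=> n x; rewrite normrM ler_piMr // ger0_norm ?expR_ge0 // expR_le1.
    by rewrite mulNr oppr_le0 mulr_ge0 // ltW.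
have c2 : \int[mu]_v (phi (e n * v) * (2 * (1 + v ^+ 2)^-1)) @[n --> \oo] -->
    \int[mu]_v (phi 0 * (2 * (1 + v ^+ 2)^-1)).
  have mp : measurable_fun setT (fun v : R => 2 * (1 + v ^+ 2)^-1).
    exact: L1_measurable (L1Z 2 lP).
  apply: (dct _ _ _ (L1Z C (L1Z 2 lP)) _).2.
  - move=> n; apply: measurable_funM => //; apply: (measurableT_comp mphi).
    exact: measurable_funM.
  - exact: measurable_funM.
  - move=> v; apply: cvgM; last exact: cvg_cst.
    apply: (@continuous_cvg _ _ _ _ _ (fun n => e n * v) phi 0) => //.
    by rewrite -(mul0r v); apply: cvgM => //; exact: cvg_cst.
  - move=> n v; rewrite normrM ler_pM // ger0_norm //.
    by rewrite mulr_ge0 // invr_ge0 addr_ge0 ?sqr_ge0.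
rewrite -(cvg_lim _ c1) // (_ : (fun n => _) = (fun n => \int[mu]_v (phi (e n * v) * (2 * (1 + v ^+ 2)^-1)))); last first.
  exact/funext.
rewrite (cvg_lim _ c2) // intZ; last exact: L1Z.
by rewrite intZ // iP; ring.
Qed.

End calculus.

(** * Smoothness through classes closed under differentiation *)

Section smooth_functions.
Context {R : realType}.
Notation mu := (@lebesgue_measure R).
Implicit Types f g F : R -> R.

Definition smoothr f := forall (n : nat) (x : R), derivable (derive1n n f) x 1.

(** Membership in a class closed under differentiation passes to all iterated derivatives by
    induction; a smoothness proof then only has to exhibit such a class, never an n-th
    derivative. *)
Lemma smoothr_class (S : (R -> R) -> Prop) :
  (forall f, S f -> exists2 g, S g & forall x : R, is_derive x 1 f (g x)) ->
  forall f, S f -> smoothr f.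
Proof.
move=> dS f Sf n.
suff : S (derive1n n f) by move=> /dS[g _ dg] x; have [] := dg x.
elim: n => [//|n /dS[g Sg dg]]; rewrite derive1nS.
rewrite (_ : (derive1 _) = g) //; apply/funext => x.
by rewrite derive1E; have [_ ->] := dg x.
Qed.

Lemma smoothr_derive f : smoothr f -> forall x : R, is_derive x 1 f (derive1 f x).
Proof. by move=> sf x; rewrite derive1E; apply/derivableP; exact: (sf 0%N x). Qed.

Lemma smoothr_derive1 f : smoothr f -> smoothr (derive1 f).
Proof. by move=> sf n; rewrite -derive1Sn; exact: sf. Qed.

Lemma smoothr_continuous f : smoothr f -> continuous f.
Proof. by move=> /smoothr_derive; exact: is_derive_continuous. Qed.

(** By the product rule sums of products of smooth functions are closed under differentiation, while
    single products are not. *)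
Inductive prod_span : (R -> R) -> Prop :=
| ProdSpanM f g of smoothr f & smoothr g : prod_span (fun x => f x * g x)
| ProdSpanD f g of prod_span f & prod_span g : prod_span (fun x => f x + g x).

Lemma prod_span_smoothr f : prod_span f -> smoothr f.
Proof.
apply: smoothr_class => {}f; elim => {f} [f g sf sg|f g _ [f' pf df] _ [g' pg dg]].
  exists (fun x => f x * derive1 g x + derive1 f x * g x).
    exact: ProdSpanD (ProdSpanM sf (smoothr_derive1 sg)) (ProdSpanM (smoothr_derive1 sf) sg).
  move=> x; have df := smoothr_derive sf x; have dg := smoothr_derive sg x.
  by apply: is_derive_eq; rewrite /GRing.scale /=; ring.
exists (fun x => f' x + g' x); first exact: ProdSpanD.
by move=> x; have := df x; have := dg x => ? ?; apply: is_derive_eq.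
Qed.

Lemma smoothrM f g : smoothr f -> smoothr g -> smoothr (fun x => f x * g x).
Proof. by move=> sf sg; apply: prod_span_smoothr; exact: ProdSpanM. Qed.

Lemma smoothr_cst (c : R) : smoothr (fun=> c).
Proof.
apply: (@smoothr_class (fun f => exists c : R, f = (fun=> c))); last by exists c.
move=> _ [d ->]; exists (fun=> 0); first by exists 0.
by move=> x; exact: is_derive_cst.
Qed.

Lemma smoothrD f g : smoothr f -> smoothr g -> smoothr (fun x => f x + g x).
Proof.
move=> sf sg; rewrite (_ : (fun x => _) = (fun x => f x * 1 + g x * 1)).
  apply: prod_span_smoothr.
  have s1 : smoothr (fun=> 1) by exact: smoothr_cst.
  by have := ProdSpanD (ProdSpanM sf s1) (ProdSpanM sg s1).
by apply/funext => x; rewrite !mulr1.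
Qed.

Lemma is_derive_affine (a b : R) f (df x : R) : is_derive (a * x + b) 1 f df ->
  is_derive x 1 (fun x => f (a * x + b)) (a * df).
Proof.
move=> dfx.
have da : is_derive x 1 (fun x : R => a * x + b) a.
  by apply: is_derive_eq; rewrite /GRing.scale /= mulr1 addr0.
rewrite mulrC; exact: (@is_derive1_comp _ f (fun x => a * x + b) x _ _ dfx da).
Qed.

Lemma smoothr_affine (a b : R) f : smoothr f -> smoothr (fun x => f (a * x + b)).
Proof.
move=> sf; apply: (@smoothr_class (fun h => exists2 c : R, exists2 f, smoothr f & h = (fun x => c * f (a * x + b)) & True)).
  move=> _ [c [{sf}f sf ->] _]; exists (fun x => c * a * derive1 f (a * x + b)).
    by exists (c * a) => //; exists (derive1 f) => //; exact: smoothr_derive1.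
  move=> x; have := is_derive_affine (smoothr_derive sf (a * x + b)) => d.
  by apply: is_derive_eq; rewrite /GRing.scale /=; ring.
by exists 1 => //; exists f => //; apply/funext => x; rewrite mul1r.
Qed.

Lemma smoothr_id : smoothr id.
Proof.
apply: (@smoothr_class (fun h => exists a b : R, h = (fun x => a * x + b))).
  move=> _ [a [b ->]]; exists (fun=> 0 * 0 + a); first by exists 0, a; apply/funext => x; rewrite !mul0r.
  by move=> x; apply: is_derive_eq; rewrite /GRing.scale /=; ring.
by exists 1, 0; apply/funext => x; rewrite mul1r addr0.
Qed.

Lemma is_derive_cos_affine (a b x : R) :
  is_derive x 1 (fun x => cos (a * x + b)) (- a * sin (a * x + b)).
Proof. rewrite mulNr -mulrN; exact: is_derive_affine (is_derive_cos (a * x + b)). Qed.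

Lemma is_derive_sin_affine (a b x : R) :
  is_derive x 1 (fun x => sin (a * x + b)) (a * cos (a * x + b)).
Proof. exact: is_derive_affine (is_derive_sin (a * x + b)). Qed.

Lemma smoothr_cos (a b : R) : smoothr (fun x => cos (a * x + b)).
Proof.
apply: (@smoothr_class (fun h => exists c b : R, h = (fun x => c * cos (a * x + b)))).
  move=> _ [c [d ->]]; exists (fun x => c * a * cos (a * x + (d + pi / 2))).
    by exists (c * a), (d + pi / 2).
  move=> x; have d1 := is_derive_cos_affine a d x.
  by apply: is_derive_eq; rewrite /GRing.scale /= addrA cosDpihalf; ring.
by exists 1, b; apply/funext => x; rewrite mul1r.
Qed.

Lemma smoothr_sin (a b : R) : smoothr (fun x => sin (a * x + b)).
Proof.
rewrite (_ : (fun x => _) = (fun x => cos (a * x + (b - pi / 2)))); first exact: smoothr_cos.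
by apply/funext => x; rewrite addrA -[in LHS](subrK (pi / 2) (a * x + b)) sinDpihalf.
Qed.

End smooth_functions.

(** * A smooth compactly supported bump *)

Section bumps.
Context {R : realType}.
Notation mu := (@lebesgue_measure R).
Implicit Types (f g F : R -> R) (p : {poly R}).

Lemma expR_pow_bound (k : nat) (y : R) : 0 <= y -> y ^+ k * expR (- y) <= k`!%:R.
Proof.
move=> y0; rewrite expRN -ler_pdivlMr ?invr_gt0 ?expR_gt0 // invrK.
case: k => [|k]; first by rewrite mul1r; have := expR_ge1Dx y; lra.
rewrite mulrC -ler_pdivrMr ?ltr0n ?fact_gt0 //.
by have := expR_ge1Dxn k y0; lra.
Qed.

Lemma poly_exp_bound p (k : nat) : exists C : R, forall y, 0 <= y ->
  `|p.[y]| * y ^+ k * expR (- y) <= C.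
Proof.
elim/poly_ind: p k => [|p c IH] k.
  by exists 0 => y _; rewrite horner0 normr0 !mul0r.
have [C hC] := IH k.+1; exists (C + `|c| * k`!%:R) => y y0.
have e0 := expR_ge0 (- y); have yk : 0 <= y ^+ k by rewrite exprn_ge0.
have h1 := hC y y0; have h2 := ler_wpM2l (normr_ge0 c) (expR_pow_bound k y0).
rewrite hornerMXaddC; apply: le_trans (lerD h1 h2).
rewrite !mulrA -mulrDl ler_wpM2r // exprS mulrA -mulrDl ler_wpM2r //.
by rewrite (le_trans (ler_normD _ _)) // normrM (ger0_norm y0).
Qed.

(** Every derivative of [exp (- 1 / x)], extended by 0, has this form: differentiation replaces [p]
    by [X^2 (p - p')], so the polynomial parameter makes the class closed. *)
Definition flat_exp p (x : R) : R := if 0 < x then p.[x^-1] * expR (- x^-1) else 0.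

(** Used at the origin, where a quadratic bound alone makes the difference quotient tend to 0. *)
Lemma flat_exp_sqr p : exists C : R, forall x, `|flat_exp p x| <= C * x ^+ 2.
Proof.
have [C hC] := poly_exp_bound p 2; exists `|C| => x; rewrite /flat_exp.
case: ltP => x0; last by rewrite normr0 mulr_ge0 ?sqr_ge0.
have y0 : 0 <= x^-1 by rewrite invr_ge0 ltW.
have := le_trans (hC _ y0) (ler_norm C).
rewrite normrM [`|expR _|]ger0_norm ?expR_ge0 //.
rewrite mulrAC exprVn ler_pdivrMr ?exprn_gt0 //.
Qed.

Lemma is_derive_sqr_bound f (C : R) : (forall x, `|f x| <= C * x ^+ 2) ->
  is_derive (0 : R) 1 f 0.
Proof.
move=> fC.
have f00 : f 0 = 0.
  by apply/eqP; rewrite -normr_le0; have := fC 0; rewrite expr0n mulr0.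
have c : h^-1 *: ((f \o shift 0) h%:A - f 0) @[h --> (0:R)^'] --> (0 : R).
  apply/cvgr0Pnorm_lt => e e0.
  have C1 : 0 < `|C| + 1 by rewrite ltr_pwDr.
  near=> h.
  have h0 : h != 0 by near: h; exact: nbhs_dnbhs_neq.
  have hn : `|h| < e / (`|C| + 1).
    near: h; apply: dnbhs0_lt; exact: divr_gt0.
  rewrite /= f00 subr0 addr0 /GRing.scale /= mulr1 normrM normfV mulrC.
  rewrite ltr_pdivrMr ?normr_gt0 //.
  apply: (le_lt_trans (fC h)).
  rewrite -real_normK ?num_real // expr2 mulrA ltr_pM2r ?normr_gt0 //.
  move: hn; rewrite ltr_pdivlMr // => hn; apply: le_lt_trans hn.
  rewrite mulrC ler_wpM2l // (le_trans (ler_norm _)) // lerDl //.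
apply: DeriveDef; first by apply/cvg_ex; exists 0.
exact/cvg_lim.
Unshelve. all: by end_near.
Qed.

Lemma is_derive_flat_exp p (x : R) :
  is_derive x 1 (flat_exp p) (flat_exp ('X^2 * (p - p^`())%R) x).
Proof.
have [x0|x0|->] := ltgtP x 0.
- rewrite {2}/flat_exp ltNge (ltW x0) /=.
  apply: (@near_eq_is_derive _ _ _ (fun=> 0) (flat_exp p)).
  near=> y; rewrite /flat_exp ltNge ifN // negbK ltW //.
  by near: y; apply: lt_nbhsl.
- rewrite {2}/flat_exp x0.
  have x0' : x != 0 by rewrite gt_eqF.
  have dV : is_derive x 1 (fun x : R => x^-1) (- x ^- 2).
    have := @is_deriveV _ id x 1 1 x0' _; rewrite /GRing.scale /= mulr1; exact.
  have dp : is_derive x 1 (fun x : R => p.[x^-1]) (p^`().[x^-1] * - x ^- 2).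
    exact: (@is_derive1_comp _ (horner p) (fun x => x^-1)).
  have de : is_derive x 1 (fun x : R => expR (- x^-1)) (expR (- x^-1) * x ^- 2).
    have dN : is_derive x 1 (fun x : R => - x^-1) (x ^- 2).
      by apply: is_derive_eq; rewrite opprK.
    exact: (@is_derive1_comp _ (@expR R) (fun x => - x^-1)).
  have D : is_derive x 1 (fun x => p.[x^-1] * expR (- x^-1))
      (('X^2 * (p - p^`())).[x^-1] * expR (- x^-1)).
    by apply: is_derive_eq; rewrite /GRing.scale /= hornerM hornerXn hornerD hornerN exprVn; ring.
  apply: near_eq_is_derive D.
  near=> y; rewrite /flat_exp ifT //.
  by near: y; apply: lt_nbhsr.
- rewrite {2}/flat_exp ltxx; have [C hC] := flat_exp_sqr p.
  exact: is_derive_sqr_bound hC.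
Unshelve. all: by end_near.
Qed.

Lemma smoothr_flat_exp p : smoothr (flat_exp p).
Proof.
apply: (@smoothr_class _ (fun h => exists p, h = flat_exp p)); last by exists p.
move=> _ [q ->]; eexists; last exact: is_derive_flat_exp.
by eexists.
Qed.

Definition Cc (A : R) f := smoothr f /\ forall x, A < `|x| -> f x = 0.

Definition bump0 (t : R) : R := flat_exp 1 (1 + t) * flat_exp 1 (1 - t).

Lemma bump0_Cc : Cc 1 bump0.
Proof.
split.
  apply: smoothrM.
    by have := @smoothr_affine _ 1 1 _ (@smoothr_flat_exp 1); congr smoothr; apply/funext => x; rewrite mul1r addrC.
  by have := @smoothr_affine _ (-1) 1 _ (@smoothr_flat_exp 1); congr smoothr; apply/funext => x; rewrite mulN1r addrC.
move=> x; rewrite /bump0 /flat_exp; case: (ltP 0 (1 + x)) => h1; last by rewrite mul0r.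
by case: (ltP 0 (1 - x)) => h2; rewrite ?mulr0 // ltNge ler_norml; lra.
Qed.

Lemma bump0_ge0 t : 0 <= bump0 t.
Proof. by rewrite /bump0 /flat_exp !hornerE; do 2 case: ifP; rewrite ?mulr0 ?mul0r // mulr_ge0 ?expR_ge0. Qed.

Lemma bump0N t : bump0 (- t) = bump0 t.
Proof. by rewrite /bump0 opprK mulrC. Qed.

End bumps.

(** * Cosine transforms of test functions *)

Section cosine_transform.
Context {R : realType}.
Notation mu := (@lebesgue_measure R).
Implicit Types (f g F : R -> R) (A c : R).

Lemma Cc_smoothr A f : Cc A f -> smoothr f. Proof. by case. Qed.

Lemma Cc_derive1 A f : Cc A f -> Cc A (derive1 f).
Proof.
move=> [sf f0]; split; first exact: smoothr_derive1.
move=> x Ax; rewrite derive1E.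
have d : is_derive x 1 f 0.
  apply: (@near_eq_is_derive _ _ _ (fun=> 0) f); near=> y; rewrite f0 //.
  near: y; apply: (@cvgr_gt _ _ _ _ (fun y => `|y|) `|x|) => //.
  exact: norm_continuous.
by have [_ ->] := d.
Unshelve. all: by end_near.
Qed.

Lemma CcM A f g : Cc A f -> smoothr g -> Cc A (fun x => f x * g x).
Proof.
by move=> [sf f0] sg; split => [|x Ax]; [exact: smoothrM | rewrite f0 ?mul0r].
Qed.

Lemma CcZ A c f : Cc A f -> Cc A (fun x => c * f x).
Proof.
move=> hf; have := CcM hf (@smoothr_cst R c).
by congr Cc; apply/funext => x; rewrite mulrC.
Qed.

Lemma CcD A f g : Cc A f -> Cc A g -> Cc A (fun x => f x + g x).
Proof.
move=> [sf f0] [sg g0]; split => [|x Ax]; first exact: smoothrD.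
by rewrite f0 // g0 // addr0.
Qed.

Lemma Cc_indic A f : Cc A f -> forall x, f x = f x * \1_`[- A, A] x.
Proof.
move=> [_ f0] x; rewrite indicE mem_setE in_itv /= -ler_norml.
by case: leP => [|/f0 ->]; rewrite ?mulr1 ?mulr0.
Qed.

Lemma Cc_measurable A f : Cc A f -> measurable_fun setT f.
Proof. by move=> [sf _]; apply: cts_measurable; exact: smoothr_continuous. Qed.

Lemma Cc_L1 A f : Cc A f -> L1 f.
Proof.
move=> hf; apply: eq_L1 (fun x => esym (Cc_indic hf x)) _.
by apply: L1_cts_itv; apply: smoothr_continuous; exact: Cc_smoothr hf.
Qed.

Lemma Cc_bounded A f : Cc A f -> exists C, forall x, `|f x| <= C.
Proof.
move=> hf; have cf := smoothr_continuous (Cc_smoothr hf).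
have [A0|A0] := leP (- A) A; last first.
  exists 0 => x; rewrite (Cc_indic hf) indicE mem_setE in_itv /= -ler_norml.
  have -> : (`|x| <= A) = false by apply/negbTE; rewrite -ltNge; have := normr_ge0 x; lra.
  by rewrite mulr0 normr0.
have cn : {within `[- A, A], continuous (fun x => `|f x|)}.
  apply: continuous_subspaceT => x; apply: (@continuous_comp _ _ _ f (fun y => `|y|)).
    exact: cf.
  exact: norm_continuous.
have [c _ cmax] := EVT_max A0 cn; exists `|f c| => x.
have [xA|Ax] := leP `|x| A; first by apply: cmax; rewrite in_itv /= -ler_norml.
by case: hf => _ ->; rewrite ?normr0.
Qed.

Lemma Cc_int_derive1 A f : Cc A f -> \int[mu]_x (derive1 f x) = 0.
Proof.
move=> hf; pose B := `|A| + 1.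
have AB : A < B by rewrite /B (le_lt_trans (ler_norm A)) // ltrDl.
have B0 : 0 < B by rewrite /B ltr_pwDr.
have hfB g : Cc A g -> Cc B g.
  by move=> [sg g0]; split => // x Bx; apply: g0; exact: lt_trans Bx.
have f0 : f B = 0 /\ f (- B) = 0.
  by case: hf => _ h; split; apply: h; rewrite ?normrN gtr0_norm.
have BB : - B <= B by lra.
rewrite (eq_int (Cc_indic (hfB _ (Cc_derive1 hf)))) -intE.
rewrite (ftc_itv BB (smoothr_derive (Cc_smoothr hf))); first by rewrite f0.1 f0.2 subrr.
by apply: smoothr_continuous; exact: Cc_smoothr (Cc_derive1 hf).
Qed.

(** The phase [c] treats cosine and sine transforms together: differentiation and integration by
    parts each advance it by [pi / 2], so one family is closed under both. *)
Definition cosT f c (x : R) : R := \int[mu]_t (f t * cos (t * x + c)).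

Lemma continuous_cos_affine (a b : R) : continuous (fun t => cos (a * t + b)).
Proof. exact: is_derive_continuous (is_derive_cos_affine a b). Qed.

Lemma L1_cosT f c x : L1 f -> L1 (fun t => f t * cos (t * x + c)).
Proof.
move=> lf; apply: (L1_bdd lf) (fun t => norm_cos_le1 _).
apply: cts_measurable; under eq_fun do rewrite [_ * x]mulrC.
exact: continuous_cos_affine.
Qed.

Lemma cosT_bound f c x : L1 f -> `|cosT f c x| <= \int[mu]_t `|f t|.
Proof.
move=> lf; apply: int_norm_le (L1_cosT c x lf) (L1_norm lf) _ => t.
by rewrite normrM ler_piMr // norm_cos_le1.
Qed.

Lemma is_derive_cosT A f c (x : R) : Cc A f ->
  is_derive x 1 (cosT f c) (cosT (fun t => t * f t) (c + pi / 2) x).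
Proof.
move=> hf; have lf := Cc_L1 hf.
have htf : Cc A (fun t => t * f t).
  by have := CcM hf (@smoothr_id R); congr Cc; apply/funext => t; rewrite mulrC.
have ltf := Cc_L1 htf.
pose F (y t : R) := f t * cos (t * y + c).
have dF (y t : R) : is_derive y 1 (F ^~ t) (t * f t * cos (t * y + (c + pi / 2))).
  have d := is_derive_cos_affine t c y.
  by rewrite /F; apply: is_derive_eq; rewrite /GRing.scale /= addrA cosDpihalf; ring.
have xI : `]x - 1, x + 1[%classic x by rewrite /= in_itv /=; lra.
have hD := @derivable_under_integral R _ _ mu F setT measurableT x (x - 1) (x + 1) xI.
have hE := @differentiation_under_integral R _ _ mu F setT measurableT x (x - 1) (x + 1) xI.
have H1 y : `]x - 1, x + 1[%classic y -> mu.-integrable setT (EFin \o F y).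
  by move=> _; exact: L1_cosT.
have H2 y t : `]x - 1, x + 1[%classic y -> setT t -> derivable (F ^~ t) y 1.
  by move=> _ _; have [] := dF y t.
have H3 y t : `]x - 1, x + 1[%classic y -> setT t ->
    `|partial1of2 F y t| <= `|t * f t|.
  move=> _ _; rewrite partial1of2E; have [_ ->] := dF y t.
  by rewrite normrM ler_piMr // norm_cos_le1.
apply: DeriveDef; first exact: (hD H1 H2 _ (fun t => normr_ge0 _) (L1_norm ltf) H3).
rewrite -derive1E (hE H1 H2 _ (fun t => normr_ge0 _) (L1_norm ltf) H3).
by apply: eq_int => t; rewrite partial1of2E; have [_ ->] := dF x t.
Qed.

Lemma Cc_mulid A f : Cc A f -> Cc A (fun t => t * f t).
Proof.
by move=> hf; have := CcM hf (@smoothr_id R); congr Cc; apply/funext => t; rewrite mulrC.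
Qed.

Lemma cosT_mulx A f c x : Cc A f ->
  x * cosT f c x = cosT (derive1 f) (c + pi / 2) x.
Proof.
move=> hf; have lf := Cc_L1 hf; have lf' := Cc_L1 (Cc_derive1 hf).
have hs : Cc A (fun t => f t * sin (x * t + c)).
  by apply: CcM => //; exact: smoothr_sin.
have := Cc_int_derive1 hs.
have dE t : derive1 (fun t => f t * sin (x * t + c)) t =
    x * (f t * cos (t * x + c)) - derive1 f t * cos (t * x + (c + pi / 2)).
  rewrite derive1E.
  have d1 := smoothr_derive (Cc_smoothr hf) t; have d2 := is_derive_sin_affine x c t.
  have D : is_derive t 1 (fun t => f t * sin (x * t + c))
      (x * (f t * cos (t * x + c)) - derive1 f t * cos (t * x + (c + pi / 2))).
    apply: is_derive_eq; rewrite /GRing.scale /= addrA cosDpihalf [t * x]mulrC; ring.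
  by have [_ ->] := D.
rewrite (eq_int dE) intB ?intZ; last 3 first.
- exact: L1_cosT.
- exact/L1Z/L1_cosT.
- exact: L1_cosT.
by move/subr0_eq.
Qed.

Lemma cosT_decay A (j : nat) f c : Cc A f ->
  exists C, forall x, `|x| ^+ j * `|cosT f c x| <= C.
Proof.
elim: j f c => [|j IH] f c hf.
  by exists (\int[mu]_t `|f t|) => x; rewrite expr0 mul1r; exact: cosT_bound (Cc_L1 hf).
have [C hC] := IH _ (c + pi / 2) (Cc_derive1 hf); exists C => x.
by rewrite exprSr -mulrA -normrM (cosT_mulx c x hf).
Qed.

Lemma smoothr_cosT A f c : Cc A f -> smoothr (cosT f c).
Proof.
move=> hf; apply: (@smoothr_class _ (fun h => exists f c, Cc A f /\ h = cosT f c)).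
  move=> _ [{hf}f [d [hf ->]]]; exists (cosT (fun t => t * f t) (d + pi / 2)).
    by exists (fun t => t * f t), (d + pi / 2); split => //; exact: Cc_mulid.
  by move=> x; exact: is_derive_cosT hf.
by exists f, c.
Qed.

Lemma cosT_L1 A f c : Cc A f -> L1 (cosT f c).
Proof.
move=> hf; have [C0 h0] := cosT_decay 0 c hf; have [C2 h2] := cosT_decay 2 c hf.
have [lP _] := @poisson_int R.
apply: L1_le (L1Z (C0 + C2) lP) _.
  by apply: cts_measurable; apply: smoothr_continuous; exact: smoothr_cosT hf.
move=> x; rewrite ler_pdivlMr ?ltr_pwDl ?sqr_ge0 //.
have := lerD (h0 x) (h2 x); rewrite -mulrDl mulrC expr0 real_normK ?num_real //.
Qed.

Lemma int_odd f : (forall x, f (- x) = - f x) -> L1 f -> \int[mu]_x f x = 0.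
Proof.
move=> fo lf; have n0 : (-1 : R) != 0 by rewrite oppr_eq0 oner_eq0.
have := int_affine 0 n0 lf; rewrite normrN1 invr1 mul1r.
rewrite (@eq_int _ _ (fun x => -1 * f x)); last by move=> x; rewrite addr0 !mulN1r fo.
by rewrite intZ // => h; lra.
Qed.

Lemma cosT_even f x : cosT f 0 (- x) = cosT f 0 x.
Proof. by apply: eq_int => t; rewrite !addr0 mulrN cosN. Qed.

Lemma cosT_inversion A f (s : R) : Cc A f -> (forall t, f (- t) = f t) ->
  \int[mu]_x (cosT f 0 x * cos (s * x)) = 2 * pi * f s.
Proof.
move=> hf fe; have lf := Cc_L1 hf.
(* Averaging the translates of [f] by [s] and [- s] moves the point of inversion to 0; by evenness
   [g 0 = f s], and the cosine transform of [g] is that of [f] times [cos (s x)]. *)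
pose g u := 2^-1 * (f (1 * u + s) + f (1 * u + - s)).
have l1 (b : R) : L1 (fun u => f (1 * u + b)) by apply: L1_affine => //; exact: oner_neq0.
have lg : L1 g by apply/L1Z/L1D.
have E x : \int[mu]_u (g u * cos (u * x)) = cosT f 0 x * cos (s * x).
  pose k (v : R) := 2^-1 * (f v * cos ((v - s) * x)) .
  pose k' (v : R) := 2^-1 * (f v * cos ((v + s) * x)).
  have lk : L1 k.
    apply: L1Z; apply: eq_L1 (L1_cosT (- (s * x)) x lf) => v.
    by rewrite mulrBl.
  have lk' : L1 k'.
    apply: L1Z; apply: eq_L1 (L1_cosT (s * x) x lf) => v.
    by rewrite mulrDl.
  rewrite (@eq_int _ _ (fun u => k (1 * u + s) + k' (1 * u + - s))); last first.
    by move=> u; rewrite /g /k /k' addrK subrK mul1r; ring.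
  rewrite intD; try (by apply: L1_affine => //; exact: oner_neq0).
  rewrite !int_affine ?oner_neq0 // normr1 invr1 !mul1r -intD //.
  rewrite mulrC -intZ; last exact: L1_cosT.
  apply: eq_int => v; by rewrite /k /k' addr0 mulrBl mulrDl cosB cosD; field.
have [C fC] := Cc_bounded hf.
under eq_Rintegral do rewrite -E.
rewrite (@cos_transform_int _ g C) //.
- by rewrite /g !mulr0 !add0r fe; field.
- move=> u; rewrite /g normrM ger0_norm ?invr_ge0 //.
  have := lerD (fC (1 * u + s)) (fC (1 * u + - s)).
  have := ler_normD (f (1 * u + s)) (f (1 * u + - s)); lra.
- have sf := Cc_smoothr hf; apply: smoothr_continuous.
  by have := smoothrM (@smoothr_cst R 2^-1)
    (smoothrD (@smoothr_affine R 1 s _ sf) (@smoothr_affine R 1 (- s) _ sf)).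
- apply: eq_L1 (L1_cos s (cosT_L1 0 hf)) => x; exact/esym/E.
Qed.

End cosine_transform.

(** * Even bumps with nonnegative transform *)

Section positive_kernel.
Context {R : realType}.
Notation mu := (@lebesgue_measure R).
Implicit Types (f g w : R -> R) (A c : R).

(** A correlation; for the even weights [w] used below it coincides with the convolution. *)
Definition conv w f (t : R) : R := \int[mu]_u (w u * f (u + t)).

Lemma L1_conv A w f t : L1 w -> Cc A f -> L1 (fun u => w u * f (u + t)).
Proof.
move=> lw hf; have [C fC] := Cc_bounded hf; apply: (L1_bdd lw) (fun u => fC _).
apply: (measurableT_comp (Cc_measurable hf)).
by apply: measurable_funD.
Qed.

Lemma is_derive_conv A w f (t : R) : L1 w -> Cc A f ->
  is_derive t 1 (conv w f) (conv w (derive1 f) t).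
Proof.
move=> lw hf; have [C fC] := Cc_bounded (Cc_derive1 hf).
pose F (y u : R) := w u * f (u + y).
have dF (y u : R) : is_derive y 1 (F ^~ u) (w u * derive1 f (u + y)).
  have := @is_derive_affine _ 1 u f _ y (smoothr_derive (Cc_smoothr hf) (1 * y + u)).
  rewrite mul1r => d.
  have -> : F ^~ u = (fun y => w u * f (1 * y + u)).
    by apply/funext => z; rewrite mul1r addrC.
  by apply: is_derive_eq; rewrite /GRing.scale /= mul1r [y + u]addrC.
have tI : `]t - 1, t + 1[%classic t by rewrite /= in_itv /=; lra.
have hD := @derivable_under_integral R _ _ mu F setT measurableT t (t - 1) (t + 1) tI.
have hE := @differentiation_under_integral R _ _ mu F setT measurableT t (t - 1) (t + 1) tI.
have H1 y : `]t - 1, t + 1[%classic y -> mu.-integrable setT (EFin \o F y).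
  by move=> _; exact: L1_conv hf.
have H2 y u : `]t - 1, t + 1[%classic y -> setT u -> derivable (F ^~ u) y 1.
  by move=> _ _; have [] := dF y u.
have C0 : 0 <= C by rewrite (le_trans _ (fC 0)).
have H3 y u : `]t - 1, t + 1[%classic y -> setT u ->
    `|partial1of2 F y u| <= C * `|w u|.
  move=> _ _; rewrite partial1of2E; have [_ ->] := dF y u.
  by rewrite normrM mulrC ler_wpM2r.
have H4 u : 0 <= C * `|w u| by rewrite mulr_ge0.
have H5 : mu.-integrable setT (EFin \o (fun u => C * `|w u|)) by exact/L1Z/L1_norm.
apply: DeriveDef; first exact: (hD H1 H2 _ H4 H5 H3).
rewrite -derive1E (hE H1 H2 _ H4 H5 H3).
by apply: eq_int => u; rewrite partial1of2E; have [_ ->] := dF t u.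
Qed.

Lemma Cc_conv A B w f : L1 w -> (forall u, B < `|u| -> w u = 0) -> Cc A f ->
  Cc (A + B) (conv w f).
Proof.
move=> lw w0 hf; split.
  apply: (@smoothr_class _ (fun h => exists2 f, Cc A f & h = conv w f)); last by exists f.
  move=> _ [{hf}f hf ->]; exists (conv w (derive1 f)).
    by exists (derive1 f) => //; exact: Cc_derive1.
  by move=> x; exact: is_derive_conv hf.
move=> t At; rewrite /conv (@eq_int _ _ (fun=> 0 * 0)).
  by rewrite intZ ?mul0r //; exact: L10.
move=> u; rewrite mul0r; have [uB|/w0 ->] := leP `|u| B; last by rewrite mul0r.
case: hf => _ ->; rewrite ?mulr0 //.
by have := ler_normB (u + t) u; rewrite [u + t]addrC addrK => ?; lra.
Qed.

Definition bump_sq := conv (@bump0 R) (@bump0 R).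

Lemma bump_sq_Cc : Cc 2 bump_sq.
Proof.
have -> : 2 = 1 + 1 :> R by [].
apply: Cc_conv bump0_Cc; first exact: Cc_L1 bump0_Cc.
by case: (@bump0_Cc R).
Qed.

Lemma bump_sq_ge0 t : 0 <= bump_sq t.
Proof. by apply: Rintegral_ge0 => u _; rewrite mulr_ge0 // bump0_ge0. Qed.

Lemma bump_sqN t : bump_sq (- t) = bump_sq t.
Proof.
have l := @L1_conv 1 _ _ t (Cc_L1 bump0_Cc) (@bump0_Cc R).
rewrite /bump_sq /conv.
have := int_affine (- t) (oner_neq0 R) l; rewrite normr1 invr1 mul1r => <-.
by apply: eq_int => u; rewrite mul1r subrK mulrC.
Qed.

(** The convolution theorem: in the double integral [cos ((v - u) x)] splits, and the sine part
    vanishes because [bump0] is even. A square is nonnegative, which is the purpose of [bump_sq]. *)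
Lemma cosT_bump_sq x : cosT bump_sq 0 x = cosT (@bump0 R) 0 x ^+ 2.
Proof.
have b0 := @bump0_Cc R; have lb := Cc_L1 b0; have [C bC] := Cc_bounded b0.
(* Cutting the cosine off at [[-2, 2]], which contains the support of [bump_sq], makes it integrable
   for Fubini without changing the pairing. *)
have le : L1 (fun t => cos (x * t + 0) * \1_`[-2, 2] t).
  by apply: L1_cts_itv; exact: continuous_cos_affine.
have mu_ : measurable_fun setT (fun z : R * R => bump0 (z.2 + z.1)).
  apply: (measurableT_comp (Cc_measurable b0)).
  exact: measurable_funD.
have Fub := @fubini_mul R _ _ (fun x t => bump0 (t + x)) C le lb mu_ (fun x t => bC _).
transitivity (\int[mu]_t (cos (x * t + 0) * \1_`[-2, 2] t * bump_sq t)).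
  apply: eq_int => t; rewrite {1}(Cc_indic bump_sq_Cc) [t * x]mulrC; ring.
rewrite [LHS]Fub {Fub} expr2 {1}/cosT [RHS]mulrC -intZ; last exact: L1_cosT.
apply: eq_int => u; rewrite mulrCA.
have [u1|u1] := leP `|u| 1; last by case: b0 => _ ->; rewrite ?mul0r.
congr *%R; rewrite addr0.
pose k (v : R) := bump0 v * cos ((v - u) * x).
have lk : L1 k.
  by apply: eq_L1 (L1_cosT (- (u * x)) x lb) => v; rewrite /k mulrBl.
transitivity (\int[mu]_t k (1 * t + u)).
  apply: eq_int => t; rewrite /k mul1r addrK addr0 [t * x]mulrC [t + u]addrC.
  have [t2|t2] := leP `|t| 2.
    by rewrite indicE mem_setE in_itv /= -ler_norml t2 mulr1 mulrC.
  suff -> : bump0 (u + t) = 0 by rewrite mulr0 mul0r.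
  have [_ b00] := b0; apply: b00; clear -u1 t2.
  by have := ler_normB (u + t) u; rewrite [u + t]addrC addrK => ?; lra.
rewrite (int_affine u (oner_neq0 R) lk) normr1 invr1 mul1r.
transitivity (\int[mu]_v (cos (u * x) * (bump0 v * cos (v * x + 0)) +
    sin (u * x) * (bump0 v * sin (x * v)))).
  by apply: eq_int => v; rewrite /k mulrBl cosB addr0 [x * v]mulrC; ring.
rewrite intD; last 2 first.
- exact/L1Z/L1_cosT.
- exact/L1Z/L1_sin.
rewrite !intZ; last 2 first.
- exact: L1_sin.
- exact: L1_cosT.
rewrite (@int_odd _ (fun v => bump0 v * sin (x * v))); last 2 first.
- by move=> v; rewrite bump0N mulrN sinN mulrN.
- exact: L1_sin.
rewrite mulr0 addr0; exact: mulrC.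
Qed.

Lemma cosT_bump0_gt0 : 0 < cosT (@bump0 R) 0 0.
Proof.
have lb := Cc_L1 (@bump0_Cc R).
have -> : cosT (@bump0 R) 0 0 = \int[mu]_t bump0 t.
  by apply: eq_int => t; rewrite mulr0 addr0 cos0 mulr1.
(* On [[-1/2, 1/2]] both [1 + t] and [1 - t] are at least [1/2], so each factor of [bump0] is at
   least [expR (-2)]. *)
have l1 : L1 (fun t : R => expR (-4) * \1_`[-2^-1, 2^-1] t).
  by have := @L1_cts_itv R (fun=> expR (-4)) (-2^-1) 2^-1; apply => x; exact: cvg_cst.
apply: (@lt_le_trans _ _ (\int[mu]_t (expR (-4) * \1_`[-2^-1, 2^-1] t))).
  rewrite -intE Rintegral_cst //= lebesgue_measure_itv /= lte_fin ifT; last by lra.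
  by rewrite /= mulr_gt0 ?expR_gt0 //; lra.
apply: int_le => // t; rewrite indicE mem_setE in_itv /=.
have [/andP[h1 h2]|_] := boolP (- 2^-1 <= t <= 2^-1); last by rewrite mulr0 bump0_ge0.
rewrite mulr1 /bump0 /flat_exp !hornerE ifT; last by lra.
rewrite ifT; last by lra.
rewrite -expRD ler_expR.
have i1 : (1 + t)^-1 <= 2 by rewrite -[leRHS]invrK lef_pV2 ?posrE; lra.
have i2 : (1 - t)^-1 <= 2 by rewrite -[leRHS]invrK lef_pV2 ?posrE; lra.
lra.
Qed.

(** Nonnegativity of the transform makes weighted means monotone; its maximum at 0 later normalizes
    a multiplier to values in [[0, 1]]. *)
Record pos_kernel (a : R) (phi : R -> R) : Prop := PosKernel {
  pk_Cc : Cc a phi;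
  pk_even : forall t, phi (- t) = phi t;
  pk_ge0 : forall x, 0 <= cosT phi 0 x;
  pk_gt0 : 0 < cosT phi 0 0;
  pk_le : forall x, cosT phi 0 x <= cosT phi 0 0 }.

(** Normalized so that the support scales by [a] while the transform is merely composed with
    [x -> a x]: a small [a] gives a narrow support and a transform nearly constant near 0. *)
Definition dilate (a : R) (phi : R -> R) t := a^-1 * phi (a^-1 * t).

Lemma cosT_dilate A a phi x : 0 < a -> Cc A phi ->
  cosT (dilate a phi) 0 x = cosT phi 0 (a * x).
Proof.
move=> a0 hp; have lp := Cc_L1 hp; have an : a != 0 by rewrite gt_eqF.
have l := L1_cosT 0 (a * x) lp.
have := int_affine 0 (invr_neq0 an) l; rewrite gtr0_norm ?invr_gt0 // invrK.
move/(congr1 ( *%R a^-1)); rewrite mulKf // => E.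
rewrite /cosT -E -intZ; last exact: (L1_affine 0 (invr_neq0 an) l).
apply: eq_int => t; rewrite /dilate !addr0 mulrA.
by congr (_ * cos _); field.
Qed.

Lemma dilate_kernel a b phi : 0 < a -> pos_kernel b phi -> pos_kernel (a * b) (dilate a phi).
Proof.
move=> a0 [hc he h0 h1 h2]; split.
- apply: CcZ; split.
    have := @smoothr_affine R a^-1 0 _ (Cc_smoothr hc).
    by congr smoothr; apply/funext => x; rewrite addr0.
  move=> x hx; case: hc => _ -> //.
  by rewrite normrM gtr0_norm ?invr_gt0 // mulrC ltr_pdivlMr // mulrC.
- by move=> t; rewrite /dilate mulrN he.
- by move=> x; rewrite (cosT_dilate _ a0 hc).
- by rewrite (cosT_dilate _ a0 hc) mulr0.
- by move=> x; rewrite !(cosT_dilate _ a0 hc) mulr0.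
Qed.

Lemma pos_kernel_exists : exists phi, pos_kernel 1 phi.
Proof.
have k : pos_kernel 2 bump_sq.
  have hc := bump_sq_Cc; split.
  - exact: hc.
  - exact: bump_sqN.
  - by move=> x; rewrite cosT_bump_sq sqr_ge0.
  - by rewrite cosT_bump_sq exprn_gt0 // cosT_bump0_gt0.
  - move=> x; apply: int_le => [||t]; try exact: L1_cosT (Cc_L1 hc).
    by rewrite mulr0 !addr0 cos0 ler_wpM2l ?bump_sq_ge0 // cos_le1.
exists (dilate 2^-1 bump_sq).
have h2 : 0 < 2^-1 :> R by rewrite invr_gt0.
by have := dilate_kernel h2 k; rewrite mulVf.
Qed.

End positive_kernel.

(** * Beurling's majorant *)

Section beurling_kernel.
Context {R : realType}.
Notation mu := (@lebesgue_measure R).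
Implicit Types (f g w : R -> R) (x y : R).

Lemma continuous_cos_int f c : L1 f ->
  continuous (fun s : R => \int[mu]_x (f x * cos (s * x + c))).
Proof.
move=> lf s.
have := @continuity_under_integral R _ _ mu (fun s x : R => f x * cos (s * x + c)) setT
  measurableT (s - 1) (s + 1) _ _ _ (L1_norm lf).
apply.
- move=> u _; apply: eq_L1 (L1_cosT c u lf) => x; by rewrite [x * u]mulrC.
- apply: aeW => x _ u _; apply: cvgM; first exact: cvg_cst.
  apply: continuous_comp; last exact: continuous_cos.
  by apply: cvgD; [apply: cvgM => //; exact: cvg_cst | exact: cvg_cst].
- move=> u _; apply: aeW => x _.
  by rewrite normrM ler_piMr // norm_cos_le1.
- by rewrite inE /= in_itv /=; lra.
Qed.

Definition tri (s : R) : R := Num.max 0 (1 - `|s|).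

Lemma tri_ge0 s : 0 <= tri s. Proof. by rewrite /tri le_max lexx. Qed.

Lemma triN s : tri (- s) = tri s. Proof. by rewrite /tri normrN. Qed.

Lemma tri_half s : tri s * \1_`[0, +oo[ s = (1 - s) * \1_`[0, 1] s.
Proof.
rewrite !indicE !mem_setE !in_itv /= andbT /tri.
have [s0|s0] := leP 0 s; last by rewrite !mulr0.
rewrite /= ger0_norm // mulr1; case: leP => s1; last by rewrite mulr0 max_l // subr_le0 ltW.
by rewrite mulr1 max_r // subr_ge0.
Qed.

Lemma continuous_onem : continuous (fun s : R => 1 - s).
Proof. by move=> s; apply: cvgB; [exact: cvg_cst|]. Qed.

Lemma tri_L1 : L1 tri.
Proof.
apply: (int_even triN _).1.
by apply: eq_L1 (fun s => esym (tri_half s)) _; apply: L1_cts_itv; exact: continuous_onem.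
Qed.

(* The Fejer kernel [(sin (pi x) / (pi x)) ^ 2], in a form free of division. *)
Definition sinc2 x := \int[mu]_s (tri s * cos (s * (2 * pi * x))).

Definition sinsq x : R := (sin (pi * x) / pi) ^+ 2.

Lemma pi_neq0 : pi != 0 :> R. Proof. by rewrite gt_eqF // pi_gt0. Qed.

Lemma cos2pi x : cos (2 * pi * x) = 1 - 2 * pi ^+ 2 * sinsq x.
Proof.
rewrite /sinsq (_ : 2 * pi * x = (pi * x) *+ 2); last by rewrite mulr2n; ring.
by rewrite cos_mulr2n cos2sin2 mulr2n; move: pi pi_neq0 => p p0; field.
Qed.

Lemma cos_L1 f (c : R) : L1 f -> L1 (fun s => f s * cos (s * c)).
Proof. by move=> /(L1_cos c); apply: eq_L1 => s; rewrite mulrC [c * s]mulrC mulrC. Qed.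

Lemma sinc2_even x : sinc2 (- x) = sinc2 x.
Proof. by apply: eq_int => s; rewrite !mulrN cosN. Qed.

Lemma sinc2_half x :
  sinc2 x = 2 * \int[mu]_(s in `[0, 1]) ((1 - s) * cos (s * (2 * pi * x))).
Proof.
have e s : tri (- s) * cos (- s * (2 * pi * x)) = tri s * cos (s * (2 * pi * x)).
  by rewrite triN mulNr cosN.
have l : L1 (fun s => tri s * cos (s * (2 * pi * x)) * \1_`[0, +oo[ s).
  by apply: L1_indic; [exact: measurable_itv | exact: cos_L1 tri_L1].
rewrite /sinc2 (int_even e l).2 [in RHS]intE; congr (_ * _); apply: eq_int => s.
by rewrite mulrAC tri_half; ring.
Qed.

Lemma sinc20 : sinc2 0 = 1.
Proof.
rewrite sinc2_half (_ : \int[mu]_(s in _) _ = \int[mu]_(s in `[0, 1]) (1 - s)); last first.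
  by apply: eq_Rintegral => s _; rewrite !mulr0 cos0 mulr1.
have dF (s : R) : is_derive s 1 (fun s : R => s - 2^-1 * s ^+ 2) (1 - s).
  by apply: is_derive_eq; rewrite /GRing.scale /=; field.
by rewrite (ftc_itv ler01 dF continuous_onem); field.
Qed.

Lemma sinc2E x : x != 0 -> sinc2 x = sinsq x / x ^+ 2.
Proof.
move=> x0; rewrite sinc2_half; have p0 := pi_neq0.
set c := 2 * pi * x; have c0 : c != 0 by rewrite !mulf_neq0 // ?pnatr_eq0.
have dF (s : R) : is_derive s 1
    (fun s : R => c^-1 * ((1 - s) * sin (c * s)) - c^-1 ^+ 2 * cos (c * s))
    ((1 - s) * cos (s * c)).
  by apply: is_derive_eq; rewrite /GRing.scale /= [s * c]mulrC; field.
have cf : continuous (fun s : R => (1 - s) * cos (s * c)).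
  move=> s; apply: cvgM; first exact: continuous_onem.
  apply: continuous_comp; last exact: continuous_cos.
  by apply: cvgM => //; exact: cvg_cst.
rewrite (ftc_itv ler01 dF cf) !mulr0 sin0 cos0 mulr1 subrr mul0r mulr0 /c cos2pi.
by clear -x0 p0; move: (sinsq x) pi p0 => S p p0; field; rewrite x0 p0.
Qed.

Lemma sinsq_ge0 x : 0 <= sinsq x. Proof. exact: sqr_ge0. Qed.

Lemma sinc2_ge0 x : 0 <= sinc2 x.
Proof.
have [->|x0] := eqVneq x 0; first by rewrite sinc20.
by rewrite sinc2E // divr_ge0 ?sqr_ge0 // sinsq_ge0.
Qed.

Lemma sinc2_le1 x : sinc2 x <= 1.
Proof.
rewrite -sinc20; apply: int_le; [exact: cos_L1 tri_L1 | exact: cos_L1 tri_L1 |].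
by move=> s; rewrite !mulr0 cos0 ler_wpM2l ?tri_ge0 // cos_le1.
Qed.

Lemma sinsqE x : sinsq x = x ^+ 2 * sinc2 x.
Proof.
have [->|x0] := eqVneq x 0; first by rewrite /sinsq mulr0 sin0 mul0r expr0n mul0r.
by rewrite sinc2E // mulrC divfK // sqrf_eq0.
Qed.

Lemma continuous_sinc2 : continuous sinc2.
Proof.
have h := @continuous_cos_int tri 0 tri_L1.
have -> : sinc2 = (fun u => \int[mu]_s (tri s * cos (u * s + 0))) \o (fun x => 2 * pi * x).
  by apply/funext => x; apply: eq_int => s; rewrite addr0 [s * _]mulrC.
move=> x; apply: continuous_comp; last exact: h.
by apply: cvgM => //; exact: cvg_cst.
Qed.

Lemma sinc2_L1 : L1 sinc2.
Proof.
have [lP _] := @poisson_int R; apply: L1_le (L1Z 2 lP) _.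
  by apply: cts_measurable; exact: continuous_sinc2.
move=> x; rewrite ger0_norm ?sinc2_ge0 //.
rewrite ler_pdivlMr ?ltr_pwDl ?sqr_ge0 // mulrDr mulr1 [_ * x ^+ 2]mulrC -sinsqE.
apply: lerD; first exact: sinc2_le1.
rewrite /sinsq expr_div_n ler_pdivrMr ?exprn_gt0 ?pi_gt0 // mul1r.
apply: (@le_trans _ _ 1); last by rewrite expr_ge1 ?pi_ge0 // (le_trans _ (pi_ge2 R)) ?ler1n.
by rewrite sin2cos2 gerBl sqr_ge0.
Qed.

(** Inversion at 0 applied to [tri], whose cosine transform is a dilate of [sinc2]. *)
Lemma int_sinc2 : \int[mu]_x sinc2 x = 1.
Proof.
have p2 : (2 * pi)^-1 != 0 :> R by rewrite invr_neq0 // mulf_neq0 ?pnatr_eq0 ?pi_neq0.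
have pp : 0 < (2 * pi)^-1 :> R by rewrite invr_gt0 mulr_gt0 // pi_gt0.
have E x : sinc2 ((2 * pi)^-1 * x + 0) = \int[mu]_s (tri s * cos (s * x)).
  by apply: eq_int => s; rewrite addr0 mulVKf // -invr_eq0.
have l := L1_affine 0 p2 sinc2_L1.
have := int_affine 0 p2 sinc2_L1; rewrite (eq_int E).
rewrite (@cos_transform_int _ tri 1 tri_L1).
- rewrite gtr0_norm // invrK /tri normr0 subr0 max_r // mulr1 => h.
  have n : 2 * pi != 0 :> R by rewrite -invr_eq0.
  by apply/esym/(mulfI n); rewrite mulr1; exact: h.
- move=> s; rewrite ger0_norm ?tri_ge0 // /tri ge_max ler01 /=.
  by rewrite gerBl.
- apply: continuous_max; first exact: cvg_cst.
  by apply: cvgB; [exact: cvg_cst | exact: norm_continuous].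
- exact: eq_L1 E l.
Qed.

(** The left side is the odd function [x * sinc2 x]. Exhibiting it as a sine transform over [[0, 1]]
    shows that the second term of Beurling's majorant also has frequencies at most [2 pi]. *)
Lemma sinsq_div x : sinsq x / x = pi^-1 * \int[mu]_s (\1_`[0, 1] s * sin (s * (2 * pi * x))).
Proof.
have p0 := pi_neq0.
have -> : \int[mu]_s (\1_`[0, 1] s * sin (s * (2 * pi * x))) =
    \int[mu]_(s in `[0, 1]) sin (2 * pi * x * s).
  by rewrite [in RHS]intE; apply: eq_int => s; rewrite mulrC [s * _]mulrC.
(* At [x = 0] the quotient takes the default value 0, which is also its limit. *)
have [->|x0] := eqVneq x 0.
  rewrite invr0 mulr0 (_ : \int[mu]_(s in _) _ = \int[mu]_(s in `[0, 1]) (0 : R)).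
    by rewrite Rintegral_cst // mul0r mulr0.
  by apply: eq_Rintegral => s _; rewrite mulr0 mul0r sin0.
set c := 2 * pi * x; have c0 : c != 0 by rewrite !mulf_neq0 // ?pnatr_eq0.
have dF (s : R) : is_derive s 1 (fun s : R => - c^-1 * cos (c * s)) (sin (c * s)).
  by apply: is_derive_eq; rewrite /GRing.scale /=; field.
rewrite (ftc_itv ler01 dF (@continuous_sin_lin R c)) mulr0 cos0 mulr1 /c cos2pi.
by clear -x0 p0; move: (sinsq x) => S; move: pi p0 => p p0; field; rewrite x0 p0.
Qed.

End beurling_kernel.

(** * Integer translates of the Fejer kernel sum to one *)

Section partition_of_unity.
Context {R : realType}.
Implicit Types (x y : R).

Lemma sum_even_odd (g : nat -> R) (K : nat) :
  \sum_(0 <= i < K.*2) g i = \sum_(0 <= i < K) (g i.*2 + g i.*2.+1).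
Proof.
elim: K => [|K IH]; first by rewrite !big_geq.
by rewrite doubleS !big_nat_recr //= IH addrA.
Qed.

Lemma inv_sin2_double y : sin y != 0 ->
  (sin (y / 2) ^+ 2)^-1 + (sin ((y + pi) / 2) ^+ 2)^-1 = 4 * (sin y ^+ 2)^-1.
Proof.
have E : sin y = (cos (y / 2) * sin (y / 2)) *+ 2 by rewrite -sin_mulr2n mulr2n -splitr.
rewrite E mulrDl sinDpihalf => h.
have := cos2Dsin2 (y / 2); move: (sin _) (cos _) h => s c h sc.
have s0 : s != 0 by apply: contraNneq h => ->; rewrite mulr0 mul0rn.
have c0 : c != 0 by apply: contraNneq h => ->; rewrite mul0r mul0rn.
apply: (@mulIf _ (s ^+ 2 * c ^+ 2)); first by rewrite mulf_neq0 // expf_neq0.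
transitivity (c ^+ 2 + s ^+ 2).
  by field; rewrite s0 c0.
by rewrite sc -mulr_natl; field; rewrite s0 c0.
Qed.

(* Summing [inv_sin2_double] over a dyadic subdivision and letting [m] grow gives
   the expansion of [1 / sin^2] into partial fractions. *)
Lemma sum_inv_sin2 (m : nat) y : sin y != 0 ->
  \sum_(0 <= i < 2 ^ m) (sin ((y + i%:R * pi) / 2 ^+ m) ^+ 2)^-1 =
  4 ^+ m * (sin y ^+ 2)^-1.
Proof.
elim: m y => [|m IH] y y0.
  by rewrite expn0 big_nat1 !expr0 mul0r addr0 divr1 mul1r.
have h : sin ((y / 2) *+ 2) != 0 by rewrite mulr2n -splitr.
have s0 : sin (y / 2) != 0.
  by apply: contraNneq h => e; rewrite sin_mulr2n e mulr0 mul0rn.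
have s1 : sin ((y + pi) / 2) != 0.
  by apply: contraNneq h => e; rewrite sin_mulr2n -sinDpihalf -mulrDl e mul0r mul0rn.
rewrite expnS mul2n sum_even_odd.
under eq_bigr => i _.
  rewrite (_ : (y + (i.*2)%:R * pi) / 2 ^+ m.+1 = (y / 2 + i%:R * pi) / 2 ^+ m); last first.
    by rewrite -muln2 natrM exprS; move: pi => p; field; rewrite expf_neq0.
  rewrite (_ : (y + (i.*2.+1)%:R * pi) / 2 ^+ m.+1 =
      ((y + pi) / 2 + i%:R * pi) / 2 ^+ m); last first.
    by rewrite -addn1 natrD -muln2 natrM exprS; move: pi => p; field; rewrite expf_neq0.
  over.
rewrite big_split /= (IH _ s0) (IH _ s1) -mulrDr (inv_sin2_double y0).
by rewrite [4 ^+ m.+1]exprSr mulrA.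
Qed.

Lemma ge0_derive_le (F f : R -> R) (a b : R) : a <= b ->
  (forall t : R, is_derive t 1 F (f t)) -> (forall t, a < t < b -> 0 <= f t) ->
  F a <= F b.
Proof.
move=> ab dF f0.
apply: (@ger0_derive1_le_cc _ F a b) => //; rewrite ?in_itv /= ?lexx ?ab //.
- move=> x; rewrite in_itv /= => /f0; rewrite derive1E.
  by have [_ ->] := dF x.
- exact: continuous_subspaceT (is_derive_continuous dF).
Qed.

Lemma mulcos_le_sin y : 0 <= y <= pi -> y * cos y <= sin y.
Proof.
move=> /andP[y0 yp].
have dF (t : R) : is_derive t 1 (fun t : R => sin t - t * cos t) (t * sin t).
  by apply: is_derive_eq; rewrite /GRing.scale /=; ring.
have := ge0_derive_le y0 dF; rewrite sin0 mul0r subrr subr_ge0; apply.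
move=> t /andP[t0 ty]; rewrite mulr_ge0 ?(ltW t0) // sin_ge0_pi // (ltW t0) /=.
by rewrite (le_trans (ltW ty)).
Qed.

Lemma sin2_le_sqr y : sin y ^+ 2 <= y ^+ 2.
Proof.
have p0 := @pi_neq0 R.
have := sinsqE (y / pi); rewrite /sinsq [pi * _]mulrC divfK // => /(congr1 ( *%R (pi ^+ 2))).
rewrite !expr_div_n mulrC divfK ?expf_neq0 // => ->.
have -> : pi ^+ 2 * (y ^+ 2 / pi ^+ 2 * sinc2 (y / pi)) = y ^+ 2 * sinc2 (y / pi).
  by move: (sinc2 _) => k; move: pi p0; clear => p p0; field.
by rewrite ler_piMr ?sqr_ge0 // sinc2_le1.
Qed.

(** Up to [pi / 2] this is [y cos y <= sin y] squared; between [pi / 2] and [3 pi / 4] one has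
    [sin y ^ 2 >= 1/2], which accounts for the factor 2. The range is the one reached by the
    arguments in [window_bounds]. *)
Lemma sqr_le_sin2 y : `|y| <= 3 / 4 * pi -> y ^+ 2 <= sin y ^+ 2 * (1 + 2 * y ^+ 2).
Proof.
wlog y0 : y / 0 <= y.
  move=> H; have [/H //|/ltW y0] := leP 0 y.
  by have := H (- y); rewrite normrN !sqrrN sinN sqrrN oppr_ge0; exact.
rewrite ger0_norm // => hy; have p0 := pi_gt0 R.
have [y1|y1] := leP y (pi / 2).
  have h : y * cos y <= sin y by apply: mulcos_le_sin; lra.
  have c0 : 0 <= cos y by apply: cos_ge0_pihalf; lra.
  have : (y * cos y) ^+ 2 <= sin y ^+ 2.
    by rewrite ler_pXn2r ?nnegrE //; [exact: mulr_ge0 | apply: le_trans h; exact: mulr_ge0].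
  rewrite exprMn cos2sin2; have := mulr_ge0 (sqr_ge0 y) (sqr_ge0 (sin y)).
  by clear; lra.
have c : 0 <= cos (y *+ 2 - pi) by apply: cos_ge0_pihalf; rewrite (mulr2n y); lra.
have : sin y ^+ 2 >= 2^-1.
  move: c.
  have : cos (y *+ 2) = - cos (y *+ 2 - pi) by rewrite -[in LHS](subrK pi (y *+ 2)) cosDpi.
  by rewrite cos_mulr2n cos2sin2 [(_ - _) *+ 2]mulr2n; clear; lra.
move=> h; have := ler_wpM2r (sqr_ge0 y) h; have := sqr_ge0 (sin y).
by clear; lra.
Qed.

Lemma sinDn (n : nat) y : sin (y + n%:R * pi) ^+ 2 = sin y ^+ 2.
Proof.
elim: n => [|n IH]; first by rewrite mul0r addr0.
by rewrite -addn1 natrD mulrDl mul1r addrA sinDpi sqrrN.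
Qed.

Lemma sinsqDn (n : nat) x : sinsq (x + n%:R) = sinsq x.
Proof. by rewrite /sinsq !expr_div_n mulrDr [pi * n%:R]mulrC sinDn. Qed.

Lemma sinsqBn (n : nat) x : sinsq (x - n%:R) = sinsq x.
Proof. by rewrite -[in RHS](subrK n%:R x) sinsqDn. Qed.

(** The translates by [- N, ..., N - 1], reindexed from 0 so as to match the sum over a full period
    in [sum_inv_sin2]. *)
Definition window (N : nat) x := \sum_(0 <= i < N.*2) sinc2 (x + i%:R - N%:R).

Lemma windowE N x : window N x =
  \sum_(0 <= i < N) sinc2 (x + i%:R) + \sum_(0 <= i < N) sinc2 (x - i.+1%:R).
Proof.
rewrite /window -addnn (big_cat_nat (n := N)) //= ?leq_addr // addrC; congr (_ + _).
  rewrite -[X in \sum_(X <= i < _) _](add0n N) big_addn addnK; apply: eq_bigr => i _.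
  by rewrite natrD addrA addrK.
rewrite big_nat_rev /= add0n; apply: eq_big_nat => i /andP[_ iN].
by congr sinc2; rewrite natrB //; ring.
Qed.

Lemma window_mono x (N M : nat) : (N <= M)%N -> window N x <= window M x.
Proof.
move=> NM; rewrite !windowE; apply: lerD.
  rewrite [leRHS](big_cat_nat (n := N)) //= lerDl sumr_ge0 // => i _; exact: sinc2_ge0.
rewrite [leRHS](big_cat_nat (n := N)) //= lerDl sumr_ge0 // => i _; exact: sinc2_ge0.
Qed.

Lemma sin_muln_eq0 (a : R) (n : nat) : sin a = 0 -> sin (n%:R * a) = 0.
Proof.
move=> a0; elim: n => [|n IH]; first by rewrite mul0r sin0.
by rewrite -addn1 natrD mulrDl mul1r sinD IH a0 mul0r mulr0 addr0.
Qed.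

(** Up to a common factor each term is [1 / y_i ^ 2], which lies between [1 / sin (y_i) ^ 2 - 2] and
    [1 / sin (y_i) ^ 2]. With that factor the inverse squared sines sum exactly to 1 by
    [sum_inv_sin2], and the [2 N] errors add up to at most [1 / N]. *)
Lemma window_bounds (m : nat) x : sinsq x != 0 -> 2 * `|x| <= 2 ^+ m ->
  1 - (2 ^+ m)^-1 <= window (2 ^ m) x <= 1.
Proof.
move=> s0 xm; set N := (2 ^ m)%N.
have NE : N%:R = 2 ^+ m :> R by rewrite /N natrX.
have N0 : 0 < N%:R :> R by rewrite NE exprn_gt0.
have p0 := pi_gt0 R.
(* Division by [2 ^ m.+1 = 2 N] spreads the [2 N] arguments over one period of [sin ^ 2], and
   [2 |x| <= N] keeps them within [3 pi / 4] of 0. *)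
pose y i : R := (pi * (x - N%:R) + i%:R * pi) / 2 ^+ m.+1.
have yE i : y i = pi * (x + i%:R - N%:R) / (2 * N%:R).
  by rewrite /y exprS -NE; congr (_ / _); ring.
have sy : sin (pi * (x - N%:R)) ^+ 2 = pi ^+ 2 * sinsq x.
  rewrite -(sinsqBn N) /sinsq; move: (sin _) => t; move: pi p0; clear => p p0.
  by field; rewrite gt_eqF.
have sy0 : sin (pi * (x - N%:R)) != 0.
  by rewrite -sqrf_eq0 sy mulf_neq0 // expf_neq0 // gt_eqF.
have S := sum_inv_sin2 m.+1 sy0.
rewrite expnS mul2n -/N in S.
have V0 : 0 < sinsq x by rewrite lt_neqAle eq_sym s0 sinsq_ge0.
have sz i : sinc2 (x + i%:R - N%:R) = sinsq x * (pi / (2 * N%:R)) ^+ 2 * (y i ^+ 2)^-1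
   /\ y i != 0.
  have e : sinsq (x + i%:R - N%:R) = sinsq x by rewrite sinsqBn sinsqDn.
  have n0 : x + i%:R - N%:R != 0.
    by apply: contraNneq s0 => h; rewrite -e h /sinsq mulr0 sin0 mul0r expr0n.
  rewrite sinc2E // e yE; split; last first.
    have nN : 2 * N%:R != 0 :> R by rewrite gt_eqF // mulr_gt0.
    apply: mulf_neq0; last by rewrite invr_neq0.
    by apply: mulf_neq0 => //; rewrite gt_eqF.
  move: pi p0 n0 N0 => p p0; move: (x + _ - _) => z n0 N0.
  by field; rewrite n0 !gt_eqF.
have s2 i : sin (y i) != 0.
  apply: contraNneq s0 => h.
  have := sin_muln_eq0 (2 * N)%N h; rewrite natrM yE mulrC divfK; last first.
    by rewrite mulf_neq0 // gt_eqF.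
  move=> h'; rewrite -(sinsqDn i x) -(sinsqBn N (x + i%:R)) /sinsq h' mul0r expr0n //.
set c := sinsq x * (pi / (2 * N%:R)) ^+ 2.
have c0 : 0 < c by rewrite mulr_gt0 // exprn_gt0 // divr_gt0 // mulr_gt0.
have cS : c * (4 ^+ m.+1 * (sin (pi * (x - N%:R)) ^+ 2)^-1) = 1.
  have -> : 4 ^+ m.+1 = (2 * N%:R) ^+ 2 :> R.
    by rewrite NE -exprS -exprM mulnC exprM expr2 -natrM.
  rewrite sy /c; move: (sinsq x) s0 => V V0'; move: (N%:R) pi N0 p0; clear -V0' => n p N0 p0.
  by field; rewrite V0' !gt_eqF.
have up i : sinc2 (x + i%:R - N%:R) <= c * (sin (y i) ^+ 2)^-1.
  have [-> y0] := sz i; rewrite ler_pM2l // lef_pV2 ?posrE ?exprn_even_gt0 ?y0 ?s2 //.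
  exact: sin2_le_sqr.
have lo i : (i < N.*2)%N ->
    c * (sin (y i) ^+ 2)^-1 - c * 2 <= sinc2 (x + i%:R - N%:R).
  move=> iN; have [-> y0] := sz i; rewrite -mulrBr ler_pM2l //.
  have hy : `|y i| <= 3 / 4 * pi.
    have iN' : i%:R <= 2 * N%:R :> R by rewrite -natrM ler_nat mul2n ltnW.
    have z1 : `|x + i%:R - N%:R| <= 3 / 2 * N%:R.
      have i0 : 0 <= i%:R :> R by [].
      move: xm; rewrite -NE ler_norml; have := ler_norm x; have := ler_norm (- x).
      by rewrite normrN; lra.
    rewrite yE normrM normfV normrM (gtr0_norm p0) [`|2 * _|]gtr0_norm ?mulr_gt0 //.
    rewrite ler_pdivrMr ?mulr_gt0 // mulrC.
    by have := ler_wpM2r (ltW p0) z1; move: pi => p; clear; lra.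
  have := sqr_le_sin2 hy.
  have sp : 0 < sin (y i) ^+ 2 by rewrite exprn_even_gt0 // s2.
  have yp : 0 < y i ^+ 2 by rewrite exprn_even_gt0 // y0.
  move: (sin _ ^+ 2) (y i ^+ 2) sp yp; clear => p q p0 q0 h.
  rewrite lerBlDr (_ : q^-1 + 2 = (1 + 2 * q) / q); last by field; rewrite gt_eqF.
  by rewrite ler_pdivlMr // mulrC ler_pdivrMr // mulrC.
apply/andP; split; last first.
  apply: (le_trans (ler_sum _ (fun i _ => up i))).
  by rewrite -mulr_sumr S cS.
have : \sum_(0 <= i < N.*2) (c * (sin (y i) ^+ 2)^-1 - c * 2) <= window N x.
  by apply: ler_sum_nat => i /andP[_ iN]; exact: lo.
apply: le_trans; rewrite sumrB -mulr_sumr S cS sumr_const_nat subn0 lerD2l lerN2.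
rewrite -NE -[_ *+ N.*2]mulr_natr -(muln2 N) (natrM _ N) /c /sinsq.
have s1 : sin (pi * x) ^+ 2 <= 1 by rewrite sin2cos2 gerBl sqr_ge0.
have -> : (sin (pi * x) / pi) ^+ 2 * (pi / (2 * N%:R)) ^+ 2 * 2 * (N%:R * 2) =
   sin (pi * x) ^+ 2 * N%:R^-1.
  move: (sin _) => s; move: (N%:R) pi N0 p0; clear => n p N0 p0.
  by field; rewrite !gt_eqF.
by rewrite ler_piMl // invr_ge0 ltW.
Qed.

Lemma sinsq_eq0_int x : sinsq x = 0 -> exists n : nat, x = n%:R \/ x = - n%:R.
Proof.
wlog x0 : x / 0 <= x.
  move=> H; have [/H //|/ltW x0 h] := leP 0 x.
  have h' : sinsq (- x) = 0 by move: h; rewrite /sinsq mulrN sinN mulNr sqrrN.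
  have nx0 : 0 <= - x by rewrite oppr_ge0.
  have [n nE] := H (- x) nx0 h'.
  by exists n; case: nE => /(congr1 -%R); rewrite opprK ?opprK; [right|left].
move=> h; have p0 := pi_gt0 R; exists (Num.truncn x); left.
have /andP[h1 h2] := truncn_itv x0.
have : sinsq (x - (Num.truncn x)%:R) = 0 by rewrite sinsqBn.
move/eqP; rewrite /sinsq sqrf_eq0 mulf_eq0 invr_eq0 (gt_eqF p0) orbF.
move: h1; rewrite le_eqVlt => /predU1P[->//|h1].
rewrite gt_eqF // sin_gt0_pi // mulr_gt0 ?subr_gt0 //=.
by rewrite gtr_pMr // ltrBlDl; move: h2; rewrite -addn1 natrD.
Qed.

Lemma sinc2_int0 x : sinsq x = 0 -> x != 0 -> sinc2 x = 0.
Proof. by move=> h x0; rewrite sinc2E // h mul0r. Qed.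

End partition_of_unity.

(** * Beurling's majorant of the step *)

Section beurling_majorant.
Context {R : realType}.
Notation mu := (@lebesgue_measure R).
Implicit Types (x y : R).

(** [window_bounds] excludes the integers, where it would divide by [sinsq x = 0]; there every
    translate vanishes except the one centred at the point, which contributes 1. *)
Lemma window_int x (N n : nat) : sinsq x = 0 -> x = n%:R \/ x = - n%:R ->
  (n < N)%N -> window N x = 1.
Proof.
move=> s0 xn nN.
have [i0 i0N xi0] : exists2 i, (i < N.*2)%N & x + i%:R - N%:R = 0.
  case: xn => ->.
    exists (N - n)%N; last by rewrite natrB ?(ltnW nN) //; ring.
    by rewrite -addnn (leq_ltn_trans (leq_subr _ _)) // -[ltnLHS]addn0 ltn_add2l (leq_ltn_trans _ nN).
  exists (N + n)%N; last by rewrite natrD; ring.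
  by rewrite -addnn ltn_add2l.
rewrite /window (bigD1_seq i0) ?mem_index_iota ?iota_uniq //= xi0 sinc20.
rewrite big1_seq ?addr0 // => i /andP[ii0 _].
apply: sinc2_int0; first by rewrite sinsqBn sinsqDn.
rewrite -xi0 -subr_eq0 (_ : _ - _ = i%:R - i0%:R); last by ring.
by rewrite subr_eq0 eqr_nat.
Qed.

Lemma expn_big (m : nat) x : exists M : nat, (m <= M)%N /\ x <= 2 ^+ M.
Proof.
have [n xn] : exists n : nat, x <= n%:R.
  by exists (Num.bound `|x|); exact: le_trans (ler_norm x) (ltW (archi_boundP (normr_ge0 x))).
exists (maxn m n); rewrite leq_maxl; split => //.
rewrite (le_trans xn) // -natrX ler_nat.
by rewrite (leq_trans (leq_maxr m n)) // ltnW // ltn_expl.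
Qed.

Lemma window_le1 N x : window N x <= 1.
Proof.
have [s0|s0] := eqVneq (sinsq x) 0.
  have [n xn] := sinsq_eq0_int s0.
  rewrite -(window_int s0 xn (leq_maxl n.+1 N)).
  by apply: window_mono; exact: leq_maxr.
have [m [Nm xm]] := expn_big N (2 * `|x|).
have /andP[_ w1] := window_bounds s0 xm.
apply: le_trans w1; apply: window_mono.
by rewrite (leq_trans Nm) // ltnW // ltn_expl.
Qed.

(** Monotonicity in [N] reduces the limit to dyadic values, for which [window_bounds] is
    available. *)
Lemma window_cvg x : window N x @[N --> \oo] --> (1 : R).
Proof.
have [s0|s0] := eqVneq (sinsq x) 0.
  have [n xn] := sinsq_eq0_int s0.
  apply: cvg_near_cst; near=> N; apply: window_int s0 xn _.
  by near: N; exact: nbhs_infty_gt.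
apply/cvgrPdist_le => e e0.
have [m [_ em]] := expn_big 0 (Num.max (2 * `|x|) e^-1).
move: em; rewrite ge_max => /andP[xm em].
have /andP[w0 _] := window_bounds s0 xm.
have h : (2 ^+ m)^-1 <= e by rewrite -[leRHS]invrK lef_pV2 ?posrE ?invr_gt0 ?exprn_gt0.
near=> N; rewrite ger0_norm ?subr_ge0 ?window_le1 // lerBlDr.
have : window (2 ^ m) x <= window N x.
  by apply: window_mono; near: N; exact: nbhs_infty_ge.
by lra.
Unshelve. all: by end_near.
Qed.

Definition comb (N : nat) x := \sum_(0 <= i < N) sinc2 (x - i%:R).

Lemma window_comb N x : window N (- x) = comb N x + \sum_(0 <= i < N) sinc2 (x + i.+1%:R).
Proof.
by rewrite windowE; congr (_ + _); apply: eq_bigr => i _; rewrite -sinc2_even; congr sinc2; ring.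
Qed.

Lemma comb_ge0 N x : 0 <= comb N x.
Proof. by apply: sumr_ge0 => i _; exact: sinc2_ge0. Qed.

Lemma comb_le1 N x : comb N x <= 1.
Proof.
have := window_le1 N (- x); rewrite window_comb; apply: le_trans.
by rewrite lerDl; apply: sumr_ge0 => i _; exact: sinc2_ge0.
Qed.

Lemma comb_mono x : nondecreasing_seq (comb ^~ x).
Proof.
move=> N M NM; rewrite /comb [leRHS](big_cat_nat (n := N)) //= lerDl.
by apply: sumr_ge0 => i _; exact: sinc2_ge0.
Qed.

Lemma is_cvg_comb x : cvgn (comb ^~ x).
Proof.
apply: nondecreasing_is_cvgn; first exact: comb_mono.
by exists 1 => _ [N _ <-]; exact: comb_le1.
Qed.

(* The Heaviside function, with the value [1 / 2] at [0]. *)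
Definition step x : R := ((0 < x)%R%:R + (0 <= x)%R%:R) / 2.

Lemma stepN x : step x + step (- x) = 1.
Proof.
rewrite /step oppr_gt0 oppr_ge0.
by case: (ltgtP x 0) => //= h; rewrite ?addr0 ?add0r; field.
Qed.

(* Beurling's majorant [sum_(n >= 0) sinc2 (x - n) + x sinc2 x] of [step]. *)
Definition beurling x := limn (comb ^~ x) + sinsq x / x.

Definition beurling_gap x := beurling x - step x.

Lemma comb_cvg x : comb N x + sinsq x / x @[N --> \oo] --> beurling x.
Proof. by apply: cvgD; [exact: is_cvg_comb | exact: cvg_cst]. Qed.

Lemma sinsqN x : sinsq (- x) = sinsq x.
Proof. by rewrite /sinsq mulrN sinN mulNr sqrrN. Qed.

(** The translates by all integers sum to 1, and the one at 0 is counted twice in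
    [comb N x + comb N (- x)]; the odd terms [sinsq x / x] cancel, and the two steps add up to 1. *)
Lemma beurling_gapD x : beurling_gap x + beurling_gap (- x) = sinc2 x.
Proof.
have c1 : comb N x + comb N (- x) @[N --> \oo] --> 1 + (sinc2 x - 0).
  have E N : comb N x + comb N (- x) = window N (- x) + (sinc2 x - sinc2 (x + N%:R)).
    rewrite window_comb -addrA; congr (_ + _).
    have -> : comb N (- x) = \sum_(0 <= i < N) sinc2 (x + i%:R).
      by apply: eq_bigr => i _; rewrite -sinc2_even; congr sinc2; ring.
    elim: N => [|N IH]; first by rewrite !big_geq // addr0; ring.
    by rewrite !big_nat_recr //= IH; ring.
  under [X in X @ _]eq_fun do rewrite E.
  apply: cvgD; first exact: window_cvg.
  apply: cvgB; first exact: cvg_cst.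
  have h := @is_cvg_comb (- x).
  (* The extreme term [sinc2 (x + N)] tends to 0 as an increment of a convergent sequence. *)
  have h0 : comb N.+1 (- x) - comb N (- x) @[N --> \oo] --> limn (comb ^~ (- x)) - limn (comb ^~ (- x)).
    by apply: cvgB => //; rewrite (cvg_shiftS (comb ^~ (- x))).
  rewrite subrr in h0; apply: cvg_trans h0.
  apply: near_eq_cvg; near=> N; rewrite /comb big_nat_recr //= addrAC subrr add0r.
  by rewrite -sinc2_even; congr sinc2; ring.
have c2 : comb N x + comb N (- x) @[N --> \oo] --> limn (comb ^~ x) + limn (comb ^~ (- x)).
  by apply: cvgD; exact: is_cvg_comb.
have E : 1 + sinc2 x = limn (comb ^~ x) + limn (comb ^~ (- x)).
  by rewrite -(subr0 (sinc2 x)); exact: (cvg_unique _ c1 c2).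
rewrite /beurling_gap /beurling sinsqN invrN mulrN.
by have := stepN x; lra.
Unshelve. all: by end_near.
Qed.

(** With [z = y + n] the term [sinc2 (- z)] equals [sinsq y / z ^ 2], and
    [1 / z ^ 2 >= 1 / z - 1 / (z + 1)] telescopes. In the limit the comb compensates the negative
    value of [sinsq x / x] at [x = - y]. *)
Lemma comb_neg N y : 0 < y -> sinsq y * (y^-1 - (y + N%:R)^-1) <= comb N (- y).
Proof.
move=> y0; elim: N => [|N IH].
  by rewrite addr0 subrr mulr0 /comb big_geq.
rewrite /comb big_nat_recr //= -/(comb N (- y)) (_ : - y - N%:R = - (y + N%:R)); last by ring.
have yN : 0 < y + N%:R by rewrite ltr_wpDr.
have yN1 : 0 < y + N.+1%:R by rewrite ltr_wpDr.
rewrite sinc2_even sinc2E ?gt_eqF // sinsqDn.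
apply: (@le_trans _ _ (sinsq y * (y^-1 - (y + N%:R)^-1) + sinsq y / (y + N%:R) ^+ 2)); last by rewrite lerD2r.
rewrite -mulrDr ler_wpM2l ?sinsq_ge0 // -[N.+1]addn1 natrD addrA.
move: (y + N%:R) yN => z z0.
have z1 : 0 < z + 1 by rewrite addr_gt0.
have : (z + 1)^-1 - z^-1 + (z ^+ 2)^-1 = (z ^+ 2 * (z + 1))^-1.
  by field; rewrite !gt_eqF.
have : 0 <= (z ^+ 2 * (z + 1))^-1 by rewrite invr_ge0 mulr_ge0 ?sqr_ge0 // ltW.
by lra.
Qed.

Lemma comb_right N y : 0 < y ->
  \sum_(0 <= i < N) sinc2 (y + i.+1%:R) <= sinsq y * (y^-1 - (y + N%:R)^-1).
Proof.
move=> y0; elim: N => [|N IH].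
  by rewrite addr0 subrr mulr0 big_geq.
rewrite big_nat_recr //=.
have yN : 0 < y + N%:R by rewrite ltr_wpDr.
have yN1 : 0 < y + N.+1%:R by rewrite ltr_wpDr.
rewrite sinc2E ?gt_eqF // sinsqDn.
apply: (@le_trans _ _ (sinsq y * (y^-1 - (y + N%:R)^-1) + sinsq y / (y + N.+1%:R) ^+ 2)); first by rewrite lerD2r.
rewrite -mulrDr ler_wpM2l ?sinsq_ge0 // -[N.+1]addn1 natrD addrA.
move: (y + N%:R) yN => z z0.
have z1 : 0 < z + 1 by rewrite addr_gt0.
have : z^-1 - (z + 1)^-1 - ((z + 1) ^+ 2)^-1 = (z * (z + 1) ^+ 2)^-1.
  by field; rewrite !gt_eqF.
have : 0 <= (z * (z + 1) ^+ 2)^-1 by rewrite invr_ge0 mulr_ge0 ?sqr_ge0 // ltW.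
by lra.
Qed.

Lemma cvg_invDn y : (y + N%:R)^-1 @[N --> \oo] --> (0 : R).
Proof.
apply/cvgr0Pnorm_lt => e e0; near=> N.
have h : e^-1 - y < N%:R by near: N; exact: nbhs_infty_gtr.
have yN : e^-1 < y + N%:R by lra.
have e1 : 0 < e^-1 by rewrite invr_gt0.
rewrite gtr0_norm ?invr_gt0 ?(lt_trans e1) // -[ltRHS]invrK ltf_pV2 ?posrE //.
exact: lt_trans yN.
Unshelve. all: by end_near.
Qed.

(** To the left of 0 [comb_neg] suffices. To the right the comb is 1 minus the opposite half of the
    partition of unity, which [comb_right] bounds. At 0 the symmetric identity gives the gap
    [1/2]. *)
Lemma beurling_gap_ge0 x : 0 <= beurling_gap x.
Proof.
have lim_c (c y : R) : c * (y^-1 - (y + N%:R)^-1) @[N --> \oo] --> c * (y^-1 - 0).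
  by apply: cvgM; [exact: cvg_cst | apply: cvgB; [exact: cvg_cst | exact: cvg_invDn]].
have [x0|x0|->] := ltgtP x 0; last first.
- have := beurling_gapD 0; rewrite oppr0 sinc20; by lra.
- have s1 : step x = 1 by rewrite /step x0 (ltW x0) /=; field.
  rewrite /beurling_gap /beurling s1.
  have c1 : window N (- x) - \sum_(0 <= i < N) sinc2 (x + i.+1%:R) @[N --> \oo] --> limn (comb ^~ x).
    have := @is_cvg_comb x; apply: cvg_trans; apply: near_eq_cvg; near=> N.
    by rewrite window_comb addrK.
  have c2 : window N (- x) - sinsq x * (x^-1 - (x + N%:R)^-1) @[N --> \oo] -->
      1 - sinsq x * (x^-1 - 0).
    by apply: cvgB; [exact: window_cvg | exact: lim_c].
  have : 1 - sinsq x * (x^-1 - 0) <= limn (comb ^~ x).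
    apply: (ler_cvg_to c2 c1); near=> N; rewrite lerD2l lerN2.
    exact: comb_right.
  by rewrite subr0; lra.
- have s0 : step x = 0 by rewrite /step (lt_gtF x0) leNgt x0 /= addr0 mul0r.
  have y0 : 0 < - x by rewrite oppr_gt0.
  rewrite /beurling_gap /beurling s0.
  have : sinsq (- x) * ((- x)^-1 - 0) <= limn (comb ^~ x).
    apply: (ler_cvg_to (lim_c _ _) (@is_cvg_comb x)); near=> N.
    by have := comb_neg N y0; rewrite opprK.
  by rewrite sinsqN invrN subr0; lra.
Unshelve. all: by end_near.
Qed.

Lemma beurling_gap_le x : beurling_gap x <= sinc2 x.
Proof. by rewrite -beurling_gapD lerDl beurling_gap_ge0. Qed.

End beurling_majorant.

(** * Kernels asymptotically orthogonal to a bounded sequence *)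

Section vanishing_pairings.
Context {R : realType}.
Notation mu := (@lebesgue_measure R).
Implicit Types (w K Q : R -> R) (x y : R).

Variables (f : nat -> R -> R) (C : R).
Hypothesis mf : forall n, measurable_fun setT (f n).
Hypothesis fC : forall n x, `|f n x| <= C.

Definition vanishes K := L1 K /\ \int[mu]_x (K x * f n x) @[n --> \oo] --> (0 : R).

Lemma L1_mulf n K : L1 K -> L1 (fun x => K x * f n x).
Proof. by move=> lK; exact: L1_bdd lK (mf n) (fC n). Qed.

Lemma vanishesD K K' : vanishes K -> vanishes K' -> vanishes (fun x => K x + K' x).
Proof.
move=> [l c] [l' c']; split; first exact: L1D.
have E n : \int[mu]_x ((K x + K' x) * f n x) =
    \int[mu]_x (K x * f n x) + \int[mu]_x (K' x * f n x).
  rewrite -intD; [|exact: L1_mulf|exact: L1_mulf].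
  by apply: eq_int => x; rewrite mulrDl.
under [X in X @ _]eq_fun do rewrite E.
by rewrite -(addr0 (0 : R)); apply: cvgD.
Qed.

Lemma vanishesZ c K : vanishes K -> vanishes (fun x => c * K x).
Proof.
move=> [l h]; split; first exact: L1Z.
have E n : \int[mu]_x (c * K x * f n x) = c * \int[mu]_x (K x * f n x).
  rewrite -intZ; last exact: L1_mulf.
  by apply: eq_int => x; rewrite mulrA.
under [X in X @ _]eq_fun do rewrite E.
by rewrite -(mulr0 c); apply: cvgM => //; exact: cvg_cst.
Qed.

Lemma eq_vanishes K K' : (forall x, K x = K' x) -> vanishes K -> vanishes K'.
Proof. by move=> /funext ->. Qed.

(** The bound [C] on the sequence makes the class closed under dominated limits: the error is at
    most [C] times the L^1 distance from [K_ m] to [K], uniformly in [n]. *)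
Lemma vanishes_dct (K_ : nat -> R -> R) K D : (forall m, vanishes (K_ m)) ->
  measurable_fun setT K -> (forall x, K_ m x @[m --> \oo] --> K x) -> L1 D ->
  (forall m x, `|K_ m x| <= D x) -> vanishes K.
Proof.
move=> gK mK cK lD KD.
have mK_ m : measurable_fun setT (K_ m) by apply: L1_measurable; case: (gK m).
have [lK _] := dct mK_ mK cK lD KD; split => //.
have C0 : 0 <= C by exact: le_trans (normr_ge0 _) (fC 0%N 0).
have ld m : L1 (fun x => `|K_ m x - K x|) by apply: L1_norm; apply: L1B => //; case: (gK m).
have KD' x : `|K x| <= D x.
  apply: (ler_cvg_to (cvg_norm (cK x)) (@cvg_cst _ (D x) nat \oo _)).
  by apply: nearW => m; exact: KD.
have cd : \int[mu]_x `|K_ m x - K x| @[m --> \oo] --> \int[mu]_x (0 : R).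
  apply: (dct (g := fun x => 2 * D x) _ _ _ _ _).2 => //.
  - by move=> m; exact: L1_measurable (ld m).
  - move=> x; rewrite -(@normr0 _ R) -(subrr (K x)); apply: cvg_norm.
    by apply: cvgB; [exact: cK | exact: cvg_cst].
  - exact: L1Z.
  - move=> m x; rewrite normr_id (le_trans (ler_normB _ _)) //.
    by have := KD m x; have := KD' x; lra.
rewrite Rintegral_cst // mul0r in cd.
apply/cvgr0Pnorm_le => e e0.
have eC : 0 < e / 2 / (C + 1) by rewrite !divr_gt0 // ltr_pwDr.
move/cvgr0Pnorm_le : cd => /(_ _ eC)[m _ /(_ m (leqnn m))] /= hm.
have [_ /cvgr0Pnorm_le/(_ (e / 2))] := gK m; rewrite divr_gt0 // => /(_ isT).
apply: filterS => n hn.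
have lm := L1_mulf n (gK m).1; have lk := L1_mulf n lK.
have -> : \int[mu]_x (K x * f n x) = \int[mu]_x (K_ m x * f n x) -
    \int[mu]_x (K_ m x * f n x - K x * f n x).
  by rewrite intB //; ring.
rewrite (le_trans (ler_normB _ _)) // [leRHS]splitr lerD //.
apply: (@le_trans _ _ (\int[mu]_x (C * `|K_ m x - K x|))).
  apply: int_norm_le; [exact: L1B | exact: L1Z |].
  by move=> x; rewrite -mulrBl normrM mulrC ler_wpM2r.
rewrite intZ //; move: hm; rewrite ger0_norm; last by apply: Rintegral_ge0.
rewrite ler_pdivlMr ?ltr_pwDr // mulrC => hm; apply: le_trans hm.
by rewrite ler_wpM2r ?lerDl //; apply: Rintegral_ge0.
Qed.

Section modulated.
Variable Q : R -> R.
Hypothesis lQ : L1 Q.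
Hypothesis vQ : forall t, `|t| <= 2 * pi ->
  vanishes (fun x => Q x * cos (t * x)) /\ vanishes (fun x => Q x * sin (t * x)).

(** Fubini writes the pairing as an integral over [s] of the pairings at frequency [2 pi s]. These
    tend to 0 for [|s| <= 1] and are bounded by [C] times the L^1 norm of [Q], so dominated
    convergence in [s] applies. The function [g] stands for cosine or sine. *)
Lemma vanishes_modulated (g : R -> R) w : (forall z, `|g z| <= 1) -> continuous g ->
  (forall F : R -> R, L1 F -> continuous (fun s : R => \int[mu]_x (F x * g (s * x)))) ->
  (forall t, `|t| <= 2 * pi -> vanishes (fun x => Q x * g (t * x))) ->
  L1 w -> (forall s, 1 < `|s| -> w s = 0) ->
  vanishes (fun x => Q x * \int[mu]_s (w s * g (s * (2 * pi * x)))).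
Proof.
move=> g1 cg cgint vg lw w0; have p0 := pi_gt0 R.
have mg : measurable_fun setT (fun z : R * R => g (z.2 * (2 * pi * z.1))).
  apply: (measurableT_comp (cts_measurable cg)).
  by apply: measurable_funM => //; exact: measurable_funM.
have msec x : measurable_fun setT (fun s : R => g (s * (2 * pi * x))).
  apply: cts_measurable => s; apply: continuous_comp; last exact: cg.
  by apply: cvgM => //; exact: cvg_cst.
split.
  apply: (@L1_bdd _ _ _ (\int[mu]_s `|w s|) lQ).
    have -> : (fun x => \int[mu]_s (w s * g (s * (2 * pi * x)))) =
        (fun u => \int[mu]_s (w s * g (u * s))) \o (fun x => 2 * pi * x).
      by apply/funext => x /=; apply: eq_int => s; rewrite [s * _]mulrC.
    apply: (measurableT_comp (cts_measurable (cgint _ lw))).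
    exact: measurable_funM.
  move=> x; apply: int_norm_le; [exact: L1_bdd lw (msec x) (fun=> g1 _) | exact: L1_norm |].
  by move=> s; rewrite normrM ler_piMr.
have E n : \int[mu]_x (Q x * \int[mu]_s (w s * g (s * (2 * pi * x))) * f n x) =
    \int[mu]_s (w s * \int[mu]_x (Q x * f n x * g (s * (2 * pi * x)))).
  rewrite -(@fubini_mul _ _ _ (fun x s => g (s * (2 * pi * x))) 1 (L1_mulf n lQ) lw mg (fun _ _ => g1 _)).
  by apply: eq_int => x; rewrite mulrAC.
under [X in X @ _]eq_fun do rewrite E.
have C0 : 0 <= C by exact: le_trans (normr_ge0 _) (fC 0%N 0).
have mI n : measurable_fun setT (fun s : R => \int[mu]_x (Q x * f n x * g (s * (2 * pi * x)))).
  have -> : (fun s => \int[mu]_x (Q x * f n x * g (s * (2 * pi * x)))) =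
      (fun s => \int[mu]_x (Q x * f n x * g (s * x))) \o (fun s => s * (2 * pi)).
    by apply/funext => s /=; apply: eq_int => x; rewrite mulrA.
  apply: (measurableT_comp (cts_measurable (cgint _ (L1_mulf n lQ)))).
  exact: measurable_funM.
have bI n s : `|\int[mu]_x (Q x * f n x * g (s * (2 * pi * x)))| <= C * \int[mu]_x `|Q x|.
  rewrite -intZ; last exact: L1_norm.
  apply: int_norm_le; last 1 first.
  - move=> x; rewrite !normrM mulrAC -[leRHS]mulr1 mulrAC [C * _]mulrC.
    by rewrite ler_pM // ?mulr_ge0 // ler_pM.
  - apply: (L1_bdd (L1_mulf n lQ) _ (fun=> g1 _)).
    apply: cts_measurable => x; apply: continuous_comp; last exact: cg.
    by do 2 (apply: cvgM; first exact: cvg_cst).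
  - exact/L1Z/L1_norm.
rewrite (_ : 0 = \int[mu]_x (0 : R)); last by rewrite Rintegral_cst // mul0r.
apply: (dct (g := fun s => C * \int[mu]_x `|Q x| * `|w s|) _ _ _ _ _).2 => //.
- by move=> n; apply: measurable_funM => //; exact: L1_measurable.
- move=> s; have [s1|s1] := leP `|s| 1; last first.
    by rewrite w0 //; under [X in X @ _]eq_fun do rewrite mul0r; exact: cvg_cst.
  rewrite -(mulr0 (w s)); apply: cvgM; first exact: cvg_cst.
  have /vg[_] : `|s * (2 * pi)| <= 2 * pi.
    by rewrite normrM [`|2 * pi|]gtr0_norm ?mulr_gt0 // ler_piMl // mulr_ge0 // ltW.
  apply: cvg_trans; apply: near_eq_cvg; apply: nearW => n.
  by apply: eq_int => x; rewrite -[s * (2 * pi) * x]mulrA mulrAC.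
- exact/L1Z/L1_norm.
- by move=> n s; rewrite normrM mulrC ler_wpM2r.
Qed.

Lemma vanishes_cos w : L1 w -> (forall s, 1 < `|s| -> w s = 0) ->
  vanishes (fun x => Q x * \int[mu]_s (w s * cos (s * (2 * pi * x)))).
Proof.
apply: vanishes_modulated norm_cos_le1 (@continuous_cos R) _ _.
  move=> F lF; have := @continuous_cos_int R F 0 lF.
  by under eq_fun do (under eq_Rintegral do rewrite addr0).
by move=> t /vQ[].
Qed.

Lemma vanishes_sin w : L1 w -> (forall s, 1 < `|s| -> w s = 0) ->
  vanishes (fun x => Q x * \int[mu]_s (w s * sin (s * (2 * pi * x)))).
Proof.
apply: vanishes_modulated norm_sin_le1 (@continuous_sin R) _ _.
  move=> F lF; have := @continuous_cos_int R F (- (pi / 2)) lF.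
  by under eq_fun do (under eq_Rintegral do rewrite -sinDpihalf subrK).
by move=> t /vQ[].
Qed.

Lemma vanishes_sinc2 (a : R) : vanishes (fun x => Q x * sinc2 (x + a)).
Proof.
(* The shift by [a] is absorbed into the weights by the addition formula. *)
pose wc s := tri s * cos (2 * pi * a * s); pose ws s := tri s * sin (2 * pi * a * s).
have t0 s : 1 < `|s| -> tri s = 0 by move=> h; rewrite /tri max_l // subr_le0 ltW.
have h1 s : 1 < `|s| -> wc s = 0 by move=> /t0; rewrite /wc => ->; rewrite mul0r.
have h2 s : 1 < `|s| -> ws s = 0 by move=> /t0; rewrite /ws => ->; rewrite mul0r.
have V := vanishesD (vanishes_cos (L1_cos _ tri_L1) h1) (vanishesZ (-1) (vanishes_sin (L1_sin _ tri_L1) h2)).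
apply: eq_vanishes V => x; rewrite mulN1r -mulrBr -intB; last 2 first.
- exact: cos_L1 (L1_cos _ tri_L1).
- have := L1_sin (2 * pi * x) (L1_sin (2 * pi * a) tri_L1).
  by apply: eq_L1 => s; rewrite /ws [s * _]mulrC.
congr (_ * _); apply: eq_int => s; rewrite /wc /ws.
rewrite (_ : s * (2 * pi * (x + a)) = s * (2 * pi * x) + 2 * pi * a * s); last by ring.
by rewrite cosD; ring.
Qed.

Lemma vanishes_sinsq_div (a : R) : vanishes (fun x => Q x * (sinsq (x + a) / (x + a))).
Proof.
have p0 := @pi_neq0 R.
have l1 : L1 (\1_`[0, 1] : R -> R).
  have := @L1_cts_itv R (fun=> 1) 0 1; move=> /(_ (fun _ => cvg_cst _)).
  by apply: eq_L1 => s; rewrite mul1r.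
have i0 (s : R) : 1 < `|s| -> \1_`[0, 1] s = 0 :> R.
  move=> h; rewrite indicE mem_setE in_itv /= (_ : (0 <= s <= 1) = false) //.
  by apply: contraTF h => /andP[s0 s1]; rewrite -leNgt ger0_norm.
pose wc s : R := \1_`[0, 1] s * cos (2 * pi * a * s).
pose ws s : R := \1_`[0, 1] s * sin (2 * pi * a * s).
have h1 s : 1 < `|s| -> wc s = 0 by move=> /i0; rewrite /wc => ->; rewrite mul0r.
have h2 s : 1 < `|s| -> ws s = 0 by move=> /i0; rewrite /ws => ->; rewrite mul0r.
have V := vanishesZ pi^-1 (vanishesD (vanishes_sin (L1_cos _ l1) h1) (vanishes_cos (L1_sin _ l1) h2)).
apply: eq_vanishes V => x; rewrite -mulrDr mulrCA sinsq_div -intD; last 2 first.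
- have := L1_sin (2 * pi * x) (L1_cos (2 * pi * a) l1).
  by apply: eq_L1 => s; rewrite /wc [s * _]mulrC.
- exact: cos_L1 (L1_sin _ l1).
congr (_ * (_ * _)); apply: eq_int => s; rewrite /wc /ws.
rewrite (_ : s * (2 * pi * (x + a)) = s * (2 * pi * x) + 2 * pi * a * s); last by ring.
by rewrite sinD; ring.
Qed.

End modulated.

End vanishing_pairings.

(** * The one-sided bound with the sharp constant *)

Section beurling_bound.
Context {R : realType}.
Notation mu := (@lebesgue_measure R).
Implicit Types (x y : R).

Lemma L1_indic_cc (a b : R) : L1 (\1_`[a, b] : R -> R).
Proof.
have := @L1_cts_itv R (fun=> 1) a b; move=> /(_ (fun _ => cvg_cst _)).
by apply: eq_L1 => s; rewrite mul1r.
Qed.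

Lemma measurable_comb N : measurable_fun setT (comb N : R -> R).
Proof.
rewrite /comb; elim: N => [|N IH].
  by under eq_fun do rewrite big_geq //; exact: measurable_cst.
under eq_fun do rewrite big_nat_recr //=.
apply: measurable_funD => //; apply: (measurableT_comp (cts_measurable continuous_sinc2)).
exact: measurable_funB.
Qed.

Lemma measurable_indic_itv (D : interval R) : measurable_fun setT (\1_[set` D] : R -> R).
Proof. by apply: measurable_indic; exact: measurable_itv. Qed.

Lemma step_indic x : step x = (\1_`]0, +oo[ x + \1_`[0, +oo[ x) / 2.
Proof. by rewrite /step !indicE !mem_setE !in_itv /= !andbT. Qed.

Lemma measurable_step : measurable_fun setT (@step R).
Proof.
rewrite (_ : @step R = fun x => (\1_`]0, +oo[ x + \1_`[0, +oo[ x) / 2); last exact/funext/step_indic.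
by apply: measurable_funM => //; apply: measurable_funD; exact: measurable_indic_itv.
Qed.

Lemma measurable_sinsq_div : measurable_fun setT (fun x : R => sinsq x / x).
Proof.
have h (x : R) : sinsq x / x = x * sinc2 x.
  have [->|x0] := eqVneq x 0; first by rewrite invr0 mulr0 mul0r.
  by rewrite sinsqE expr2; field.
under eq_fun do rewrite h.
by apply: measurable_funM => //; exact: (cts_measurable continuous_sinc2).
Qed.

Lemma measurable_beurling : measurable_fun setT (@beurling R).
Proof.
apply: (measurable_fun_cvg (h := fun N x => comb N x + sinsq x / x)).
  by move=> N; apply: measurable_funD; [exact: measurable_comb | exact: measurable_sinsq_div].
by move=> x _; exact: comb_cvg.
Qed.

Lemma measurable_gap : measurable_fun setT (@beurling_gap R).
Proof. by apply: measurable_funB; [exact: measurable_beurling | exact: measurable_step]. Qed.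

Lemma gap_L1 : L1 (@beurling_gap R).
Proof.
apply: L1_le measurable_gap sinc2_L1 _ => x.
by rewrite ger0_norm ?beurling_gap_ge0 // beurling_gap_le.
Qed.

Lemma int_gap : \int[mu]_x (@beurling_gap R x) = 1 / 2.
Proof.
have n0 : (-1 : R) != 0 by rewrite oppr_eq0 oner_eq0.
have l := L1_affine 0 n0 gap_L1; have := int_affine 0 n0 gap_L1.
rewrite normrN1 invr1 mul1r => E.
have := @int_sinc2 R.
rewrite (@eq_int _ _ (fun x => beurling_gap x + beurling_gap (-1 * x + 0))); last first.
  by move=> x; rewrite addr0 mulN1r beurling_gapD.
rewrite intD //; last exact: gap_L1.
by rewrite E; move: (\int[mu]_x _) => I; lra.
Qed.

Lemma sinsq_div_le1 x : `|sinsq x / x| <= 1.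
Proof.
rewrite sinsq_div normrM ger0_norm ?invr_ge0 ?pi_ge0 //.
have l1 := L1_indic_cc 0 1.
have i1 : \int[mu]_s \1_`[0, 1] s = 1 :> R.
  transitivity (\int[mu]_(s in `[0, 1]) (1 : R)).
    by rewrite [in RHS]intE; apply: eq_int => s; rewrite mul1r.
  by rewrite Rintegral_cst //= lebesgue_measure_itv /= lte_fin ltr01 /= subr0 mulr1.
have : `|\int[mu]_s (\1_`[0, 1] s * sin (s * (2 * pi * x)))| <= 1.
  rewrite -[leRHS]i1; apply: int_norm_le => //.
    by have := L1_sin (2 * pi * x) l1; apply: eq_L1 => s; rewrite [s * _]mulrC.
  move=> s; rewrite normrM ger0_norm ?indicE //.
  by rewrite ler_piMr // norm_sin_le1.
apply: le_trans; rewrite ler_piMl // invf_le1 ?pi_gt0 //.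
by rewrite (le_trans _ (pi_ge2 R)) // ler1n.
Qed.

Lemma L1_small_tail (P : R -> R) (e : R) : L1 P -> 0 < e ->
  exists A : R, `|\int[mu]_x (P x * \1_(~` `[- A, A]) x)| <= e.
Proof.
move=> lP e0.
have mP := L1_measurable lP.
have mD (A : R) : measurable (~` `[- A, A] : set R) by apply: measurableC; exact: measurable_itv.
have [] := @dct R (fun n x => P x * \1_(~` `[- n%:R, n%:R]) x) (fun=> 0) (fun x => `|P x|).
- by move=> n; apply: measurable_funM => //; exact: measurable_indic.
- exact: measurable_cst.
- move=> x; apply: cvg_near_cst; near=> n.
  rewrite indicE memNset ?mulr0 //= => h; apply: h; rewrite in_itv /= -ler_norml.
  by near: n; exact: nbhs_infty_ger.
- exact: L1_norm.
- move=> n x; rewrite normrM ler_piMr // indicE.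
  by case: (_ \in _); rewrite ?normr1 ?normr0.
rewrite Rintegral_cst // mul0r => _ /cvgr0Pnorm_le/(_ _ e0)[n _ /(_ n (leqnn n)) h].
by exists n%:R.
Unshelve. all: by end_near.
Qed.

Lemma step_shift (d : R) : 0 < d ->
  L1 (fun x => step (x + d) - step x) /\
  (forall x, 0 <= step (x + d) - step x) /\
  (forall x, ~~ (- d <= x <= 0) -> step (x + d) - step x = 0) /\
  \int[mu]_x (step (x + d) - step x) = d.
Proof.
move=> d0.
have E x : step (x + d) - step x = 2^-1 * (\1_`]- d, 0] x + \1_`[- d, 0[ x).
  rewrite /step !indicE !mem_setE !in_itv /=.
  have -> : (0 < x + d) = (- d < x) by rewrite -ltrBlDr sub0r.
  have -> : (0 <= x + d) = (- d <= x) by rewrite -lerBlDr sub0r.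
  case: (ltP 0 x) => x0; case: (leP 0 x) => x1; case: (ltP (- d) x) => x2;
    case: (leP (- d) x) => x3 //=; try (by field); exfalso; lra.
have l1 : L1 (\1_`]- d, 0] : R -> R).
  have := L1_indic (measurable_itv `]- d, 0]) (L1_indic_cc (- d) 0).
  apply: eq_L1 => x; rewrite !indicE !mem_setE !in_itv /=.
  by case: (ltP (- d) x) => [/ltW ->|_]; rewrite ?mulr0 //=; case: (x <= 0); rewrite ?mulr1 ?mulr0.
have l2 : L1 (\1_`[- d, 0[ : R -> R).
  have := L1_indic (measurable_itv `[- d, 0[) (L1_indic_cc (- d) 0).
  apply: eq_L1 => x; rewrite !indicE !mem_setE !in_itv /=.
  by case: (ltP x 0) => [/ltW ->|_]; rewrite ?andbT ?andbF ?mulr0 //; case: (- d <= x); rewrite ?mulr1 ?mulr0.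
have i1 (D : interval R) : \int[mu]_x \1_[set` D] x = fine (mu [set` D]) :> R.
  transitivity (\int[mu]_(s in [set` D]) (1 : R)).
    by rewrite [in RHS]intE; apply: eq_int => s; rewrite mul1r.
  by rewrite Rintegral_cst ?mul1r //; exact: measurable_itv.
split; first by apply: eq_L1 (fun x => esym (E x)) _; apply: L1Z; exact: L1D.
split; first by move=> x; rewrite E mulr_ge0 // ?invr_ge0 // addr_ge0 // indicE.
split.
  move=> x; rewrite E !indicE !mem_setE !in_itv /= negb_and -!ltNge => /orP[h|h].
    by rewrite [- d <= x]leNgt h (lt_gtF h) /= addr0 mulr0.
  by rewrite (lt_gtF h) [x <= 0]leNgt h !andbF addr0 mulr0.
rewrite (eq_int E) intZ; last exact: L1D.
rewrite intD // !i1 !lebesgue_measure_itv /= !lte_fin oppr_lt0 d0 /= sub0r opprK.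
by field.
Qed.

(** Since [beurling_gap] is nonnegative of integral [1/2], weighting [F (x - d) - F x >= - M d] by
    it costs only [M d / 2]. By translation the weighted difference is the pairing of [F] with [L],
    which tends to 0, minus the integral of [F] over [[- d, 0]]. The multiplier [q] is there because
    a pure trigonometric kernel is not integrable; its dilates tend to 1. *)
Theorem beurling_bound (f : nat -> R -> R) (C M : R) (q : R -> R) :
  0 <= M -> (forall n, measurable_fun setT (f n)) -> (forall n x, `|f n x| <= C) ->
  (forall A, \forall n \near \oo, forall x y, - A <= x -> x <= y -> y <= A ->
     f n y - f n x <= M * (y - x)) ->
  L1 q -> {for 0, continuous q} -> q 0 = 1 -> (forall x, `|q x| <= 1) ->
  (forall (m : nat) t, `|t| <= 2 * pi ->
     vanishes f (fun x => q (m.+1%:R^-1 * x) * cos (t * x)) /\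
     vanishes f (fun x => q (m.+1%:R^-1 * x) * sin (t * x))) ->
  forall e, 0 < e -> \forall n \near \oo, f n 0 <= M / 2 + e.
Proof.
move=> M0 mf fC fM lq cq q0 q1 vq e e0.
have C0 : 0 <= C by exact: le_trans (normr_ge0 _) (fC 0%N 0).
(* This step length makes [M d] at most [e / 4]; the [+ 1] covers [M = 0]. *)
pose d := e / 4 / (M + 1).
have d0 : 0 < d by rewrite !divr_gt0 // ltr_pwDr.
have Md : M * d <= e / 4.
  by rewrite /d mulrA ler_pdivrMr ?ltr_pwDr //; have := mulr_ge0 (ltW e0) M0; lra.
have mshift (g : R -> R) : measurable_fun setT g -> measurable_fun setT (fun x => g (x + d)).
  by move=> mg; apply: (measurableT_comp mg); exact: measurable_funD.
have l1d (P : R -> R) : L1 P -> L1 (fun x => P (x + d)).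
  by move=> lP; apply: eq_L1 (L1_affine d (oner_neq0 R) lP) => x; rewrite mul1r.
have [lD [D0 [Dout iD]]] := step_shift d0.
(* Neither [beurling] nor [step] is integrable, but their increments over [d] are. *)
pose L x := beurling (x + d) - beurling x.
have LE x : L x = beurling_gap (x + d) - beurling_gap x + (step (x + d) - step x).
  by rewrite /L /beurling_gap; ring.
have lL : L1 L.
  have lg := gap_L1; apply: eq_L1 (fun x => esym (LE x)) _.
  by apply: L1D => //; apply: L1B => //; exact: l1d.
pose Q m x := q (m.+1%:R^-1 * x).
have lQ m : L1 (Q m).
  have m0 : (m.+1%:R^-1 : R) != 0 by rewrite invr_neq0 // pnatr_eq0.
  by apply: eq_L1 (L1_affine 0 m0 lq) => x; rewrite addr0.
have vcomb m (a : R) N : vanishes f (fun x => Q m x * comb N (x + a)).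
  elim: N => [|N IH].
    apply: eq_vanishes (vanishesZ mf fC 0 (vanishes_sinc2 mf fC (lQ m) (vq m) 0)) => x.
    by rewrite /comb big_geq // mul0r mulr0.
  have := vanishesD mf fC IH (vanishes_sinc2 mf fC (lQ m) (vq m) (a - N%:R)).
  by apply: eq_vanishes => x; rewrite /comb big_nat_recr //= mulrDr addrA.
(* These partial sums are finite combinations of kernels already known to vanish; [beurling] is
   their pointwise limit, and their bound by 2 lets a multiple of [|Q m|] dominate. *)
pose B N x := comb N x + sinsq x / x.
have vB m (a : R) N : vanishes f (fun x => Q m x * B N (x + a)).
  have := vanishesD mf fC (vcomb m a N) (vanishes_sinsq_div mf fC (lQ m) (vq m) a).
  by apply: eq_vanishes => x; rewrite /B mulrDr.
have B2 N x : `|B N x| <= 2.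
  have h1 := sinsq_div_le1 x; rewrite (le_trans (ler_normD _ _)) //.
  by rewrite ger0_norm ?comb_ge0 //; have := comb_le1 N x; lra.
have mL : measurable_fun setT L by exact: L1_measurable lL.
have vQL m : vanishes f (fun x => Q m x * L x).
  have vK N : vanishes f (fun x => Q m x * (B N (x + d) - B N x)).
    have := vanishesD mf fC (vB m d N) (vanishesZ mf fC (-1) (vB m 0 N)).
    by apply: eq_vanishes => x; rewrite addr0 mulN1r mulrBr.
  apply: (vanishes_dct mf fC vK _ _ (L1Z 4 (L1_norm (lQ m)))).
  - by apply: measurable_funM => //; exact: L1_measurable (lQ m).
  - move=> x; apply: cvgM; first exact: cvg_cst.
    by apply: cvgB; exact: comb_cvg.
  - move=> N x; rewrite normrM mulrC ler_wpM2r //.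
    by rewrite (le_trans (ler_normB _ _)) //; have := B2 N (x + d); have := B2 N x; lra.
(* Dilating [q] to the constant 1 removes the multiplier, with [|L|] as the dominating function. *)
have vL : vanishes f L.
  apply: (vanishes_dct mf fC vQL mL _ (L1_norm lL)).
  - move=> x; rewrite -[X in _ --> X]mul1r -q0; apply: cvgM; last exact: cvg_cst.
    apply: (@continuous_cvg _ _ _ _ _ (fun m => m.+1%:R^-1 * x) q 0) => //.
    by rewrite -(mul0r x); apply: cvgM; [exact: cvg_inv_nat | exact: cvg_cst].
  - by move=> m x; rewrite normrM ler_piMl // q1.
pose g := d * (e / 4).
have g0 : 0 < g by rewrite mulr_gt0 // divr_gt0.
have [|A hA] := @L1_small_tail beurling_gap (g / (2 * C + 1)) (@gap_L1) _.
  by rewrite divr_gt0 // ltr_wpDl // mulr_ge0.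
have [_ /cvgr0Pnorm_le/(_ _ g0)] := vL.
apply: filterS2 (fM (`|A| + d)) => n fn hL.
pose F := f n.
have lg := gap_L1.
have lgd := l1d _ lg.
have lLF : L1 (fun x => L x * F x) by exact: L1_mulf mf fC n _ lL.
have lDF : L1 (fun x => (step (x + d) - step x) * F x) by exact: L1_mulf mf fC n _ lD.
have lgF : L1 (fun x => beurling_gap x * F x) by exact: L1_mulf mf fC n _ lg.
have lgdF : L1 (fun x => beurling_gap (x + d) * F x) by exact: L1_mulf mf fC n _ lgd.
have mFd : measurable_fun setT (fun x => F (x - d)).
  by apply: (measurableT_comp (mf n)); exact: measurable_funB.
have lgFd : L1 (fun x => beurling_gap x * F (x - d)) by exact: L1_bdd lg mFd (fun x => fC n _).
have s1 : \int[mu]_x (beurling_gap x * F (x - d)) = \int[mu]_x (beurling_gap (x + d) * F x).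
  have := int_affine d (oner_neq0 R) lgFd; rewrite normr1 invr1 mul1r => <-.
  by apply: eq_int => x; rewrite mul1r addrK.
(* Inside [[- A, A]] the integrand is nonnegative by the one-sided Lipschitz condition; outside it
   is at least [- 2 C] times the gap, whose mass there is small. *)
have key1 : - g <= \int[mu]_x (beurling_gap x * (F (x - d) - F x + M * d)).
  have lt_ : L1 (fun x => beurling_gap x * \1_(~` `[- A, A]) x).
    by apply: L1_indic => //; apply: measurableC; exact: measurable_itv.
  apply: (@le_trans _ _ (- (2 * C + 1) * \int[mu]_x (beurling_gap x * \1_(~` `[- A, A]) x))).
    have C1 : 0 < 2 * C + 1 by rewrite ltr_wpDl // mulr_ge0.
    move: hA; rewrite ler_pdivlMr // mulNr lerN2 mulrC; apply: le_trans.
    by apply: ler_wpM2l; [exact: ltW | exact: ler_norm].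
  rewrite -intZ //; apply: int_le; first exact: L1Z.
    have := L1D (L1B lgFd lgF) (L1Z (M * d) lg); apply: eq_L1 => x; ring.
  move=> x; have g00 := beurling_gap_ge0 x.
  have [xA|xA] := boolP (x \in `[- A, A]%R).
    rewrite indicE memNset ?mulr0; last by apply; exact: xA.
    rewrite mulr_ge0 //; move: xA; rewrite in_itv /= => /andP[h1 h2].
    have := fn (x - d) x; have := ler_norm A => h3.
    by rewrite (_ : x - (x - d) = d); [rewrite -/F => h; have := h _ _ _; lra | ring].
  rewrite indicE mem_set ?mulr1; last by apply/negP.
  rewrite mulrC ler_wpM2l //.
  have := fC n (x - d); have := fC n x; rewrite -/F !ler_norml.
  by have := mulr_ge0 M0 (ltW d0); lra.
(* The step increment lives on [[- d, 0]], and there [F x >= F 0 - M d]. *)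
have key2 : (F 0 - M * d) * d <= \int[mu]_x ((step (x + d) - step x) * F x).
  have -> : (F 0 - M * d) * d = \int[mu]_x ((F 0 - M * d) * (step (x + d) - step x)).
    by rewrite intZ ?iD.
  apply: int_le; [exact: L1Z | exact: lDF |].
  move=> x; have [xd|/Dout ->] := boolP (- d <= x <= 0); last by rewrite mulr0 mul0r.
  rewrite mulrC ler_wpM2l //.
  have /andP[h1 h2] := xd; have := normr_ge0 A => h3.
  have := fn x 0 _ h2 _; rewrite -/F => h.
  have : F 0 - F x <= M * (0 - x) by apply: h; lra.
  have : M * (- x) <= M * d by rewrite ler_wpM2l //; lra.
  lra.
have key3 : \int[mu]_x (beurling_gap x * (F (x - d) - F x + M * d)) =
    \int[mu]_x (L x * F x) - \int[mu]_x ((step (x + d) - step x) * F x) + M * d / 2.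
  transitivity (\int[mu]_x (beurling_gap x * F (x - d)) - \int[mu]_x (beurling_gap x * F x)
     + M * d * \int[mu]_x beurling_gap x).
    rewrite -intZ // -intB // -intD //; last 2 first.
    - exact: L1B.
    - exact: L1Z.
    by apply: eq_int => x; ring.
  rewrite s1 int_gap -intB // -intB //.
  have -> : \int[mu]_x (L x * F x - (step (x + d) - step x) * F x) =
     \int[mu]_x (beurling_gap (x + d) * F x - beurling_gap x * F x).
    by apply: eq_int => x; rewrite LE; ring.
  by rewrite mul1r.
move: hL; rewrite ler_norml -/F => /andP[_ hL].
have : (F 0 - M * d) * d <= (M / 2 + e / 2) * d.
  by move: key1 key2 key3 hL; rewrite /g; lra.
by rewrite ler_pM2r // -/(F 0); lra.
Qed.

End beurling_bound.

Local Open Scope complex_scope.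

(** * Wave packets and Laplace transforms *)

Section pseudofunction_pairing.
Context {R : realType}.
Notation mu := (@lebesgue_measure R).
Implicit Types (f g w : R -> R) (x y t : R) (z : R[i]).

Lemma cabsE z : cabs z = Num.sqrt (complex.Re z ^+ 2 + complex.Im z ^+ 2).
Proof. by case: z. Qed.

Lemma norm_Re_le z : `|complex.Re z| <= cabs z.
Proof. by rewrite cabsE -sqrtr_sqr ler_wsqrtr // lerDl sqr_ge0. Qed.

Lemma norm_Im_le z : `|complex.Im z| <= cabs z.
Proof. by rewrite cabsE -sqrtr_sqr ler_wsqrtr // lerDr sqr_ge0. Qed.

Lemma cabs_le z : cabs z <= `|complex.Re z| + `|complex.Im z|.
Proof.
have h : 0 <= `|complex.Re z| + `|complex.Im z| by rewrite addr_ge0.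
rewrite cabsE -[leRHS]ger0_norm // -sqrtr_sqr ler_wsqrtr // sqrrD !real_normK ?num_real //.
by rewrite addrAC lerDl mulrn_wge0 // mulr_ge0.
Qed.

Lemma complexP z1 z2 : complex.Re z1 = complex.Re z2 ->
  complex.Im z1 = complex.Im z2 -> z1 = z2.
Proof. by case: z1 => a b; case: z2 => c d /= -> ->. Qed.

Lemma ReM z1 z2 : complex.Re (z1 * z2) =
  complex.Re z1 * complex.Re z2 - complex.Im z1 * complex.Im z2.
Proof. by case: z1; case: z2. Qed.

Lemma ImM z1 z2 : complex.Im (z1 * z2) =
  complex.Re z1 * complex.Im z2 + complex.Im z1 * complex.Re z2.
Proof. by case: z1 => a b; case: z2 => c d /=. Qed.

Lemma int_ae_bound f g (c : R -> R) (B : R) : L1 f -> measurable_fun setT g ->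
  measurable_fun setT c -> (forall x, 0 <= c x <= B) ->
  {ae mu, forall x, `|g x| <= c x} ->
  L1 (fun x => g x * f x) /\ `|\int[mu]_x (g x * f x)| <= \int[mu]_x (`|f x| * c x).
Proof.
move=> lf mg mc cB ae.
(* The bound on [g] holds almost everywhere only; clamping [g] to [[- c, c]] changes it on a null
   set and yields a pointwise bound. *)
pose g' x := Num.max (- c x) (Num.min (g x) (c x)).
have mg' : measurable_fun setT g'.
  apply: measurable_maxr; first exact: measurableT_comp.
  exact: measurable_minr.
have g'c x : `|g' x| <= c x.
  have /andP[c0 _] := cB x; rewrite ler_norml le_max lexx /= ge_max ge_min lexx orbT andbT.
  by lra.
have mf := L1_measurable lf.
have lg' : L1 (fun x => g' x * f x).
  apply: eq_L1 (fun x => mulrC (f x) (g' x)) _; apply: (L1_bdd lf mg' (C := B)) => x.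
  by rewrite (le_trans (g'c x)) //; have /andP[] := cB x.
have E : ae_eq mu setT (EFin \o (fun x => g' x * f x)) (EFin \o (fun x => g x * f x)).
  apply: (@filterS _ _ (ae_filter_ringOfSetsType mu) _ _ _ ae) => x h _ /=; congr (_ * _)%:E.
  move: h; rewrite ler_norml /g' => /andP[h1 h2].
  by rewrite min_l // max_r.
have m1 : measurable_fun (setT : set (measurableTypeR R)) (EFin \o (fun x => g x * f x)).
  by apply: (measurable_EFinP _ _).2; exact: measurable_funM.
have m2 : measurable_fun (setT : set (measurableTypeR R)) (EFin \o (fun x => g' x * f x)).
  by apply: (measurable_EFinP _ _).2; exact: measurable_funM.
split.
  apply/integrableP; split => //; have /integrableP[_] := lg'.
  rewrite (ae_eq_integral _ _ _ _ _ (ae_eq_abse E)) //.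
  - exact: measurableT_comp.
  - exact: measurableT_comp.
rewrite (_ : \int[mu]_x (g x * f x) = \int[mu]_x (g' x * f x)); last first.
  rewrite /Rintegral (ae_eq_integral _ _ _ m2 m1 E) //.
apply: int_norm_le => //.
  apply: (L1_bdd (L1_norm lf) mc (C := B)) => x.
  by have /andP[h1 h2] := cB x; rewrite ger0_norm.
by move=> x; rewrite normrM mulrC ler_wpM2l.
Qed.

Lemma derive1n_cosTD A (n : nat) f g c d : Cc A f -> Cc A g ->
  exists f' g' c' d', [/\ Cc A f', Cc A g' &
   derive1n n (fun x => cosT f c x + cosT g d x) = (fun x => cosT f' c' x + cosT g' d' x)].
Proof.
move=> hf hg; elim: n => [|n [f' [g' [c' [d' [hf' hg' E]]]]]]; first by exists f, g, c, d.
exists (fun t => t * f' t), (fun t => t * g' t), (c' + pi / 2), (d' + pi / 2).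
split; [exact: Cc_mulid | exact: Cc_mulid |].
rewrite derive1nS E; apply/funext => x; rewrite derive1E.
have d1 := is_derive_cosT c' x hf'; have d2 := is_derive_cosT d' x hg'.
by have [_ ->] := is_deriveD d1 d2.
Qed.

(** Sums of two transforms are needed because, after the addition formula, the real and imaginary
    parts of [packet_hat] each have this form. *)
Lemma cosTD_schwartz A f1 g1 c1 d1 f2 g2 c2 d2 : Cc A f1 -> Cc A g1 -> Cc A f2 -> Cc A g2 ->
  schwartz (fun x => (cosT f1 c1 x + cosT g1 d1 x) +i* (cosT f2 c2 x + cosT g2 d2 x)).
Proof.
move=> h1 k1 h2 k2; split.
  have s1 : smoothr (cosT f1 c1) := smoothr_cosT h1.
  have s2 : smoothr (cosT g1 d1) := smoothr_cosT k1.
  have s3 : smoothr (cosT f2 c2) := smoothr_cosT h2.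
  have s4 : smoothr (cosT g2 d2) := smoothr_cosT k2.
  by split; [exact: (smoothrD s1 s2) | exact: (smoothrD s3 s4)].
move=> j k; rewrite /cderiv /=.
have [f1' [g1' [c1' [d1' [h1' k1' ->]]]]] := derive1n_cosTD k c1 d1 h1 k1.
have [f2' [g2' [c2' [d2' [h2' k2' ->]]]]] := derive1n_cosTD k c2 d2 h2 k2.
have [B1 b1] := cosT_decay j c1' h1'; have [B2 b2] := cosT_decay j d1' k1'.
have [B3 b3] := cosT_decay j c2' h2'; have [B4 b4] := cosT_decay j d2' k2'.
exists (B1 + B2 + (B3 + B4)) => x.
set u := cosT f1' c1' x + _; set v := cosT f2' c2' x + _.
apply: (@le_trans _ _ (`|x| ^+ j * (`|u| + `|v|))).
  by rewrite ler_wpM2l ?exprn_ge0 //; exact: (cabs_le (u +i* v)).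
rewrite mulrDr /=; apply: lerD.
  apply: le_trans (lerD (b1 x) (b2 x)); rewrite -mulrDr ler_wpM2l ?exprn_ge0 //.
  exact: ler_normD.
apply: le_trans (lerD (b3 x) (b4 x)); rewrite -mulrDr ler_wpM2l ?exprn_ge0 //.
exact: ler_normD.
Qed.

(** Where [|q|] is small the contribution is small uniformly in [n]; on the remaining bounded set
    the translated mass of [f] escapes as [h n] tends to infinity. The bound and the decay of [q]
    hold almost everywhere only, hence the comparison function [c] in the proof. *)
Lemma shift_pairing_cvg0 f (q : R -> R) (h : nat -> R) : L1 f ->
  measurable_fun setT q ->
  (exists M : R, {ae mu, forall x, `|q x| <= M}) ->
  (forall e : R, 0 < e -> exists A : R, {ae mu, forall x, A <= `|x| -> `|q x| <= e}) ->
  h n @[n --> \oo] --> +oo ->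
  (forall n, L1 (fun x => q x * f (x + h n))) /\
  \int[mu]_x (q x * f (x + h n)) @[n --> \oo] --> (0 : R).
Proof.
move=> lf mq [M bM] qv hh.
have lfh c : L1 (fun x => f (x + c)).
  have := L1_affine c (oner_neq0 R) lf.
  by apply: eq_L1 => x; rewrite mul1r.
have bM' : {ae mu, forall x, `|q x| <= `|M|}.
  apply: (@filterS _ _ (ae_filter_ringOfSetsType mu) _ _ _ bM) => x hx.
  exact: le_trans hx (ler_norm M).
split=> [n|].
  have [] := @int_ae_bound _ q (fun=> `|M|) `|M| (lfh (h n)) mq => //.
  by move=> x; rewrite normr_ge0 /=.
apply/cvgrPdist_le => e e0.
pose N := \int[mu]_x `|f x|.
have N0 : 0 <= N by apply: Rintegral_ge0.
have [e' e'0 e'N] : exists2 e' : R, 0 < e' & e' * N <= e / 2.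
  have N1 : 0 < N + 1 by rewrite ltr_wpDl.
  exists (e / 2 / (N + 1)); first by rewrite !divr_gt0.
  by rewrite mulrAC ler_pdivrMr // ler_wpM2l ?lerDl // divr_ge0 // ltW.
have [A hA] := qv _ e'0.
pose I : R -> R := \1_(`[- A, A]%classic).
have I01 x : 0 <= I x <= 1 by rewrite /I indicE; case: (_ \in _) => /=; rewrite ?lexx ?ler01.
have mI : measurable_fun setT I by exact: measurable_indic.
pose c x := e' + `|M| * I x.
have cb x : 0 <= c x <= e' + `|M|.
  have /andP[i0 i1] := I01 x; rewrite /c addr_ge0 ?mulr_ge0 ?(ltW e'0) //=.
  by rewrite lerD2l ler_piMr.
have mc : measurable_fun setT c.
  by apply: measurable_funD => //; exact: measurable_funM.
have qc : {ae mu, forall x, `|q x| <= c x}.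
  apply: (@filterS2 _ _ (ae_filter_ringOfSetsType mu) _ _ _ _ bM' hA) => x h1 h2.
  rewrite /c /I indicE; case: (boolP (x \in _)) => /= hx.
    by rewrite mulr1 (le_trans h1) // lerDr ltW.
  rewrite mulr0 addr0; apply: h2; rewrite leNgt; apply: contra hx => hx.
  by rewrite inE /= in_itv /= -ler_norml ltW.
have lfI n : L1 (fun y => `|f y| * I (1 * y - h n)).
  apply: (L1_bdd (L1_norm lf) (C := 1)).
    by apply: measurableT_comp => //; exact: affine_measurable.
  by move=> y; have /andP[i0 i1] := I01 (1 * y - h n); rewrite ger0_norm.
have [_ lim0] : L1 (fun=> 0 : R) /\
    \int[mu]_y (`|f y| * I (1 * y - h n)) @[n --> \oo] --> \int[mu]_y (0 : R).
  apply: (@dct R _ _ (fun y => `|f y|)).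
  - by move=> n; exact: L1_measurable (lfI n).
  - exact: measurable_cst.
  - move=> y; apply: cvg_near_cst; near=> n.
    rewrite /I indicE (_ : (_ \in _) = false) ?mulr0 //.
    apply/negbTE; rewrite notin_setE /= in_itv /= mul1r => /andP[hy _].
    have : y + A < h n by near: n; move/cvgryPgt : hh; exact.
    by move: hy; clear; lra.
  - exact: L1_norm.
  - move=> n y; have /andP[i0 i1] := I01 (1 * y - h n).
    by rewrite normrM normr_id (ger0_norm i0) ler_piMr.
rewrite /Rintegral integral0 /= in lim0.
near=> n.
rewrite sub0r normrN.
have [_] := int_ae_bound (lfh (h n)) mq mc cb qc.
move=> hb; apply: (le_trans hb).
have E : \int[mu]_x (`|f (x + h n)| * c x) =
    e' * N + `|M| * \int[mu]_y (`|f y| * I (1 * y - h n)).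
  have l1 := L1Z e' (L1_norm lf); have l2 := L1Z `|M| (lfI n).
  have := int_affine (h n) (oner_neq0 R) (L1D l1 l2).
  rewrite normr1 invr1 mul1r (intD l1 l2) (intZ _ (L1_norm lf)) (intZ _ (lfI n)).
  move=> <-; apply: eq_int => x.
  by rewrite !mul1r addrK /c; ring.
rewrite E (_ : e = e / 2 + e / 2); last by clear; field.
apply: lerD.
  exact: e'N.
near: n.
have e2 : 0 < e / 2 by rewrite divr_gt0.
have : `|M| * \int[mu]_y (`|f y| * I (1 * y - h n)) @[n --> \oo] --> `|M| * 0.
  by apply: cvgM lim0; exact: cvg_cst.
rewrite mulr0 => /cvgrPdist_le/(_ _ e2).
apply: filterS => n; rewrite sub0r normrN; exact: le_trans (ler_norm _).
Unshelve. all: by end_near.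
Qed.

Section wave_packets.
Variables (a : R) (phi : R -> R).
Hypotheses (hphi : Cc a phi) (ephi : forall t, phi (- t) = phi t).
Let K := cosT phi 0.

Lemma shift_Cc (t0 : R) : Cc (`|t0| + a) (fun t => phi (t - t0)).
Proof.
split.
  have := @smoothr_affine R 1 (- t0) _ (Cc_smoothr hphi).
  by congr smoothr; apply/funext => t; rewrite mul1r.
move=> t h; case: hphi => _ -> //.
have := ler_normD (t - t0) t0; rewrite subrK => ?; lra.
Qed.

Lemma shift_transform t0 y :
  \int[mu]_t (phi (t - t0) * cos (t * y)) = cos (t0 * y) * K y /\
  \int[mu]_t (phi (t - t0) * sin (t * y)) = sin (t0 * y) * K y.
Proof.
have lp := Cc_L1 hphi.
have s0 : \int[mu]_u (phi u * sin (y * u)) = 0.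
  by apply: int_odd; [move=> u; rewrite ephi mulrN sinN mulrN | exact: L1_sin].
have l1 : L1 (fun u => phi u * cos (u * y)) by exact: cos_L1.
have l2 : L1 (fun u => phi u * sin (y * u)) by exact: L1_sin.
have l3 := L1D (L1Z (cos (t0 * y)) l1) (L1Z (- sin (t0 * y)) l2).
have l4 := L1D (L1Z (sin (t0 * y)) l1) (L1Z (cos (t0 * y)) l2).
have := int_affine (- t0) (oner_neq0 R) l3; have := int_affine (- t0) (oner_neq0 R) l4.
rewrite normr1 invr1 !mul1r => i4 i3.
have KE : \int[mu]_u (phi u * cos (u * y)) = K y.
  by apply: eq_int => u; rewrite addr0.
split.
- transitivity (\int[mu]_x (cos (t0 * y) * (phi x * cos (x * y)) + - sin (t0 * y) * (phi x * sin (y * x)))).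
    rewrite -i3; apply: eq_int => t; rewrite mul1r.
    rewrite (_ : t * y = t0 * y + (t - t0) * y); last by ring.
    by rewrite cosD [y * _]mulrC; ring.
  rewrite intD; [|exact: L1Z|exact: L1Z].
  by rewrite !intZ // s0 mulr0 addr0 KE.
- transitivity (\int[mu]_x (sin (t0 * y) * (phi x * cos (x * y)) + cos (t0 * y) * (phi x * sin (y * x)))).
    rewrite -i4; apply: eq_int => t; rewrite mul1r.
    rewrite (_ : t * y = t0 * y + (t - t0) * y); last by ring.
    by rewrite sinD [y * _]mulrC; ring.
  rewrite intD; [|exact: L1Z|exact: L1Z].
  by rewrite !intZ // s0 mulr0 addr0 KE.
Qed.

Definition packet (t0 h : R) (t : R) : R[i] :=
  (phi (t - t0) * cos (h * t)) +i* (phi (t - t0) * sin (h * t)).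

(* [packet_hat t0 h] has Fourier transform [packet t0 h], so pairing a
   pseudofunction with a packet evaluates its Fourier transform near [- h]. *)
Definition packet_hat (t0 h : R) (x : R) : R[i] :=
  ((2 * pi)^-1 * (cos (t0 * (x + h)) * K (x + h))) +i*
  ((2 * pi)^-1 * (sin (t0 * (x + h)) * K (x + h))).

Lemma packet_Cc t0 h : Cc (`|t0| + a) (fun t => phi (t - t0) * cos (h * t)) /\
  Cc (`|t0| + a) (fun t => phi (t - t0) * sin (h * t)).
Proof.
have hs := shift_Cc t0.
have sc : smoothr (fun t => cos (h * t)).
  by have := @smoothr_cos R h 0; congr smoothr; apply/funext => t; rewrite addr0.
have ss : smoothr (fun t => sin (h * t)).
  by have := @smoothr_sin R h 0; congr smoothr; apply/funext => t; rewrite addr0.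
by split; exact: CcM.
Qed.

Lemma packet_test (U : set R) t0 h : `[t0 - a, t0 + a] `<=` U ->
  test_function U (packet t0 h).
Proof.
move=> sU; have [h1 h2] := packet_Cc t0 h; split.
  by move=> n x; split; [exact: (Cc_smoothr h1) | exact: (Cc_smoothr h2)].
exists `[t0 - a, t0 + a]%classic; split => //; first exact: segment_compact.
move=> t nt; rewrite /packet; have -> : phi (t - t0) = 0; last by rewrite !mul0r.
case: hphi => _ -> //; rewrite ltNge; apply/negP => h'; apply: nt.
by move: h'; rewrite ler_norml /= in_itv /=; lra.
Qed.

Lemma packet_hat_schwartz t0 h : schwartz (packet_hat t0 h).
Proof.
have [h1 h2] := packet_Cc t0 h; pose c : R := (2 * pi)^-1.
have l1 := Cc_L1 h1; have l2 := Cc_L1 h2.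
have := cosTD_schwartz 0 (pi / 2) (pi / 2) 0 (CcZ c h1) (CcZ c h2) (CcZ (- c) h1) (CcZ c h2).
congr schwartz; apply/funext => x; rewrite /packet_hat /cosT.
have [<- <-] := shift_transform t0 (x + h).
have lz d e g : L1 g -> L1 (fun t => e * g t * cos (t * x + d)).
  by move=> lg; apply: L1_cosT; exact: L1Z.
have lc : L1 (fun t => phi (t - t0) * cos (t * (x + h))) by exact: cos_L1 (Cc_L1 (shift_Cc t0)).
have ls : L1 (fun t => phi (t - t0) * sin (t * (x + h))).
  have := L1_sin (x + h) (Cc_L1 (shift_Cc t0)).
  by apply: eq_L1 => t; rewrite [t * _]mulrC.
congr (_ +i* _).
- rewrite -intD; [|exact: lz|exact: lz]; rewrite -intZ //.
  apply: eq_int => t; rewrite addr0 -/c.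
  by rewrite cosDpihalf [t * (x + h)]mulrDr cosD [h * t]mulrC; ring.
- rewrite -intD; [|exact: lz|exact: lz]; rewrite -intZ //.
  apply: eq_int => t; rewrite addr0 -/c.
  by rewrite cosDpihalf [t * (x + h)]mulrDr sinD [h * t]mulrC; ring.
Qed.

Lemma fourier_packet_hat t0 h : fourier (packet_hat t0 h) = packet t0 h.
Proof.
apply/funext => t; rewrite /fourier /cint /packet.
have p0 : 2 * pi != 0 :> R by rewrite mulf_neq0 // ?pnatr_eq0 ?pi_neq0.
have lK : L1 K by exact: cosT_L1 hphi.
pose D := t0 - t.
have lKc : L1 (fun y => K y * cos (D * y)) by exact: L1_cos.
have lKs : L1 (fun y => K y * sin (D * y)) by exact: L1_sin.
have iKc : \int[mu]_y (K y * cos (D * y)) = 2 * pi * phi D by exact: cosT_inversion hphi ephi.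
have iKs : \int[mu]_y (K y * sin (D * y)) = 0.
  by apply: int_odd => // y; rewrite mulrN sinN /K cosT_even mulrN.
have phE : phi (t - t0) = phi D by rewrite -ephi; congr phi; rewrite /D; ring.
pose r y := (2 * pi)^-1 * (cos (h * t) * (K y * cos (D * y)) + - sin (h * t) * (K y * sin (D * y))).
pose s y := (2 * pi)^-1 * (sin (h * t) * (K y * cos (D * y)) + cos (h * t) * (K y * sin (D * y))).
have lr : L1 r by apply: L1Z; apply: L1D; exact: L1Z.
have ls : L1 s by apply: L1Z; apply: L1D; exact: L1Z.
have ir : \int[mu]_y r y = phi D * cos (h * t).
  rewrite intZ; last by apply: L1D; exact: L1Z.
  rewrite intD; [|exact: L1Z|exact: L1Z].
  by rewrite !intZ // iKc iKs mulr0 addr0 mulrCA mulKf // mulrC.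
have is_ : \int[mu]_y s y = phi D * sin (h * t).
  rewrite intZ; last by apply: L1D; exact: L1Z.
  rewrite intD; [|exact: L1Z|exact: L1Z].
  by rewrite !intZ // iKc iKs mulr0 addr0 mulrCA mulKf // mulrC.
have := int_affine h (oner_neq0 R) lr; have := int_affine h (oner_neq0 R) ls.
rewrite normr1 invr1 !mul1r ir is_ phE => <- <-.
congr (_ +i* _); apply: eq_int => x; rewrite ?ReM ?ImM /cexp /packet_hat /= expR0 !mul1r.
- transitivity ((2 * pi)^-1 * (K (x + h) * cos (t0 * (x + h) - t * x))).
    by rewrite cosB cosN sinN; ring.
  rewrite (_ : t0 * (x + h) - t * x = D * (x + h) + h * t); last by rewrite /D; ring.
  by rewrite cosD /r; ring.
- transitivity ((2 * pi)^-1 * (K (x + h) * sin (t0 * (x + h) - t * x))).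
    by rewrite sinB cosN sinN; ring.
  rewrite (_ : t0 * (x + h) - t * x = D * (x + h) + h * t); last by rewrite /D; ring.
  by rewrite sinD /s; ring.
Qed.

(** As [packet t0 h] is the Fourier transform of [packet_hat t0 h], the pairing equals the integral
    of the bounded function [k] against a translate by [h] of a fixed integrable function, and [k]
    vanishes at infinity. *)
Lemma pf_pairing (f : (R -> R[i]) -> R[i]) (t0 : R) (h : nat -> R) :
  global_pseudofunction f -> h n @[n --> \oo] --> +oo ->
  complex.Re (f (packet t0 (h n))) @[n --> \oo] --> (0 : R) /\
  complex.Im (f (packet t0 (h n))) @[n --> \oo] --> (0 : R).
Proof.
move=> [_ [k [[mkr mki [M bM]] kE kv]]] hh.
have fE n : f (packet t0 (h n)) = regular k (packet_hat t0 (h n)).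
  by rewrite -kE; [rewrite /fourier_dist fourier_packet_hat|exact: packet_hat_schwartz].
pose u y := (2 * pi)^-1 * (cos (t0 * y) * K y).
pose v y := (2 * pi)^-1 * (sin (t0 * y) * K y).
have lK : L1 K by exact: cosT_L1 hphi.
have lu : L1 u by apply: L1Z; apply: eq_L1 (L1_cos t0 lK) => y; rewrite mulrC.
have lv : L1 v by apply: L1Z; apply: eq_L1 (L1_sin t0 lK) => y; rewrite mulrC.
have aeF := ae_filter_ringOfSetsType mu.
have br : exists M : R, {ae mu, forall x, `|complex.Re (k x)| <= M}.
  by exists M; apply: (@filterS _ _ aeF _ _ _ bM) => x; exact: le_trans (norm_Re_le _).
have bi : exists M : R, {ae mu, forall x, `|complex.Im (k x)| <= M}.
  by exists M; apply: (@filterS _ _ aeF _ _ _ bM) => x; exact: le_trans (norm_Im_le _).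
have vr (e : R) : 0 < e -> exists A : R, {ae mu, forall x, A <= `|x| -> `|complex.Re (k x)| <= e}.
  move=> /kv[A hA]; exists A; apply: (@filterS _ _ aeF _ _ _ hA) => x hx /hx.
  exact: le_trans (norm_Re_le _).
have vi (e : R) : 0 < e -> exists A : R, {ae mu, forall x, A <= `|x| -> `|complex.Im (k x)| <= e}.
  move=> /kv[A hA]; exists A; apply: (@filterS _ _ aeF _ _ _ hA) => x hx /hx.
  exact: le_trans (norm_Im_le _).
have [lru cru] := shift_pairing_cvg0 lu mkr br vr hh.
have [lrv crv] := shift_pairing_cvg0 lv mkr br vr hh.
have [liu ciu] := shift_pairing_cvg0 lu mki bi vi hh.
have [liv civ] := shift_pairing_cvg0 lv mki bi vi hh.
split.
- have : \int[mu]_x (complex.Re (k x) * u (x + h n)) -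
    \int[mu]_x (complex.Im (k x) * v (x + h n)) @[n --> \oo] --> (0 - 0 : R) by exact: cvgB.
  rewrite subr0; apply: cvg_trans; apply: near_eq_cvg; apply: nearW => n.
  rewrite fE /regular /cint -(intB (lru n) (liv n)).
  by apply: eq_int => x; rewrite ReM.
- have : \int[mu]_x (complex.Re (k x) * v (x + h n)) +
    \int[mu]_x (complex.Im (k x) * u (x + h n)) @[n --> \oo] --> (0 + 0 : R) by exact: cvgD.
  rewrite addr0; apply: cvg_trans; apply: near_eq_cvg; apply: nearW => n.
  rewrite fE /regular /cint -(intD (lrv n) (liu n)).
  by apply: eq_int => x; rewrite ImM.
Qed.

End wave_packets.

End pseudofunction_pairing.

(** * The primitive of rho and its Laplace transform *)

Section primitive.
Context {R : realType}.
Notation mu := (@lebesgue_measure R).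
Implicit Types (rho w : R -> R).

Definition prim rho (x : R) : R := \int[mu]_(u in `[0, x]) rho u.

Lemma L1loc_itv rho A : L1loc_nneg rho -> L1 (fun x => rho x * \1_`[0, A] x).
Proof. by move=> /(_ A) h; apply/(@L1_on R `[0, A]%classic). Qed.

Lemma prim_lt0 rho x : x < 0 -> prim rho x = 0.
Proof. by move=> x0; rewrite /prim set_itv_ge ?Rintegral_set0 // bnd_simp -ltNge. Qed.

(** The variable endpoint becomes a bounded kernel over a fixed interval, the form that Fubini and
    pointwise comparison require. *)
Lemma primE rho x A : x <= A ->
  prim rho x = \int[mu]_t (rho t * \1_`[0, A] t * \1_`[0, +oo[ (x - t)).
Proof.
move=> xA; rewrite /prim intE; apply: eq_int => t.
rewrite !indicE !mem_setE !in_itv /= andbT subr_ge0 -mulrA; congr (_ * _).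
case: (leP t x) => tx; last by rewrite andbF mulr0.
by rewrite (le_trans tx xA) !andbT mulr1.
Qed.

Lemma L1loc_indic_ge rho A x : L1loc_nneg rho ->
  L1 (fun t => rho t * \1_`[0, A] t * \1_`[0, +oo[ (x - t)).
Proof.
move=> hr; apply: (L1_bdd (L1loc_itv A hr) (C := 1)).
  apply: measurableT_comp; first exact: measurable_indic.
  by apply: measurable_funB.
by move=> t; rewrite indicE; case: (_ \in _); rewrite ?normr1 ?normr0.
Qed.

Lemma prim_bound rho x A : L1loc_nneg rho -> x <= A ->
  `|prim rho x| <= \int[mu]_t `|rho t * \1_`[0, A] t|.
Proof.
move=> hr xA; rewrite (primE _ xA); apply: int_norm_le.
- exact: L1loc_indic_ge.
- exact: L1_norm (L1loc_itv A hr).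
- move=> t; rewrite normrM ler_piMr // indicE.
  by case: (_ \in _); rewrite ?normr1 ?normr0.
Qed.

Lemma prim_sub rho x y : L1loc_nneg rho -> 0 <= x -> x <= y ->
  prim rho y - prim rho x = \int[mu]_(t in `]x, y]) rho t.
Proof.
move=> hr x0 xy; rewrite (primE rho xy) (primE rho (lexx y)).
rewrite -(intB (L1loc_indic_ge y y hr) (L1loc_indic_ge y x hr)) [RHS]intE.
apply: eq_int => t; rewrite !indicE !mem_setE !in_itv /= !andbT !subr_ge0 -mulrBr -mulrA.
congr (_ * _); case: (leP t y) => ty; case: (leP t x) => tx /=.
- by rewrite subrr mulr0 // ltNge tx.
- by rewrite (ltW (le_lt_trans x0 tx)) subr0 mulr1.
- by move: (lt_le_trans ty tx); rewrite ltNge xy.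
- by rewrite !andbF mul0r.
Qed.

Lemma prim_measurable rho : L1loc_nneg rho -> measurable_fun setT (prim rho).
Proof.
move=> hr.
(* Splitting [rho] into positive and negative parts exhibits the primitive as a difference of
   nondecreasing functions. *)
pose p x := Num.max (rho x) 0; pose m x := Num.max (- rho x) 0.
have mono q : (forall x, 0 <= q x) -> L1loc_nneg q ->
    nondecreasing_fun (prim q).
  move=> q0 hq x y xy.
  rewrite (primE q xy) (primE q (lexx y)); apply: int_le.
  - exact: L1loc_indic_ge.
  - exact: L1loc_indic_ge.
  - move=> t; rewrite ler_wpM2l //.
      by rewrite mulr_ge0 // indicE; case: (_ \in _).
    rewrite !indicE !mem_setE !in_itv /= !andbT !subr_ge0.
    by case: (leP t x) => // tx; rewrite (le_trans tx xy).
have hp : L1loc_nneg p.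
  move=> A; apply/(@L1_on R `[0, A]%classic) => //.
  have l := L1loc_itv A hr; have ml := L1_measurable l.
  have -> : (fun x => p x * \1_`[0, A] x) = (fun x => Num.max (rho x * \1_`[0, A] x) 0).
    apply/funext => x; rewrite /p indicE.
    by case: (_ \in _); rewrite ?mulr1 ?mulr0 ?maxxx.
  apply: L1_le (L1_norm l) _; first by apply: measurable_maxr.
  by move=> x; case: (leP _ 0); rewrite ?normr0 ?normr_ge0.
have hm : L1loc_nneg m.
  move=> A; apply/(@L1_on R `[0, A]%classic) => //.
  have l := L1loc_itv A hr; have ml := L1_measurable l.
  have -> : (fun x => m x * \1_`[0, A] x) = (fun x => Num.max (- (rho x * \1_`[0, A] x)) 0).
    apply/funext => x; rewrite /m indicE.
    by case: (_ \in _); rewrite ?mulr1 ?mulr0 ?oppr0 ?maxxx.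
  apply: L1_le (L1_norm l) _; first by apply: measurable_maxr => //; exact: measurableT_comp.
  by move=> x; case: (leP _ 0); rewrite ?normr0 ?normr_ge0 ?normrN.
have -> : prim rho = (fun x => prim p x - prim m x).
  apply/funext => x; rewrite (primE rho (lexx x)) (primE p (lexx x)) (primE m (lexx x)).
  rewrite -(intB (L1loc_indic_ge x x hp) (L1loc_indic_ge x x hm)); apply: eq_int => t.
  rewrite -!mulrBl /p /m; congr (_ * _ * _).
  by case: (leP (rho t) 0); case: (leP (- rho t) 0); lra.
apply: measurable_funB; apply: nondecreasing_measurable => //; apply: mono => //.
- by move=> x; rewrite /p le_max lexx orbT.
- by move=> x; rewrite /m le_max lexx orbT.
Qed.

(** Fubini on the triangle [x <= t], with [w A - w x] written as the integral of [w'], gives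
    integration by parts for merely integrable [rho]. *)
Lemma int_parts rho w (w' : R -> R) (A : R) : L1loc_nneg rho -> 0 <= A ->
  (forall x : R, is_derive x 1 w (w' x)) -> continuous w' ->
  L1 (fun x => rho x * w x * \1_`[0, A] x) /\
  \int[mu]_x (rho x * w x * \1_`[0, A] x) =
    prim rho A * w A - \int[mu]_x (prim rho x * w' x * \1_`[0, A] x).
Proof.
move=> hr A0 dw cw'.
have lr := L1loc_itv A hr; have lw := @L1_cts_itv R w' 0 A cw'.
have cw := is_derive_continuous dw.
have wE x : 0 <= x <= A ->
    w A - w x = \int[mu]_t (w' t * \1_`[0, A] t * \1_`[0, +oo[ (t - x)).
  move=> /andP[x0 xA]; rewrite -(ftc_itv xA dw cw') intE; apply: eq_int => t.
  rewrite !indicE !mem_setE !in_itv /= andbT subr_ge0 -mulrA; congr (_ * _).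
  case: (leP x t) => tx; last by rewrite mulr0.
  by rewrite (le_trans x0 tx) mulr1.
have mu_ : measurable_fun setT (fun z : R * R => \1_(`[0, +oo[%classic : set R) (z.2 - z.1) : R).
  apply: measurableT_comp; first exact: measurable_indic.
  by apply: measurable_funB.
have u1 (x t : R) : `|\1_(`[0, +oo[%classic : set R) (t - x) : R| <= 1.
  by rewrite indicE; case: (_ \in _); rewrite ?normr1 ?normr0.
have lwu x : L1 (fun t => w' t * \1_`[0, A] t * \1_`[0, +oo[ (t - x)).
  apply: (L1_bdd lw (C := 1)) => //.
  by apply: measurableT_comp; [exact: measurable_indic | apply: measurable_funB].
have mrw : measurable_fun setT (fun x => rho x * \1_`[0, A] x * w x).
  by apply: measurable_funM; [exact: L1_measurable | exact: cts_measurable].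
pose B := `|w A| + \int[mu]_t `|w' t * \1_`[0, A] t|.
have lrw : L1 (fun x => rho x * \1_`[0, A] x * w x).
  apply: (L1_le mrw (L1Z B (L1_norm lr))) => x.
  rewrite indicE mem_setE in_itv /=; case: (boolP (0 <= x <= A)) => hx /=; last first.
    by rewrite !(mulr0, mul0r) normr0 mulr0.
  rewrite mulr1 normrM mulrC; apply: ler_wpM2r => //.
  have -> : w x = w A - (w A - w x) by ring.
  apply: (le_trans (ler_normB _ _)); rewrite lerD2l (wE _ hx).
  apply: int_norm_le => //; first exact: L1_norm.
  by move=> t; rewrite normrM ler_piMr.
have lrw' : L1 (fun x => rho x * w x * \1_`[0, A] x).
  by apply: eq_L1 lrw => x; rewrite mulrAC.
split=> //.
have := fubini_mul lr lw mu_ u1.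
have -> : \int[mu]_x (rho x * \1_`[0, A] x * \int[mu]_t (w' t * \1_`[0, A] t * \1_`[0, +oo[ (t - x))) =
    w A * prim rho A - \int[mu]_x (rho x * w x * \1_`[0, A] x).
  rewrite (_ : prim rho A = \int[mu]_x (rho x * \1_`[0, A] x)); last exact: intE.
  rewrite -(intZ _ lr) -(intB (L1Z _ lr) lrw'); apply: eq_int => x.
  rewrite [in LHS]indicE [X in _ = _ * (_ * X) - _ * X]indicE !mem_setE in_itv /=.
  case: (boolP (0 <= x <= A)) => hx /=; last by rewrite !(mulr0, mul0r) subr0.
  by rewrite -(wE _ hx); ring.
have -> : \int[mu]_t (w' t * \1_`[0, A] t * \int[mu]_x (rho x * \1_`[0, A] x * \1_`[0, +oo[ (t - x))) =
    \int[mu]_x (prim rho x * w' x * \1_`[0, A] x).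
  apply: eq_int => t; rewrite [\1_`[0, A] t]indicE mem_setE in_itv /=.
  case: (boolP (0 <= t <= A)) => /= [/andP[t0 tA]|_]; last by rewrite !(mulr0, mul0r).
  by rewrite -(primE rho tA) !mulr1 mulrC.
by move: (\int[mu]_x _) (\int[mu]_x _) => I J; lra.
Qed.

Lemma L1_mul_cts_itv (f w : R -> R) (A C : R) : measurable_fun setT f -> (forall x, `|f x| <= C) ->
  continuous w -> L1 (fun x => f x * w x * \1_`[0, A] x).
Proof.
move=> mf fC cw; apply: eq_L1 (L1_bdd (@L1_cts_itv R w 0 A cw) mf fC) => x.
by rewrite mulrC mulrA.
Qed.

Lemma laplace_partialE rho (s t A : R) :
  laplace_partial rho (s +i* t) A =
  (\int[mu]_x (rho x * (expR (- s * x) * cos (t * x)) * \1_`[0, A] x)) +i*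
  (\int[mu]_x (rho x * (expR (- s * x) * - sin (t * x)) * \1_`[0, A] x)).
Proof.
have E (x : R) : - (s +i* t) * x%:C = (- s * x) +i* (- (t * x)).
  by apply: complexP => /=; ring.
rewrite /laplace_partial /cint; congr (_ +i* _); rewrite intE; apply: eq_int => x.
- rewrite E ReM /cexp; congr (_ * _).
  by rewrite [complex.Re (_ +i* _)]/= [complex.Im (_%:C)]/= mul0r subr0 /= cosN.
- rewrite E ImM /cexp; congr (_ * _).
  by rewrite [complex.Im (_%:C)]/= mul0r addr0 /= sinN.
Qed.

(** Convergence at [s], possibly conditional, bounds the primitive of [r x = rho x * expR (- s x)];
    integrating [rho x = r x * expR (s x)] by parts transfers the bound with the factor
    [expR (s x)]. *)
Lemma prim_growth rho (s : R) : L1loc_nneg rho -> 0 < s ->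
  laplace_converges rho (s +i* 0) ->
  exists2 C : R, 0 <= C & forall x, `|prim rho x| <= C * expR (s * x).
Proof.
move=> hr s0 [l [hl _]].
pose r x := rho x * expR (- s * x).
have c1 : continuous (fun x => expR (- s * x)).
  exact: is_derive_continuous (is_derive_expR_lin (- s)).
have c2 : continuous (fun x => s * expR (s * x)).
  move=> x; apply: cvgMl_tmp; exact: is_derive_continuous (is_derive_expR_lin s) x.
have c1' : continuous (fun x => - s * expR (- s * x)).
  by move=> x; apply: cvgMl_tmp; exact: c1.
have hr' : L1loc_nneg r.
  move=> A; case: (leP 0 A) => A0; last first.
    by rewrite set_itv_ge ?bnd_simp -?ltNge //; exact: integrable_set0.
  apply/(@L1_on R `[0, A]%classic); first exact: measurable_itv.
  by have [] := int_parts hr A0 (is_derive_expR_lin (- s)) c1'.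
have [A [_ hA]] : \forall x \near +oo, `|prim r x| <= `|complex.Re l| + 1.
  have /cvgrPdist_le/(_ _ ltr01) := hl; apply: filterS => x.
  rewrite laplace_partialE /= (_ : \int[mu]_x0 _ = prim r x).
    move=> h; rewrite (_ : prim r x = complex.Re l - (complex.Re l - prim r x)); last by ring.
    by apply: (le_trans (ler_normB _ _)); rewrite lerD2l.
  rewrite [RHS]/prim [RHS]intE; apply: eq_int => y.
  by rewrite /r mul0r cos0 mulr1.
pose B := `|complex.Re l| + 1 + \int[mu]_t `|r t * \1_`[0, A + 1] t|.
have B0 : 0 <= B by rewrite !addr_ge0 // Rintegral_ge0.
have hB x : `|prim r x| <= B.
  case: (leP x (A + 1)) => xA.
    by apply: (le_trans (prim_bound hr' xA)); rewrite /B lerDr addr_ge0.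
  apply: (le_trans (hA x _)); first by rewrite (lt_trans _ xA) // ltrDl.
  by rewrite /B lerDl Rintegral_ge0.
clearbody B; exists (B + B); first exact: (addr_ge0 B0 B0).
move=> x; case: (ltP x 0) => x0.
  by rewrite prim_lt0 // normr0; exact: (mulr_ge0 (addr_ge0 B0 B0) (expR_ge0 _)).
have [_ e] := int_parts hr' x0 (is_derive_expR_lin s) c2.
have -> : prim rho x = \int[mu]_y (r y * expR (s * y) * \1_`[0, x] y).
  rewrite /prim intE; apply: eq_int => y.
  by rewrite /r -(mulrA (rho y)) -expRD mulNr addNr expR0 mulr1.
rewrite e (le_trans (ler_normB _ _)) // mulrDl lerD //.
  by rewrite normrM (ger0_norm (expR_ge0 _)) ler_wpM2r ?expR_ge0.
have lc : L1 (fun y => s * expR (s * y) * \1_`[0, x] y) by exact: L1_cts_itv.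
have h1 := @L1_mul_cts_itv (prim r) _ x B (prim_measurable hr') hB c2.
apply: (le_trans (int_norm_le h1 (L1Z B lc) _)).
  move=> y; rewrite -mulrA normrM; apply: ler_pM => //.
  rewrite ger0_norm // mulr_ge0 ?(mulr_ge0 (ltW s0)) ?expR_ge0 //.
rewrite (intZ _ lc) -intE (ftc_itv x0 (is_derive_expR_lin s) c2).
by rewrite ler_wpM2l // gerBl expR_ge0.
Qed.

Section laplace_formula.
Variable rho : R -> R.
Hypotheses (hr : L1loc_nneg rho)
  (hL : forall s : R[i], 0 < complex.Re s -> laplace_converges rho s).

Definition expi (s x : R) : R := expR (- s * x) * \1_`[0, +oo[ x.

Lemma expR_halve (s x : R) : expR (s / 2 * x) * expR (- s * x) = expR (- (s / 2) * x).
Proof. by rewrite -expRD; congr expR; field. Qed.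

Lemma expi_ge0 s x : 0 <= expi s x.
Proof. by rewrite /expi mulr_ge0 ?expR_ge0 // indicE; case: (_ \in _). Qed.

Lemma L1_prim_expi s : 0 < s -> L1 (fun x => prim rho x * expi s x).
Proof.
(* The growth bound at abscissa [s / 2] leaves the integrable factor [expR (- (s / 2) x)]. *)
move=> s0; have s20 : 0 < s / 2 by rewrite divr_gt0.
have [C C0 hC] := prim_growth hr s20 (hL (s20 : 0 < complex.Re (s / 2 +i* 0))).
apply: (L1_le _ (L1Z C (L1_exp s20))).
  apply: measurable_funM; first exact: prim_measurable.
  exact: L1_measurable (L1_exp s0).
move=> x; rewrite normrM (ger0_norm (expi_ge0 _ _)).
apply: (le_trans (ler_wpM2r (expi_ge0 _ _) (hC x))).
by rewrite -(expR_halve s x) /expi !mulrA.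
Qed.

(** The boundary term is at most [C expR (- (s / 2) n)] in absolute value and disappears in the
    limit. *)
Lemma int_parts_lim (s : R) w (w' : R -> R) (K : R) : 0 < s ->
  (forall x : R, is_derive x 1 w (w' x)) -> continuous w' ->
  (forall x, 0 <= x -> `|w x| <= expR (- s * x)) ->
  (forall x, 0 <= x -> `|w' x| <= K * expR (- s * x)) ->
  \int[mu]_x (rho x * w x * \1_`[0, n%:R] x) @[n --> \oo] -->
    - \int[mu]_x (prim rho x * w' x * \1_`[0, +oo[ x).
Proof.
move=> s0 dw cw' hw hw'.
have mw' := cts_measurable cw'; have mS := prim_measurable hr.
have [_ c] : L1 (fun x => prim rho x * w' x * \1_`[0, +oo[ x) /\
   \int[mu]_x (prim rho x * w' x * \1_`[0, n%:R] x) @[n --> \oo] -->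
    \int[mu]_x (prim rho x * w' x * \1_`[0, +oo[ x).
  apply: (@dct R _ _ (fun x => K * `|prim rho x * expi s x|)).
  - move=> n; apply: measurable_funM; first exact: measurable_funM.
    exact: measurable_indic.
  - apply: measurable_funM; first exact: measurable_funM.
    exact: measurable_indic.
  - move=> x; apply: cvg_near_cst; near=> n.
    rewrite !indicE !mem_setE !in_itv /= andbT (_ : x <= n%:R) ?andbT //.
    by near: n; exact: nbhs_infty_ger.
  - exact: L1Z (L1_norm (L1_prim_expi s0)).
  - move=> n x; rewrite indicE mem_setE in_itv /=.
    case: (boolP (0 <= x <= n%:R)) => [/andP[x0 xn]|_] /=; last first.
      rewrite mulr0 normr0 mulr_ge0 // -(pmulr_lge0 _ (expR_gt0 (- s * 0))).
      exact: le_trans (hw' 0 (lexx 0)).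
    rewrite mulr1 /expi indicE mem_setE in_itv /= x0 mulr1 !normrM mulrCA.
    by rewrite ler_wpM2l // (ger0_norm (expR_ge0 _)) hw'.
have s20 : 0 < s / 2 by rewrite divr_gt0.
have [C C0 hC] := prim_growth hr s20 (hL (s20 : 0 < complex.Re (s / 2 +i* 0))).
have b0 : prim rho n%:R * w n%:R @[n --> \oo] --> 0.
  have e0 : C * expR (- (s / 2) * n%:R) @[n --> \oo] --> C * 0.
    apply: cvgM; first exact: cvg_cst.
    by have := cvg_comp _ _ (@cvgr_idn R) (expR_lin_cvg0 s20).
  rewrite mulr0 in e0; apply/norm_cvg0P.
  apply: (squeeze_cvgr _ (cvg_cst 0) e0); apply: nearW => n; rewrite normr_ge0 /=.
  rewrite normrM (le_trans (ler_pM _ _ (hC _) (hw _ (ler0n _ n)))) //.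
  by rewrite -[leLHS]mulrA expR_halve.
rewrite -[X in _ --> X]add0r.
have h : prim rho n%:R * w n%:R - \int[mu]_x (prim rho x * w' x * \1_`[0, n%:R] x)
    @[n --> \oo] --> 0 - \int[mu]_x (prim rho x * w' x * \1_`[0, +oo[ x) by exact: cvgB.
apply: cvg_trans h; apply: near_eq_cvg; apply: nearW => n.
by have [_ ->] := int_parts hr (ler0n _ n) dw cw'.
Unshelve. all: by end_near.
Qed.

(** By parts, the possibly conditionally convergent integral becomes an absolutely convergent one
    for the primitive; the limit along integers suffices since the full limit is known to exist. *)
Lemma laplace_prim (s t : R) : 0 < s ->
  laplace rho (s +i* t) = (s +i* t) *
    ((\int[mu]_x (prim rho x * expi s x * cos (t * x))) +i*
     (- (\int[mu]_x (prim rho x * expi s x * sin (t * x))))).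
Proof.
move=> s0; have [l [hl1 hl2]] := hL (s0 : 0 < complex.Re (s +i* t)).
have -> : laplace rho (s +i* t) = l.
  rewrite /laplace /clim (cvg_lim (@Rhausdorff R) hl1) (cvg_lim (@Rhausdorff R) hl2).
  by case: (l).
have := cvg_comp _ _ (@cvgr_idn R) hl1; have := cvg_comp _ _ (@cvgr_idn R) hl2.
rewrite /comp => c2 c1.
have e1 : (fun n : nat => complex.Re (laplace_partial rho (s +i* t) n%:R)) =
    (fun n => \int[mu]_x (rho x * (expR (- s * x) * cos (t * x)) * \1_`[0, n%:R] x)).
  by apply/funext => n; rewrite laplace_partialE.
have e2 : (fun n : nat => complex.Im (laplace_partial rho (s +i* t) n%:R)) =
    (fun n => \int[mu]_x (rho x * (expR (- s * x) * - sin (t * x)) * \1_`[0, n%:R] x)).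
  by apply/funext => n; rewrite laplace_partialE.
rewrite e1 in c1; rewrite e2 in c2.
have ce : continuous (fun x => expR (- s * x)).
  exact: is_derive_continuous (is_derive_expR_lin (- s)).
have cc := @continuous_cos_lin R t; have cs := @continuous_sin_lin R t.
pose w1' x := expR (- s * x) * (- s * cos (t * x) + - t * sin (t * x)).
pose w2' x := expR (- s * x) * (s * sin (t * x) + - t * cos (t * x)).
have d1 (x : R) : is_derive x 1 (fun x => expR (- s * x) * cos (t * x)) (w1' x).
  have h1 := is_derive_expR_lin (- s) x; have h2 := is_derive_cos_lin t x.
  by apply: is_derive_eq; rewrite /GRing.scale /= /w1'; ring.
have d2 (x : R) : is_derive x 1 (fun x => expR (- s * x) * - sin (t * x)) (w2' x).
  have h1 := is_derive_expR_lin (- s) x; have h2 := is_derive_sin_lin t x.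
  by apply: is_derive_eq; rewrite /GRing.scale /= /w2'; ring.
have cw1 : continuous w1'.
  move=> x; apply: cvgM; first exact: ce.
  by apply: cvgD; apply: cvgM; [exact: cvg_cst|exact: cc|exact: cvg_cst|exact: cs].
have cw2 : continuous w2'.
  move=> x; apply: cvgM; first exact: ce.
  by apply: cvgD; apply: cvgM; [exact: cvg_cst|exact: cs|exact: cvg_cst|exact: cc].
have tr (a b u v x : R) : `|u| <= 1 -> `|v| <= 1 ->
    `|expR (- s * x) * (a * u + b * v)| <= (`|a| + `|b|) * expR (- s * x).
  move=> hu hv; rewrite normrM (ger0_norm (expR_ge0 _)) mulrC ler_wpM2r ?expR_ge0 //.
  apply: (le_trans (ler_normD _ _)); rewrite !normrM.
  by apply: lerD; rewrite ler_piMr.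
have k1 := int_parts_lim (K := `|- s| + `|- t|) s0 d1 cw1.
have k2 := int_parts_lim (K := `|s| + `|- t|) s0 d2 cw2.
have lS := L1_prim_expi s0.
have lc := L1_cos t lS; have ls := L1_sin t lS.
apply: complexP; rewrite ?ReM ?ImM /=.
- have u : - (\int[mu]_x (prim rho x * w1' x * \1_`[0, +oo[ x)) =
     s * \int[mu]_x (prim rho x * expi s x * cos (t * x)) -
     t * (- (\int[mu]_x (prim rho x * expi s x * sin (t * x)))).
    rewrite mulrN opprK -(intZ _ lc) -(intZ _ ls) -(intD (L1Z _ lc) (L1Z _ ls)).
    rewrite -[LHS]mulN1r -intZ; last first.
      apply: eq_L1 (L1D (L1Z (- s) lc) (L1Z (- t) ls)) => x.
      by rewrite /w1' /expi; ring.
    by apply: eq_int => x; rewrite /w1' /expi; ring.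
  rewrite -u; apply: cvg_unique c1 _ => //.
  apply: k1 => x _; last by apply: tr; [exact: norm_cos_le1|exact: norm_sin_le1].
  by rewrite normrM (ger0_norm (expR_ge0 _)) ler_piMr ?expR_ge0 // norm_cos_le1.
- have u : - (\int[mu]_x (prim rho x * w2' x * \1_`[0, +oo[ x)) =
     s * - (\int[mu]_x (prim rho x * expi s x * sin (t * x))) +
     t * (\int[mu]_x (prim rho x * expi s x * cos (t * x))).
    rewrite mulrN -mulNr -(intZ _ lc) -(intZ _ ls) -(intD (L1Z _ ls) (L1Z _ lc)).
    rewrite -[LHS]mulN1r -intZ; last first.
      apply: eq_L1 (L1D (L1Z s ls) (L1Z (- t) lc)) => x.
      by rewrite /w2' /expi; ring.
    by apply: eq_int => x; rewrite /w2' /expi; ring.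
  rewrite -u; apply: cvg_unique c2 _ => //.
  apply: k2 => x _; last by apply: tr; [exact: norm_sin_le1|exact: norm_cos_le1].
  by rewrite normrM normrN (ger0_norm (expR_ge0 _)) ler_piMr ?expR_ge0 // norm_sin_le1.
Qed.

(** With [z = s + i t], a constant [b] is [z] times the transform of [b]; subtracting it and
    dividing gives the transform of [prim rho - b], separated here into real and imaginary parts. *)
Lemma laplace_quotient (beta gamma s t : R) : 0 < s ->
  (laplace rho (s +i* t) - (beta +i* gamma)) / (s +i* t) =
    (\int[mu]_x ((prim rho x - beta) * expi s x * cos (t * x)) -
     gamma * \int[mu]_x (expi s x * sin (t * x))) +i*
    (- (\int[mu]_x ((prim rho x - beta) * expi s x * sin (t * x))) -
     gamma * \int[mu]_x (expi s x * cos (t * x))).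
Proof.
move=> s0; rewrite laplace_prim //.
have d0 : s ^+ 2 + t ^+ 2 != 0 by rewrite gt_eqF // ltr_pwDl ?sqr_ge0 ?exprn_gt0.
have [ec es] := laplace_cos_sin t s0.
have lE := L1_exp s0; have lS := L1_prim_expi s0.
have lEc := L1_cos t lE; have lEs := L1_sin t lE.
have lSc := L1_cos t lS; have lSs := L1_sin t lS.
have split_int (w : R -> R) : L1 (fun x => prim rho x * expi s x * w x) ->
    L1 (fun x => expi s x * w x) ->
    \int[mu]_x ((prim rho x - beta) * expi s x * w x) =
    \int[mu]_x (prim rho x * expi s x * w x) - beta * \int[mu]_x (expi s x * w x).
  move=> l1 l2; rewrite -(intZ _ l2) -(intB l1 (L1Z _ l2)).
  by apply: eq_int => x; ring.
rewrite (split_int _ lSc lEc) (split_int _ lSs lEs) {lS lSc lSs lEc lEs split_int}.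
rewrite /expi ec es.
move: (\int[mu]_x _) (\int[mu]_x _) => C1 S1 {ec es lE}.
have z0 : (s +i* t) != 0 by rewrite eq_complex /= (gt_eqF s0).
apply: (mulIf z0); rewrite divfK //.
by apply: complexP; rewrite ?ReM ?ImM /=; field.
Qed.

End laplace_formula.

End primitive.

(** * Pairing the Laplace transform with a packet *)

Section laplace_pairing.
Context {R : realType}.
Notation mu := (@lebesgue_measure R).
Variables (a : R) (phi : R -> R).
Hypotheses (hphi : Cc a phi) (ephi : forall t, phi (- t) = phi t).
Notation K := (cosT phi 0).

Lemma packet_fubini (f : R -> R) (t0 h : R) : L1 f ->
  \int[mu]_t (phi (t - t0) * \int[mu]_x (f x * cos (t * (x - h)))) =
    \int[mu]_x (f x * (cos (t0 * (x - h)) * K (x - h))) /\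
  \int[mu]_t (phi (t - t0) * \int[mu]_x (f x * sin (t * (x - h)))) =
    \int[mu]_x (f x * (sin (t0 * (x - h)) * K (x - h))).
Proof.
move=> lf; have lp := Cc_L1 (shift_Cc hphi t0).
have m : measurable_fun setT (fun z : R * R => z.1 * (z.2 - h)).
  by apply: measurable_funM => //; exact: measurable_funB.
have mc : measurable_fun setT (fun z : R * R => cos (z.1 * (z.2 - h))).
  by apply: measurableT_comp m; exact: cts_measurable (@continuous_cos R).
have ms : measurable_fun setT (fun z : R * R => sin (z.1 * (z.2 - h))).
  by apply: measurableT_comp m; exact: cts_measurable (@continuous_sin R).
split.
- rewrite (fubini_mul lp lf mc (fun x t => norm_cos_le1 (x * (t - h)))).
  by apply: eq_int => x; have [-> _] := shift_transform hphi ephi t0 (x - h).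
- rewrite (fubini_mul lp lf ms (fun x t => norm_sin_le1 (x * (t - h)))).
  by apply: eq_int => x; have [_ ->] := shift_transform hphi ephi t0 (x - h).
Qed.

Lemma shift_trig_int (f : R -> R) (t h : R) : L1 f ->
  \int[mu]_x (f x * cos (t * (x - h))) =
    \int[mu]_x (f x * cos (t * x)) * cos (h * t) + \int[mu]_x (f x * sin (t * x)) * sin (h * t) /\
  \int[mu]_x (f x * sin (t * (x - h))) =
    \int[mu]_x (f x * sin (t * x)) * cos (h * t) - \int[mu]_x (f x * cos (t * x)) * sin (h * t).
Proof.
move=> lf; have lc := L1_cos t lf; have ls := L1_sin t lf.
split.
- rewrite mulrC [X in _ + X]mulrC -(intZ _ lc) -(intZ _ ls) -(intD (L1Z _ lc) (L1Z _ ls)).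
  apply: eq_int => x; rewrite mulrBr [h * t]mulrC cosB; ring.
- rewrite mulrC [X in _ - X]mulrC -(intZ _ lc) -(intZ _ ls) -(intB (L1Z _ ls) (L1Z _ lc)).
  apply: eq_int => x; rewrite mulrBr [h * t]mulrC sinB; ring.
Qed.

Lemma L1_packet_int (f : R -> R) (t0 h : R) : L1 f ->
  L1 (fun t => phi (t - t0) * \int[mu]_x (f x * cos (t * (x - h)))) /\
  L1 (fun t => phi (t - t0) * \int[mu]_x (f x * sin (t * (x - h)))).
Proof.
move=> lf; have lp := Cc_L1 (shift_Cc hphi t0).
have sh (g : R -> R) t : measurable_fun setT g ->
   (forall x, `|g x| <= 1) -> `|\int[mu]_x (f x * g (t * (x - h)))| <= \int[mu]_x `|f x|.
  move=> mg g1; apply: int_norm_le.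
  - apply: (L1_bdd lf (C := 1)) => //; apply: measurableT_comp => //.
    by apply: measurable_funM => //; exact: measurable_funB.
  - exact: L1_norm.
  - by move=> x; rewrite normrM ler_piMr.
have mC : measurable_fun setT (fun t : R => \int[mu]_x (f x * cos (t * x))).
  have := cts_measurable (@continuous_cos_int R f 0 lf).
  by congr measurable_fun; apply/funext => t; apply: eq_int => x; rewrite addr0.
have mS : measurable_fun setT (fun t : R => \int[mu]_x (f x * sin (t * x))).
  have := cts_measurable (@continuous_cos_int R f (- (pi / 2)) lf).
  congr measurable_fun; apply/funext => t; apply: eq_int => x.
  by rewrite cosB cos_pihalf sin_pihalf mulr0 add0r mulr1.
have m1 : measurable_fun setT (fun t : R => cos (h * t)).
  exact: cts_measurable (@continuous_cos_lin R h).
have m2 : measurable_fun setT (fun t : R => sin (h * t)).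
  exact: cts_measurable (@continuous_sin_lin R h).
split.
- apply: (L1_bdd lp (C := \int[mu]_x `|f x|)).
    have -> : (fun t => \int[mu]_x (f x * cos (t * (x - h)))) =
      (fun t => \int[mu]_x (f x * cos (t * x)) * cos (h * t) + \int[mu]_x (f x * sin (t * x)) * sin (h * t)).
      by apply/funext => t; have [] := shift_trig_int t h lf.
    by apply: measurable_funD; exact: measurable_funM.
  move=> t; apply: (sh cos); [exact: cts_measurable (@continuous_cos R) | exact: norm_cos_le1].
- apply: (L1_bdd lp (C := \int[mu]_x `|f x|)).
    have -> : (fun t => \int[mu]_x (f x * sin (t * (x - h)))) =
      (fun t => \int[mu]_x (f x * sin (t * x)) * cos (h * t) - \int[mu]_x (f x * cos (t * x)) * sin (h * t)).
      by apply/funext => t; have [] := shift_trig_int t h lf.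
    by apply: measurable_funB; exact: measurable_funM.
  move=> t; apply: (sh sin); [exact: cts_measurable (@continuous_sin R) | exact: norm_sin_le1].
Qed.

Variable rho : R -> R.
Hypotheses (hr : L1loc_nneg rho)
  (hL : forall s : R[i], 0 < complex.Re s -> laplace_converges rho s).

(** At fixed [s > 0] everything is absolutely integrable. The modulation [e^{i h t}] combines with
    [e^{- i t x}] into a function of [x - h], and Fubini performs the [t]-integral first, leaving
    the transform of the shifted bump. *)
Lemma laplace_packet (beta gamma s t0 h : R) : 0 < s ->
  let F x := (prim rho x - beta) * expi s x in
  cint setT (fun t => (laplace rho (s +i* t) - (beta +i* gamma)) / (s +i* t) *
    packet phi t0 h t) =
  (\int[mu]_x (F x * (cos (t0 * (x - h)) * K (x - h))) -
   gamma * \int[mu]_x (expi s x * (sin (t0 * (x - h)) * K (x - h)))) +i*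
  (- (\int[mu]_x (F x * (sin (t0 * (x - h)) * K (x - h)))) -
   gamma * \int[mu]_x (expi s x * (cos (t0 * (x - h)) * K (x - h)))).
Proof.
move=> s0 F; have lE : L1 (expi s) := L1_exp s0.
have lF : L1 F.
  apply: eq_L1 (L1B (L1_prim_expi hr hL s0) (L1Z beta lE)) => x.
  by rewrite /F; ring.
have [Fc Fs] := packet_fubini t0 h lF; have [Ec Es] := packet_fubini t0 h lE.
have [lFc lFs] := L1_packet_int t0 h lF; have [lEc lEs] := L1_packet_int t0 h lE.
rewrite -Fc -Fs -Ec -Es {Fc Fs Ec Es} /cint; congr (_ +i* _).
- rewrite -(intZ _ lEs) -(intB lFc (L1Z _ lEs)); apply: eq_int => t.
  rewrite laplace_quotient // ReM /packet.
  have [-> _] := shift_trig_int t h lF; have [_ ->] := shift_trig_int t h lE.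
  rewrite /F; move: (\int[mu]_x _) (\int[mu]_x _) (\int[mu]_x _) (\int[mu]_x _) => x1 x2 x3 x4 /=.
  by ring.
- rewrite -(intZ _ lEc) -[X in X - _]mulN1r -(intZ _ lFs) -(intB (L1Z _ lFs) (L1Z _ lEc)); apply: eq_int => t.
  rewrite laplace_quotient // ImM /packet.
  have [_ ->] := shift_trig_int t h lF; have [-> _] := shift_trig_int t h lE.
  rewrite /F; move: (\int[mu]_x _) (\int[mu]_x _) (\int[mu]_x _) (\int[mu]_x _) => x1 x2 x3 x4 /=.
  by ring.
Qed.

End laplace_pairing.

(** * The upper bound *)

Section mean_bound.
Context {R : realType}.
Notation mu := (@lebesgue_measure R).

Lemma int_ge_itv (f : R -> R) (a b c : R) : a <= b -> L1 f -> (forall x, 0 <= f x) ->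
  (forall x, a <= x <= b -> c <= f x) -> c * (b - a) <= \int[mu]_x f x.
Proof.
move=> ab lf f0 cf; have l1 := L1Z c (L1_indic_cc a b).
have <- : \int[mu]_x (c * \1_`[a, b] x) = c * (b - a).
  rewrite (intZ _ (L1_indic_cc a b)); congr (_ * _).
  have := @ftc_itv R id (fun=> 1) a b ab (fun x => is_derive_id x 1) (fun x => cvg_cst _).
  by rewrite intE => <-; apply: eq_int => x; rewrite mul1r.
apply: int_le => // x; rewrite indicE mem_setE in_itv /=.
by case: (boolP (a <= x <= b)) => /= [/cf|_]; rewrite ?mulr1 ?mulr0.
Qed.

(** Used before [res] is known to be bounded, when no dominating function is available. *)
Lemma L1_monotone_limit (f_ : nat -> R -> R) (f : R -> R) (B : R) :
  (forall n, L1 (f_ n)) -> (forall n x, 0 <= f_ n x) ->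
  (forall x n m, (n <= m)%N -> f_ n x <= f_ m x) ->
  (forall x, f_ n x @[n --> \oo] --> f x) ->
  (forall n, \int[mu]_x f_ n x <= B) -> L1 f.
Proof.
move=> lf f0 nd cf fB.
have mf n : measurable_fun setT (EFin \o f_ n).
  by apply: (measurable_EFinP _ _).2; exact: L1_measurable (lf n).
have mlim : measurable_fun setT f.
  by apply: (@measurable_fun_cvg _ _ _ _ f_) => // n; exact: L1_measurable (lf n).
have ff0 x : 0 <= f x.
  rewrite -(cvg_lim (@Rhausdorff R) (cf x)); apply: limr_ge; last by apply: nearW.
  by apply/cvg_ex; exists (f x); exact: cf.
apply/integrableP; split; first exact: (measurable_EFinP _ _).2.
have h := @cvg_monotone_convergence _ _ _ mu setT measurableT (fun n => EFin \o f_ n) mf.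
have {}h : (\int[mu]_x (f_ n x)%:E @[n --> \oo] --> \int[mu]_x (f x)%:E)%E.
  have -> : (\int[mu]_x (f x)%:E = \int[mu]_x limn (fun n => (f_ n x)%:E))%E.
    apply: eq_integral => x _; apply/esym/cvg_lim => //.
    by apply: cvg_EFin; [exact: nearW | exact: cf].
  apply: h => [n x _|x _ n m nm]; rewrite lee_fin //; exact: nd.
have le : (\int[mu]_x (f x)%:E <= B%:E)%E.
  rewrite -(cvg_lim _ h) //; apply: lime_le; first by apply/cvg_ex; eexists; exact: h.
  apply: nearW => n; rewrite -(fineK (integrable_fin_num measurableT (lf n))) lee_fin.
  exact: fB.
rewrite (_ : (\int[mu]_x `|(EFin \o f) x|)%E = (\int[mu]_x (f x)%:E)%E).
  exact: le_lt_trans le (ltry _).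
by apply: eq_integral => x _ /=; rewrite ger0_norm.
Qed.

Lemma L1_shift (f : R -> R) (h : R) : L1 f -> L1 (fun x => f (x + h)).
Proof. by move=> /(L1_affine h (oner_neq0 R)); apply: eq_L1 => x; rewrite mul1r. Qed.

Lemma int_shift (f : R -> R) (h : R) : L1 f -> \int[mu]_x f (x + h) = \int[mu]_x f x.
Proof.
move=> /(int_affine h (oner_neq0 R)); rewrite normr1 invr1 mul1r => <-.
by apply: eq_int => x; rewrite mul1r.
Qed.

(* The increments of the nondecreasing function [r x + M x] over unit intervals
   are controlled by differences of consecutive means, so [r] differs from its
   mean near [n] by a bounded amount. *)
Lemma bounded_of_means (r K : R -> R) (A M c k B : R) : 0 <= A -> 0 <= M -> 0 < k ->
  measurable_fun setT r -> (forall x, x <= A -> `|r x| <= c) ->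
  (forall x y, A <= x -> x <= y -> - M * (y - x) <= r y - r x) ->
  L1 K -> (forall x, 0 <= K x) -> (forall x, `|x| <= 1 -> k <= K x) ->
  L1 (fun x => x * K x) ->
  (forall n : nat, L1 (fun x => r (x + n%:R) * K x)) ->
  (forall n : nat, `|\int[mu]_x (r (x + n%:R) * K x)| <= B) ->
  exists C, forall x, `|r x| <= C.
Proof.
move=> A0 M0 k0 mr rc rM lK K0 Kk lxK lr rB.
have c0 : 0 <= c by exact: le_trans (normr_ge0 _) (rc A (lexx A)).
(* The one-sided control of [r] starts at [A]. Freezing the argument there changes [r] by at most
   [2 c] and makes [T] nondecreasing on the whole line. *)
pose m x := Num.max x A.
have mA x : A <= m x by rewrite /m le_max lexx orbT.
have mmono x y : x <= y -> m x <= m y.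
  by move=> xy; rewrite /m ge_max !le_max xy lexx orbT.
have mlip x y : `|m x - m y| <= `|x - y|.
  rewrite ler_norml /m; have := ler_norm (x - y); have := ler_norm (y - x); rewrite distrC.
  by case: (leP x A); case: (leP y A) => *; apply/andP; split; lra.
have meas_m : measurable_fun setT m by apply: measurable_maxr.
pose Q x := r (m x); pose T x := Q x + M * m x.
have mQ : measurable_fun setT Q by exact: measurableT_comp.
have Tmono x y : x <= y -> T x <= T y.
  move=> xy; have := rM _ _ (mA x) (mmono _ _ xy); rewrite /T /Q mulNr mulrBr.
  by clear; lra.
have Qr x : `|Q x - r x| <= 2 * c.
  rewrite /Q /m; case: (leP x A) => xA; last by rewrite subrr normr0 mulr_ge0.
  by rewrite mulr2n mulrDl mul1r (le_trans (ler_normB _ _)) // lerD // rc.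
pose N := \int[mu]_x K x; pose N1 := \int[mu]_x `|x * K x|.
have lQr n : L1 (fun x => (Q (x + n) - r (x + n)) * K x).
  apply: eq_L1 (L1_bdd lK _ (fun x => Qr (x + n))) => [x|]; first by rewrite mulrC.
  have ms : measurable_fun setT (fun x : R => x + n) by apply: measurable_funD.
  by apply: measurable_funB; exact: measurableT_comp ms.
have lQ (n : nat) : L1 (fun x => Q (x + n%:R) * K x).
  by apply: eq_L1 (L1D (lr n) (lQr n%:R)) => x; ring.
have iQ (n : nat) : `|\int[mu]_x (Q (x + n%:R) * K x)| <= B + 2 * c * N.
  have -> : \int[mu]_x (Q (x + n%:R) * K x) = \int[mu]_x (r (x + n%:R) * K x) +
     \int[mu]_x ((Q (x + n%:R) - r (x + n%:R)) * K x).
    by rewrite -(intD (lr n) (lQr n%:R)); apply: eq_int => x; ring.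
  apply: (le_trans (ler_normD _ _)); apply: lerD => //.
  rewrite /N -(intZ _ lK); apply: int_norm_le; [exact: lQr | exact: L1Z |] => x.
  by rewrite normrM (ger0_norm (K0 x)) ler_wpM2r.
have lm h : L1 (fun x => m (x + h) * K x).
  apply: (L1_le _ (L1D (L1_norm lxK) (L1Z (`|h| + A) lK))).
    apply: measurable_funM; last exact: L1_measurable lK.
    by apply: measurableT_comp => //; apply: measurable_funD.
  move=> x; rewrite !normrM (ger0_norm (K0 x)) -mulrDl ler_wpM2r //.
  rewrite -(normr_id (m _)); have := mlip (x + h) 0; have := ler_normD x h.
  rewrite subr0 (_ : m 0 = A); last by rewrite /m max_r.
  have := ler_normB (m (x + h)) (- A).
  have := ler_normD (m (x + h) - A) A; rewrite subrK (ger0_norm A0) normr_id.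
  by clear; lra.
pose C1 := 2 * (B + 2 * c * N) + 2 * M * N.
have step (n : nat) : k * (T n.+1%:R - T n%:R) <= C1.
  have lT (j : nat) : L1 (fun x => T (x + j%:R) * K x).
    by apply: eq_L1 (L1D (lQ j) (L1Z M (lm j%:R))) => x; rewrite /T; ring.
  pose f x := T (x + n.+2%:R) * K x - T (x + n%:R) * K x.
  have lf : L1 f by exact: L1B.
  have f0 x : 0 <= f x.
    rewrite /f -mulrBl; apply: mulr_ge0 => //; rewrite subr_ge0 Tmono // lerD2l ler_nat.
    exact: leq_trans (leqnSn _) (leqnSn _).
  have n2 : n.+2%:R = n.+1%:R + 1 :> R by rewrite -natr1.
  have n1 : n.+1%:R = n%:R + 1 :> R by rewrite -natr1.
  (* For [x] in [[-1, 0]] the interval from [x + n] to [x + n + 2] contains [[n, n + 1]], and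
     [K x >= k]; this is why means two steps apart are compared. *)
  have fk x : - 1 <= x <= 0 -> k * (T n.+1%:R - T n%:R) <= f x.
    move=> /andP[x1 x0]; rewrite /f -mulrBl mulrC; apply: ler_pM.
    - by rewrite subr_ge0 Tmono // ler_nat.
    - exact: ltW.
    - apply: lerB; apply: Tmono; rewrite ?n2; move: x1 x0; clear; lra.
    - by apply: Kk; rewrite ler_norml x1 (le_trans x0).
  have m10 : - 1 <= 0 :> R by rewrite oppr_le0.
  have := int_ge_itv m10 lf f0 fk; rewrite opprK add0r mulr1 => h.
  apply: (le_trans h).
  pose d x := (m (x + n.+2%:R) - m (x + n%:R)) * K x.
  have ld : L1 d by apply: eq_L1 (L1B (lm n.+2%:R) (lm n%:R)) => x; rewrite /d mulrBl.
  have -> : \int[mu]_x f x = (\int[mu]_x (Q (x + n.+2%:R) * K x) -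
      \int[mu]_x (Q (x + n%:R) * K x)) + M * \int[mu]_x d x.
    rewrite -(intB (lQ _) (lQ _)) -(intZ _ ld) -(intD (L1B (lQ _) (lQ _)) (L1Z _ ld)).
    by apply: eq_int => x; rewrite /f /T /d; ring.
  have hd : \int[mu]_x d x <= 2 * N.
    rewrite /N -(intZ _ lK); apply: int_le => //; first exact: L1Z.
    move=> x; rewrite /d ler_wpM2r //; apply: (le_trans (ler_norm _)).
    apply: (le_trans (mlip _ _)); rewrite (_ : _ - _ = 2); first by rewrite ger0_norm.
    by rewrite n2 n1; ring.
  have := ler_wpM2l M0 hd; have := iQ n.+2; have := iQ n; rewrite !ler_norml.
  rewrite /C1; clear; lra.
pose C2 := C1 / k.
have stepT (n : nat) : T n.+1%:R - T n%:R <= C2 by rewrite /C2 ler_pdivlMr // mulrC.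
have C20 : 0 <= C2 by apply: le_trans (stepT 0%N); rewrite subr_ge0 Tmono // ler_nat.
clearbody C2.
have stepk (j i : nat) : T (i + j)%:R - T i%:R <= j%:R * C2.
  elim: j => [|j IH]; first by rewrite addn0 subrr mul0r.
  have := stepT (i + j)%N; rewrite addnS -[j.+1%:R]natr1 mulrDl mul1r.
  by move: IH; clear; lra.
have Tij (i j : nat) : `|T i%:R - T j%:R| <= C2 * `|i%:R - j%:R|.
  wlog ij : i j / (i <= j)%N.
    by move=> H; case/orP: (leq_total i j) => /H //; rewrite distrC [X in _ * X]distrC.
  rewrite distrC [X in _ * X]distrC !ger0_norm ?subr_ge0 ?Tmono ?ler_nat //.
  by have := stepk (j - i)%N i; rewrite subnKC // natrB // mulrC.
have Tn (n : nat) y : `|T y - T n%:R| <= C2 * (`|y - n%:R| + 1).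
  case: (ltP y 0) => y0.
    have -> : T y = T 0%:R by rewrite /T /Q /m !max_r // (le_trans (ltW y0)).
    apply: (le_trans (Tij 0%N n)); rewrite ler_wpM2l // sub0r normrN ger0_norm //.
    by rewrite distrC; have := ler_norm (n%:R - y); move: y0; clear; lra.
  have /andP[j1 j2] := truncn_itv y0; set j := Num.truncn y in j1 j2.
  have := ler_norm (y - n%:R); have := ler_norm (n%:R - y); rewrite distrC => a1 a2.
  have t1 : T j%:R <= T y by exact: Tmono.
  have t2 : T y <= T j.+1%:R by apply: Tmono; exact: ltW.
  have b1 : `|j%:R - n%:R| <= `|y - n%:R| + 1 :> R.
    by move: j2; rewrite ler_norml -natr1 => j2; apply/andP; split; move: a1 a2 j1 j2; clear; lra.
  have b2 : `|j.+1%:R - n%:R| <= `|y - n%:R| + 1 :> R.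
    by move: j2; rewrite ler_norml -natr1 => j2; apply/andP; split; move: a1 a2 j1 j2; clear; lra.
  have := le_trans (Tij j n) (ler_wpM2l C20 b1); have := le_trans (Tij j.+1 n) (ler_wpM2l C20 b2).
  by rewrite !ler_norml; move: t1 t2; clear; lra.
pose C3 := C2 + M.
have C30 : 0 <= C3 by exact: addr_ge0.
have Qn (n : nat) y : `|Q y - Q n%:R| <= C3 * (`|y - n%:R| + 1).
  have -> : Q y - Q n%:R = (T y - T n%:R) - M * (m y - m n%:R) by rewrite /T; ring.
  apply: (le_trans (ler_normB _ _)); rewrite normrM (ger0_norm M0).
  have := Tn n y; have := ler_wpM2l M0 (mlip y n%:R); rewrite /C3; move: M0; clear; lra.
have N0 : 0 < N.
  have := @int_ge_itv K 0 1 k ler01 lK K0; rewrite subr0 mulr1 => H; apply: lt_le_trans k0 (H _).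
  by move=> x /andP[x0 x1]; apply: Kk; rewrite ger0_norm.
(* The mean of [Q] around [n] is bounded, and [Q] deviates from [Q n] at most linearly; since
   [x * K x] is integrable, [Q n] is bounded. *)
pose C5 := (B + 2 * c * N + C3 * (N1 + N)) / N.
have QC (n : nat) : `|Q n%:R| <= C5.
  rewrite /C5 ler_pdivlMr // -{1}(gtr0_norm N0) -normrM.
  have lC : L1 (fun x => Q n%:R * K x) by exact: L1Z.
  have lD : L1 (fun x => (Q (x + n%:R) - Q n%:R) * K x).
    by apply: eq_L1 (L1B (lQ n) lC) => x; rewrite mulrBl.
  have -> : Q n%:R * N = \int[mu]_x (Q (x + n%:R) * K x) -
      \int[mu]_x ((Q (x + n%:R) - Q n%:R) * K x).
    by rewrite -(intB (lQ n) lD) -(intZ _ lK); apply: eq_int => x; ring.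
  apply: (le_trans (ler_normB _ _)); apply: lerD => //.
  have lxa := L1_norm lxK.
  rewrite /N1 -(intD lxa lK) -(intZ _ (L1D lxa lK)); apply: int_norm_le => //.
    by apply: L1Z; exact: L1D.
  move=> x; rewrite !normrM (ger0_norm (K0 x)) -[X in _ * (_ + X)]mul1r -mulrDl mulrA ler_wpM2r //.
  by have := Qn n (x + n%:R); rewrite addrK.
exists (C5 + C3 * 2 + 2 * c) => y.
have QyC : `|Q y| <= C5 + C3 * 2.
  case: (ltP y 0) => y0.
    have -> : Q y = Q 0%:R by rewrite /Q /m !max_r // (le_trans (ltW y0)).
    by apply: (le_trans (QC 0%N)); rewrite lerDl mulr_ge0.
  have /andP[j1 j2] := truncn_itv y0; set j := Num.truncn y in j1 j2.
  have -> : Q y = Q j%:R + (Q y - Q j%:R) by ring.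
  apply: (le_trans (ler_normD _ _)); apply: lerD; first exact: QC.
  apply: (le_trans (Qn j y)); rewrite ler_wpM2l // ger0_norm ?subr_ge0 //.
  by move: j2; rewrite -natr1; clear; lra.
have -> : r y = Q y - (Q y - r y) by ring.
apply: (le_trans (ler_normB _ _)); exact: lerD QyC (Qr y).
Qed.

End mean_bound.

(** * Pairings with the residual of the primitive *)

Section direct_part.
Context {R : realType}.
Notation mu := (@lebesgue_measure R).
Variables (lambda : R) (rho : R -> R) (beta gamma : R).
Hypotheses (hr : L1loc_nneg rho)
  (hL : forall s : R[i], 0 < complex.Re s -> laplace_converges rho s)
  (hpf : local_pseudofunction_boundary `]- lambda, lambda[
     (fun s => (laplace rho s - (beta +i* gamma)) / s)).

(** The cutoff removes the constant [- beta] to which [prim rho - beta] reduces on the negative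
    half-line. *)
Definition res (x : R) : R := (prim rho x - beta) * \1_`[0, +oo[ x.

Lemma res_measurable : measurable_fun setT res.
Proof.
apply: measurable_funM; last exact: measurable_indic.
by apply: measurable_funB => //; exact: prim_measurable.
Qed.

Lemma res_expi s x : (prim rho x - beta) * expi s x = res x * expR (- s * x).
Proof. by rewrite /res /expi; ring. Qed.

Lemma res_lt0 x : x < 0 -> res x = 0.
Proof. by move=> x0; rewrite /res indicE mem_setE in_itv /= leNgt x0 mulr0. Qed.

Lemma res_ge0 x : 0 <= x -> res x = prim rho x - beta.
Proof. by move=> x0; rewrite /res indicE mem_setE in_itv /= x0 mulr1. Qed.

(* [p h] and [q h] are the real and imaginary parts of the boundary distribution
   tested against the wave packet of frequency [h]. *)
Definition packet_limits (phi : R -> R) (t0 : R) (p q : R -> R) : Prop :=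
  [/\ forall h, \int[mu]_x (res x * expR (- s * x) * (cos (t0 * (x - h)) * cosT phi 0 (x - h))) -
        gamma * \int[mu]_x (expi s x * (sin (t0 * (x - h)) * cosT phi 0 (x - h)))
        @[s --> 0^'+] --> p h,
      forall h, - (\int[mu]_x (res x * expR (- s * x) * (sin (t0 * (x - h)) * cosT phi 0 (x - h)))) -
        gamma * \int[mu]_x (expi s x * (cos (t0 * (x - h)) * cosT phi 0 (x - h)))
        @[s --> 0^'+] --> q h &
      forall h : nat -> R, h n @[n --> \oo] --> +oo ->
        p (h n) @[n --> \oo] --> (0 : R) /\ q (h n) @[n --> \oo] --> (0 : R)].

(** A packet supported close to [t1] lies in the neighborhood where the boundary distribution
    coincides with one global pseudofunction, to which [pf_pairing] applies; the condition on
    [|t0 - t1| + a] is the support inclusion. *)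
Lemma local_packet_limits (t1 : R) : - lambda < t1 < lambda ->
  exists2 d : R, 0 < d & forall phi a t0, Cc a phi -> (forall t, phi (- t) = phi t) ->
    `|t0 - t1| + a < d -> exists p q, packet_limits phi t0 p q.
Proof.
move=> /= t1l; have [g [gd gl] gb] := hpf.
have Ut : `]- lambda, lambda[%classic t1 by rewrite /= in_itv.
have [V [oV Vt VU [f pf gf]]] := gl _ Ut.
have /nbhs_ballP[d /= d0 dV] := open_nbhs_nbhs (conj oV Vt).
exists d => // phi a t0 hphi ephi td.
have sV : `[t0 - a, t0 + a] `<=` V.
  move=> t; rewrite /= in_itv /= => /andP[ta tb]; apply: dV; rewrite /ball /=.
  apply: le_lt_trans td; have := ler_normD (t1 - t0) (t0 - t); rewrite subrKA => h1.
  rewrite (distrC t0); apply: (le_trans h1); rewrite lerD2l ler_norml.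
  by apply/andP; split; lra.
have tV h : test_function V (packet phi t0 h) := packet_test hphi h sV.
have tU h : test_function `]- lambda, lambda[ (packet phi t0 h) :=
  packet_test hphi h (subset_trans sV VU).
exists (fun h => complex.Re (f (packet phi t0 h))), (fun h => complex.Im (f (packet phi t0 h))).
have key h (F : R -> R[i]) : (forall s, 0 < s -> cint setT (fun t => (laplace rho (s +i* t) - (beta +i* gamma)) / (s +i* t) *
    packet phi t0 h t) = F s) -> ccvg 0^'+ F (f (packet phi t0 h)).
  move=> hF; have [c1 c2] := gb _ (tU h); rewrite -(gf _ (tV h)).
  have e : \forall s \near (0 : R)^'+, cint setT (fun t => (laplace rho (s +i* t) -
      (beta +i* gamma)) / (s +i* t) * packet phi t0 h t) = F s.
    by near=> s; apply: hF; near: s; exact: nbhs_right_gt.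
  by split; [apply: cvg_trans c1 | apply: cvg_trans c2]; apply: near_eq_cvg;
    apply: filterS e => s ->.
have lp h := key h _ (fun s s0 => laplace_packet hphi ephi hr hL beta gamma t0 h s0).
have resE (w : R -> R) s : \int[mu]_x ((prim rho x - beta) * expi s x * w x) =
    \int[mu]_x (res x * expR (- s * x) * w x).
  by apply: eq_int => x; rewrite res_expi.
split=> [h|h|h hh].
- have [c _] := lp h; apply: cvg_trans c; apply: near_eq_cvg; apply: nearW => s /=.
  by rewrite (resE (fun x => cos (t0 * (x - h)) * cosT phi 0 (x - h))).
- have [_ c] := lp h; apply: cvg_trans c; apply: near_eq_cvg; apply: nearW => s /=.
  by rewrite (resE (fun x => sin (t0 * (x - h)) * cosT phi 0 (x - h))).
- exact: (pf_pairing hphi ephi t0 pf hh).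
Unshelve. all: by end_near.
Qed.

(** The local radius depends on the frequency; compactness of [[- l, l]] makes it uniform, at the
    price of [l < lambda]. *)
Lemma uniform_packet_limits (l : R) : 0 < l -> l < lambda ->
  exists2 d : R, 0 < d & forall phi a t0, 0 < a -> a < d -> `|t0| <= l -> Cc a phi ->
    (forall t, phi (- t) = phi t) -> exists p q, packet_limits phi t0 p q.
Proof.
move=> l0 ll.
pose P (d t0 : R) := forall phi a, 0 < a -> a < d -> Cc a phi ->
  (forall t, phi (- t) = phi t) -> exists p q, packet_limits phi t0 p q.
have /compact_near_coveringP := @segment_compact R (- l) l.
move=> /(_ R (0 : R)^'+ P _) H.
have {}H : \forall d \near (0 : R)^'+, `[- l, l]%classic `<=` P d.
  apply: H => t1; rewrite /= in_itv /= => /andP[lt1 t1l].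
  have t1lam : - lambda < t1 < lambda by apply/andP; split; lra.
  have [d d0 hd] := local_packet_limits t1lam.
  (* Half of the local radius goes to the distance between frequencies, half to the width of the
     support. *)
  exists ([set t0 | `|t0 - t1| < d / 2], [set e | e < d / 2]); first split.
  - have d20 : 0 < d / 2 by rewrite divr_gt0.
    by apply: filterS (nbhsx_ballx t1 (d / 2) d20) => t; rewrite /ball /= distrC.
  - by apply: nbhs_right_lt; rewrite divr_gt0.
  - move=> [t0 e] /= [h1 h2] phi a a0 ae hphi ephi; apply: (hd phi a t0) => //.
    by move: (lt_trans ae h2) h1; lra.
have [d [d0 Pd]] : exists d, 0 < d /\ `[- l, l]%classic `<=` P d.
  have H2 : \forall d \near (0 : R)^'+, 0 < d /\ `[- l, l]%classic `<=` P d.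
    by near=> d; split; near: d; [exact: nbhs_right_gt | exact: H].
  exact: (@filter_ex _ _ (at_right_proper_filter (0 : R)) _ H2).
exists d => // phi a t0 a0 ad t0l; apply: (Pd t0 _ phi a) => //.
by rewrite /= in_itv /= -ler_norml.
Unshelve. all: by end_near.
Qed.

Lemma inv_nat_gt0 (n : nat) : 0 < (n.+1%:R)^-1 :> R.
Proof. by rewrite invr_gt0. Qed.

Lemma cvg_at_right0_seq (f : R -> R) (l : R) : f s @[s --> 0^'+] --> l ->
  f (n.+1%:R)^-1 @[n --> \oo] --> l.
Proof.
move=> /cvg_at_rightP; apply; split; first exact: inv_nat_gt0.
exact: cvg_inv_nat.
Qed.

Lemma expR_inv_nat_cvg1 (x : R) : expR (- (n.+1%:R)^-1 * x) @[n --> \oo] --> (1 : R).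
Proof.
have h : - (n.+1%:R)^-1 * x @[n --> \oo] --> - 0 * x.
  by apply: cvgM; [apply: cvgN; exact: cvg_inv_nat | exact: cvg_cst].
by have := cvg_comp _ _ h (@continuous_expR R (- 0 * x)); rewrite oppr0 mul0r expR0.
Qed.

Lemma abel_limit (f : R -> R) : L1 f -> (forall x, x < 0 -> f x = 0) ->
  \int[mu]_x (f x * expR (- (n.+1%:R)^-1 * x)) @[n --> \oo] --> \int[mu]_x f x.
Proof.
move=> lf f0; have mf := L1_measurable lf.
have [|||||_ //] := @dct R (fun n x => f x * expR (- (n.+1%:R)^-1 * x)) f (fun x => `|f x|).
- move=> n; apply: measurable_funM => //.
  exact: cts_measurable (is_derive_continuous (is_derive_expR_lin _)).
- exact: mf.
- by move=> x; rewrite -[X in _ --> X]mulr1; apply: cvgM; [exact: cvg_cst | exact: expR_inv_nat_cvg1].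
- exact: L1_norm.
- move=> n x; case: (ltP x 0) => x0; first by rewrite f0 // mul0r normr0.
  rewrite normrM (ger0_norm (expR_ge0 _)) ler_piMr // -expR0 ler_expR mulNr oppr_le0.
  by rewrite mulr_ge0 // ltW // inv_nat_gt0.
Qed.

Lemma seq_bounded (u : nat -> R) (l : R) : u n @[n --> \oo] --> l ->
  exists B, forall n, `|u n| <= B.
Proof.
move=> ul; have cu : cvgn u by apply/cvg_ex; exists l.
have /pinfty_ex_gt0[B _ hB] := cvg_seq_bounded cu.
by exists B => n; exact: hB.
Qed.

(** A narrow support in frequency gives a slowly varying transform, which therefore stays above half
    its value at 0 on all of [[-1, 1]]. *)
Lemma tight_kernel (d : R) : 0 < d -> exists phi a k,
  [/\ 0 < a, a < d, pos_kernel a phi, 0 < k & forall x, `|x| <= 1 -> k <= cosT phi 0 x].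
Proof.
move=> d0; have [phi hp] := @pos_kernel_exists R.
have [hc _ _ gt0 _] := hp.
have cK : continuous (cosT phi 0) := smoothr_continuous (smoothr_cosT hc).
have k0 : 0 < cosT phi 0 0 / 2 by rewrite divr_gt0.
have /cvgrPdist_lt/(_ _ k0) := cK 0.
move=> /nbhs_ballP[e /= e0 he].
pose a := Num.min (d / 2) (e / 2).
have a0 : 0 < a by rewrite /a lt_min !divr_gt0.
have ad : a <= d / 2 by rewrite /a ge_min lexx.
have ae : a <= e / 2 by rewrite /a ge_min lexx orbT.
exists (dilate a phi), (a * 1), (cosT phi 0 0 / 2); split => //.
- by rewrite mulr1.
- by rewrite mulr1; lra.
- exact: dilate_kernel.
- move=> x x1; rewrite (cosT_dilate _ a0 hc).
  have : ball (0 : R) e (a * x).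
    rewrite /ball /= sub0r normrN normrM (gtr0_norm a0).
    have : a * `|x| <= a * 1 by rewrite ler_wpM2l // ltW.
    by rewrite mulr1; lra.
  by move=> /he /= h; have := le_lt_trans (ler_norm _) h; lra.
Qed.

Hypothesis lambda0 : 0 < lambda.

(** At frequency 0 the sine terms disappear, and Abel summation leaves [q n] equal to [- gamma]
    times the mass on the half-line of a translated nonnegative kernel. That mass stays at least
    [k], while [q n] tends to 0. *)
Lemma gamma_eq0 : gamma = 0.
Proof.
have l20 : 0 < lambda / 2 by rewrite divr_gt0.
have l2 : lambda / 2 < lambda by lra.
have [d d0 hd] := uniform_packet_limits l20 l2.
have [phi [a [k [a0 ad [hc he K0 _ _] k0 hk]]]] := tight_kernel d0.
have z0 : `|0 : R| <= lambda / 2 by rewrite normr0 ltW.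
have [p [q [_ hq vq]]] := hd phi a 0 a0 ad z0 hc he.
have lK : L1 (cosT phi 0) := cosT_L1 0 hc.
have hn : n%:R @[n --> \oo] --> +oo := @cvgr_idn R.
have [_ q0] := vq _ hn.
pose I n x : R := cosT phi 0 (x - n%:R) * \1_`[0, +oo[ x.
have lI n : L1 (I n).
  by apply: L1_indic; [exact: measurable_itv | exact: L1_shift lK].
have qE (n : nat) : q n%:R = - gamma * \int[mu]_x I n x.
  apply: (cvg_unique _ (cvg_at_right0_seq (hq n%:R))) => //.
  have I0 x : x < 0 -> I n x = 0.
    by move=> x0; rewrite /I indicE mem_setE in_itv /= leNgt x0 mulr0.
  have : - gamma * \int[mu]_x (I n x * expR (- (m.+1%:R)^-1 * x)) @[m --> \oo] -->
      - gamma * \int[mu]_x I n x.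
    by apply: cvgM; [exact: cvg_cst | exact: abel_limit].
  apply: cvg_trans; apply: near_eq_cvg; apply: nearW => m.
  rewrite [X in _ = - X - _](_ : _ = 0); last first.
    rewrite -[RHS](mul0r (\int[mu]_x (0 : R))) -(intZ 0 (@L10 R)); apply: eq_int => x.
    by rewrite mul0r sin0 !(mul0r, mulr0).
  rewrite oppr0 sub0r mulNr; congr (- (_ * _)); apply: eq_int => x.
  by rewrite mul0r cos0 mul1r /expi /I; ring.
apply/eqP/negP => /negP g0.
have gk : 0 < `|gamma| * k by rewrite mulr_gt0 // normr_gt0.
have /cvgrPdist_lt/(_ _ gk)[N _ /(_ N (leqnn N))] := q0.
rewrite sub0r normrN qE normrM normrN ltr_pM2l ?normr_gt0 // ltNge => /negP; apply.
apply: (le_trans _ (ler_norm _)).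
have NN : N%:R <= N%:R + 1 :> R by rewrite lerDl.
have := @int_ge_itv R (I N) _ _ k NN (lI N); rewrite (_ : N%:R + 1 - N%:R = 1 :> R) ?mulr1; last by ring.
apply.
  by move=> x; rewrite /I mulr_ge0 // indicE; case: (_ \in _).
move=> x /andP[x1 x2]; rewrite /I indicE mem_setE in_itv /= (le_trans (ler0n _ N) x1) mulr1.
by apply: hk; rewrite ger0_norm ?subr_ge0 //; lra.
Qed.

Variables (A M : R).
Hypotheses (A0 : 0 <= A) (M0 : 0 <= M)
  (slow : forall x y, A <= x -> x <= y -> - M * (y - x) <= prim rho y - prim rho x).

Lemma res_slow x y : A <= x -> x <= y -> - M * (y - x) <= res y - res x.
Proof.
move=> Ax xy; rewrite !res_ge0 ?(le_trans A0) ?(le_trans Ax) //.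
by have := slow Ax xy; lra.
Qed.

(** Adding [L], affine on the half-line, makes [res] nonnegative at frequency 0, so the Abel means
    of the sum increase as the abscissa decreases; monotone convergence then identifies [p n] with a
    genuine mean of [res]. *)
Lemma res_bounded : exists C, forall x, `|res x| <= C.
Proof.
have l20 : 0 < lambda / 2 by rewrite divr_gt0.
have l2 : lambda / 2 < lambda by lra.
have [d d0 hd] := uniform_packet_limits l20 l2.
have [phi [a [k [a0 ad [hc he K0 _ _] k0 hk]]]] := tight_kernel d0.
have z0 : `|0 : R| <= lambda / 2 by rewrite normr0 ltW.
have [p [q [hp _ vp]]] := hd phi a 0 a0 ad z0 hc he.
set K := cosT phi 0 in K0 hk hp *.
have lK : L1 K := cosT_L1 0 hc.
have lxK : L1 (fun x => x * K x).
  apply: eq_L1 (cosT_L1 (0 + pi / 2) (Cc_derive1 hc)) => x.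
  by rewrite /K (cosT_mulx _ _ hc).
have [c c0 hc0] : exists2 c, 0 <= c & forall x, x <= A -> `|res x| <= c.
  exists (\int[mu]_t `|rho t * \1_`[0, A] t| + `|beta|).
    by rewrite addr_ge0 // Rintegral_ge0.
  move=> x xA; case: (ltP x 0) => x0.
    by rewrite res_lt0 // normr0 addr_ge0 // Rintegral_ge0.
  by rewrite res_ge0 // (le_trans (ler_normB _ _)) // lerD2r prim_bound.
(* Up to [A] the function [res] is at least [- c], and beyond [A] it decreases at rate at most [M];
   hence [res + L] is nonnegative. *)
pose L x : R := (M * x + c) * \1_`[0, +oo[ x.
have L0 x : 0 <= L x.
  rewrite /L indicE mem_setE in_itv /= andbT; case: (leP 0 x) => x0; last by rewrite mulr0.
  by rewrite mulr1 addr_ge0 // mulr_ge0.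
have L_lt0 x : x < 0 -> L x = 0.
  by move=> x0; rewrite /L indicE mem_setE in_itv /= leNgt x0 mulr0.
have W0 x : 0 <= res x + L x.
  case: (ltP x 0) => x0.
    by rewrite res_lt0 // add0r.
  rewrite /L indicE mem_setE in_itv /= x0 mulr1.
  case: (leP x A) => xA.
    by have := hc0 x xA; rewrite ler_norml => /andP[h _]; have := mulr_ge0 M0 x0; lra.
  have := hc0 A (lexx A); rewrite ler_norml => /andP[h _].
  by have := res_slow (lexx A) (ltW xA); have := mulr_ge0 M0 A0; lra.
have mres := res_measurable.
have key (n : nat) : L1 (fun x => res x * K (x - n%:R)) /\
    p n%:R = \int[mu]_x (res x * K (x - n%:R)).
  pose Kn x := K (x - n%:R); pose e (j : nat) (x : R) : R := expR (- (j.+1%:R)^-1 * x).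
  have lKn : L1 Kn by exact: L1_shift lK.
  have Kn0 x : 0 <= Kn x by exact: K0.
  have lxKn : L1 (fun x => x * Kn x).
    apply: eq_L1 (L1D (L1_shift (- n%:R) lxK) (L1Z n%:R lKn)) => x.
    by rewrite /Kn; ring.
  have lLK : L1 (fun x => L x * Kn x).
    have := L1_indic (measurable_itv `[0, +oo[) (L1D (L1Z M lxKn) (L1Z c lKn)).
    by apply: eq_L1 => x; rewrite /L; ring.
  have me j : measurable_fun setT (e j).
    exact: cts_measurable (is_derive_continuous (is_derive_expR_lin _)).
  have e1 j x : 0 <= x -> `|e j x| <= 1.
    move=> x0; rewrite ger0_norm ?expR_ge0 // -expR0 ler_expR mulNr oppr_le0.
    by rewrite mulr_ge0 // ltW // inv_nat_gt0.
  have lLe j : L1 (fun x => L x * Kn x * e j x).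
    apply: L1_le (L1_norm lLK) _.
      by apply: measurable_funM; [exact: L1_measurable lLK | exact: me].
    move=> x; case: (ltP x 0) => x0.
      by rewrite L_lt0 // !mul0r normr0.
    by rewrite normrM ler_piMr // e1.
  have lre j : L1 (fun x => res x * e j x * Kn x).
    have i0 := inv_nat_gt0 j.
    have lF : L1 (fun x => res x * e j x).
      apply: eq_L1 (L1B (L1_prim_expi hr hL i0) (L1Z beta (L1_exp i0))) => x.
      by rewrite -res_expi /expi; ring.
    apply: (L1_bdd lF _ (C := \int[mu]_t `|phi t|)); first exact: L1_measurable lKn.
    by move=> x; exact: cosT_bound (Cc_L1 hc).
  have cu : \int[mu]_x (res x * e j x * Kn x) @[j --> \oo] --> p n%:R.
    have := cvg_at_right0_seq (hp n%:R).
    apply: cvg_trans; apply: near_eq_cvg; apply: nearW => j.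
    rewrite gamma_eq0 mul0r subr0; apply: eq_int => x.
    by rewrite mul0r cos0 mul1r.
  have [B hB] := seq_bounded cu.
  have lW : L1 (fun x => (res x + L x) * Kn x).
    apply: (@L1_monotone_limit R (fun j x => (res x + L x) * Kn x * e j x) _
      (B + \int[mu]_x (L x * Kn x))).
    - by move=> j; apply: eq_L1 (L1D (lre j) (lLe j)) => x; ring.
    - by move=> j x; rewrite !mulr_ge0 // expR_ge0.
    - move=> x i j ij; case: (ltP x 0) => x0.
        by rewrite res_lt0 // L_lt0 // addr0 !mul0r.
      apply: ler_wpM2l; first by rewrite mulr_ge0.
      by rewrite ler_expR !mulNr lerN2 ler_wpM2r // lef_pV2 ?posrE ?ltr0n // ler_nat.
    - move=> x; rewrite -[X in _ --> X]mulr1; apply: cvgM; first exact: cvg_cst.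
      exact: expR_inv_nat_cvg1.
    - move=> j; rewrite (_ : \int[mu]_x _ = \int[mu]_x (res x * e j x * Kn x) +
          \int[mu]_x (L x * Kn x * e j x)); last first.
        by rewrite -(intD (lre j) (lLe j)); apply: eq_int => x; ring.
      apply: lerD; first exact: le_trans (ler_norm _) (hB j).
      apply: int_le => // x; case: (ltP x 0) => x0.
        by rewrite L_lt0 // !mul0r.
      apply: ler_piMr; first by rewrite mulr_ge0.
      exact: le_trans (ler_norm _) (e1 j x x0).
  have lrK : L1 (fun x => res x * Kn x) by apply: eq_L1 (L1B lW lLK) => x; ring.
  split=> //; apply: (cvg_unique _ cu) => //.
  have rK0 x : x < 0 -> res x * Kn x = 0 by move=> x0; rewrite res_lt0 // mul0r.
  have := abel_limit lrK rK0; apply: cvg_trans; apply: near_eq_cvg; apply: nearW => j.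
  by apply: eq_int => x; rewrite mulrAC.
have [p0 _] := vp _ (@cvgr_idn R); have [B hB] := seq_bounded p0.
have sh (n : nat) : (fun x => res (x + n%:R) * K x) =
    (fun x => (fun y => res y * K (y - n%:R)) (x + n%:R)).
  by apply/funext => x; rewrite /= addrK.
apply: (bounded_of_means A0 M0 k0 mres hc0 res_slow lK K0 hk lxK (B := B)).
- by move=> n; have [l _] := key n; rewrite sh; exact: L1_shift l.
- by move=> n; have [l e] := key n; rewrite sh (int_shift n%:R l) -e.
Qed.

Lemma L1_res_packet (phi : R -> R) (a t0 : R) (w : R -> R) (y : R) :
  Cc a phi -> continuous w -> (forall x, `|w x| <= 1) ->
  L1 (fun x => res x * (w (t0 * (x - y)) * cosT phi 0 (x - y))).
Proof.
move=> hc cw w1; have [C hC] := res_bounded.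
have lw : L1 (fun x => cosT phi 0 x * w (t0 * x)).
  apply: (L1_bdd (cosT_L1 0 hc) (C := 1)) => //.
  by apply: measurableT_comp; [exact: cts_measurable | apply: measurable_funM].
have := L1_bdd (L1_shift (- y) lw) res_measurable hC.
by apply: eq_L1 => x; ring.
Qed.

(* By boundedness, Abel summation at [s = 0] is dominated for every frequency. *)
Lemma res_packet_cvg0 (phi : R -> R) (a t0 : R) (h : nat -> R) (p q : R -> R) :
  Cc a phi -> packet_limits phi t0 p q -> h n @[n --> \oo] --> +oo ->
  \int[mu]_x (res x * (cos (t0 * (x - h n)) * cosT phi 0 (x - h n))) @[n --> \oo] --> (0 : R) /\
  \int[mu]_x (res x * (sin (t0 * (x - h n)) * cosT phi 0 (x - h n))) @[n --> \oo] --> (0 : R).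
Proof.
move=> hc [hp hq v] hh; have [p0 q0] := v h hh; have [C hC] := res_bounded.
have lK : L1 (cosT phi 0) := cosT_L1 0 hc.
have lres w y := @L1_res_packet phi a t0 w y hc.
have r0 (w : R -> R) x : x < 0 -> res x * w x = 0 by move=> x0; rewrite res_lt0 // mul0r.
have cc := @continuous_cos R; have cs := @continuous_sin R.
have pE y : p y = \int[mu]_x (res x * (cos (t0 * (x - y)) * cosT phi 0 (x - y))).
  apply: (cvg_unique _ (cvg_at_right0_seq (hp y))) => //.
  have := abel_limit (lres cos y cc (@norm_cos_le1 R)) (r0 (fun x => cos (t0 * (x - y)) * cosT phi 0 (x - y))).
  apply: cvg_trans; apply: near_eq_cvg; apply: nearW => m.
  by rewrite gamma_eq0 mul0r subr0; apply: eq_int => x; rewrite mulrAC.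
have qE y : q y = - (\int[mu]_x (res x * (sin (t0 * (x - y)) * cosT phi 0 (x - y)))).
  apply: (cvg_unique _ (cvg_at_right0_seq (hq y))) => //.
  have := abel_limit (lres sin y cs (@norm_sin_le1 R)) (r0 (fun x => sin (t0 * (x - y)) * cosT phi 0 (x - y))).
  move=> /cvgN; apply: cvg_trans; apply: near_eq_cvg; apply: nearW => m.
  by rewrite gamma_eq0 mul0r subr0; congr (- _); apply: eq_int => x; rewrite mulrAC.
split.
- by apply: cvg_trans p0; apply: near_eq_cvg; apply: nearW => n; rewrite pE.
- rewrite -[X in _ --> X]oppr0; apply: cvg_trans (cvgN q0); apply: near_eq_cvg.
  by apply: nearW => n; change (- q (h n) = \int[mu]_x (res x * (sin (t0 * (x - h n)) * cosT phi 0 (x - h n)))); rewrite qE opprK.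
Qed.

(** The sign [sg] reflects the line so that slow decrease of [res] becomes the upper slope bound on
    [f n] asked for by [beurling_bound], whichever sign of [res] is estimated. The dilation by
    [p = 2 pi / l] maps frequencies up to [2 pi] to frequencies up to [l] and turns [M p / 2] into
    [pi M / l]. *)
Lemma res_seq_bound (l e : R) (sg : R) (h : nat -> R) : 0 < l -> l < lambda -> 0 < e ->
  sg = 1 \/ sg = - 1 -> h n @[n --> \oo] --> +oo ->
  \forall n \near \oo, sg * res (h n) <= pi * M / l + e.
Proof.
move=> l0 ll e0 hsg hh; have pi0 : 0 < pi :> R := pi_gt0 R.
have sg2 : sg * sg = 1 by case: hsg => ->; rewrite ?mulrNN mulr1.
have sg1 : `|sg| = 1 by case: hsg => ->; rewrite ?normrN normr1.
have [d d0 hd] := uniform_packet_limits l0 ll.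
have [C hC] := res_bounded.
have [phi hphi] := @pos_kernel_exists R; have [hc _ K0 Kgt Kle] := hphi.
have [p pE p0] : exists2 p, p = 2 * pi / l & 0 < p.
  by exists (2 * pi / l) => //; rewrite divr_gt0 // mulr_gt0.
have pn0 : p != 0 by rewrite gt_eqF.
(* Dilating the bump by at most [d / 2] keeps its support within the uniform radius [d]. *)
pose a := d / 2; have a0 : 0 < a by rewrite divr_gt0.
pose q x := (cosT phi 0 0)^-1 * cosT phi 0 (a * (p * x)).
pose f n x := sg * res (h n - sg * p * x).
have lK : L1 (cosT phi 0) := cosT_L1 0 hc.
have scale_ne (b : R) : 0 < b -> b * p != 0 by move=> b0; rewrite gt_eqF // mulr_gt0.
have lKs (b : R) : 0 < b -> L1 (fun x => cosT phi 0 (b * (p * x))).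
  move=> b0; apply: eq_L1 (L1_affine 0 (scale_ne b b0) lK) => x.
  by rewrite addr0 mulrA.
have mf n : measurable_fun setT (f n).
  apply: measurable_funM => //.
  have m : measurable_fun setT (fun x => h n - sg * p * x) by apply: measurable_funB.
  exact: measurableT_comp res_measurable m.
have fC n x : `|f n x| <= C by rewrite normrM sg1 mul1r.
have fM (B : R) : \forall n \near \oo, forall x y, - B <= x -> x <= y -> y <= B ->
    f n y - f n x <= M * p * (y - x).
  near=> n => x y Bx xy yB.
  have hn : A + p * B <= h n by near: n; move/cvgryPge : hh; exact.
  have b1 : p * x <= p * B by rewrite ler_pM2l // (le_trans xy).
  have b2 : p * y <= p * B by rewrite ler_pM2l.
  have b3 : - (p * B) <= p * x by rewrite -mulrN ler_pM2l.
  have b4 : p * x <= p * y by rewrite ler_pM2l.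
  have rs X Y : A <= X -> X <= Y -> res X - res Y <= M * (Y - X).
    by move=> AX XY; have := res_slow AX XY; rewrite mulNr; lra.
  rewrite /f -mulrBr -(mulrA M) mulrBr; case: hsg => ->; rewrite ?mulN1r ?mul1r ?mulNr ?opprK ?opprB.
    apply: (le_trans (rs _ _ _ _)); [| |by rewrite le_eqVlt; apply/orP; left; apply/eqP; ring].
      by lra.
    by lra.
  rewrite addrC; apply: (le_trans (rs _ _ _ _)); [| |by rewrite le_eqVlt; apply/orP; left; apply/eqP; ring].
    by lra.
  by lra.
have vq (m : nat) t : `|t| <= 2 * pi ->
    vanishes f (fun x => q (m.+1%:R^-1 * x) * cos (t * x)) /\
    vanishes f (fun x => q (m.+1%:R^-1 * x) * sin (t * x)).
  move=> t2; pose b := m.+1%:R^-1 * a.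
  have b0 : 0 < b by rewrite mulr_gt0 // invr_gt0.
  have bd : b * 1 < d.
    rewrite mulr1; apply: (@le_lt_trans _ _ a); last by rewrite /a; lra.
    by rewrite ler_piMl ?(ltW a0) // invf_le1 // ler1n.
  have t0l : `|t / p| <= l.
    rewrite normrM normfV (gtr0_norm p0) ler_pdivrMr // pE mulrC divfK ?gt_eqF //.
  have [hcb heb _ _ _] := dilate_kernel b0 hphi.
  have b1 : 0 < b * 1 by rewrite mulr1.
  have [P [Q lim]] := hd _ _ (t / p) b1 bd t0l hcb heb.
  have [c1 c2] := res_packet_cvg0 hcb lim hh.
  have qE x : q (m.+1%:R^-1 * x) = (cosT phi 0 0)^-1 * cosT phi 0 (b * (p * x)).
    by rewrite /q /b; congr (_ * cosT _ _ _); ring.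
  have lq : L1 (fun x => q (m.+1%:R^-1 * x)).
    by apply: eq_L1 (L1Z (cosT phi 0 0)^-1 (lKs b b0)) => x; rewrite qE.
  have sp : - (sg * p) != 0 by rewrite oppr_eq0 mulf_neq0 //; case: hsg => ->; rewrite ?oppr_eq0 oner_eq0.
  have nsp : `|- (sg * p)|^-1 = p^-1 by rewrite normrN normrM sg1 mul1r gtr0_norm.
  have Kev x : cosT (dilate b phi) 0 (- (sg * p) * x) = cosT phi 0 (b * (p * x)).
    rewrite (cosT_dilate _ b0 hc).
    case: hsg => ->; first by rewrite mul1r mulNr mulrN cosT_even.
    by rewrite mulN1r opprK.
  (* Both trigonometric cases follow from one substitution [x -> - sg p x + h n]; the factor [kap]
     records how the sign acts on an even or an odd function. *)
  have fin (w v : R -> R) (kap : R) : continuous w -> continuous v -> (forall x, `|w x| <= 1) ->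
      (forall x, `|v x| <= 1) -> (forall x, sg * v x = kap * w (- sg * x)) ->
      \int[mu]_x (res x * (w (t / p * (x - h n)) * cosT (dilate b phi) 0 (x - h n)))
        @[n --> \oo] --> (0 : R) ->
      vanishes f (fun x => q (m.+1%:R^-1 * x) * v (t * x)).
    move=> cw cv w1 v1 vw c; split.
      apply: (L1_bdd lq (C := 1)) => //; apply: measurableT_comp; first exact: cts_measurable.
      by apply: measurable_funM.
    pose k := (cosT phi 0 0)^-1 * kap * p^-1.
    have ck : k * \int[mu]_x (res x * (w (t / p * (x - h n)) * cosT (dilate b phi) 0 (x - h n)))
        @[n --> \oo] --> k * 0 by apply: cvgM c; exact: cvg_cst.
    rewrite mulr0 in ck.
    apply: cvg_trans ck; apply: near_eq_cvg; apply: nearW => n.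
    have lG := L1_res_packet (t / p) (h n) hcb cw w1.
    have := int_affine (h n) sp lG; rewrite nsp => iG.
    have lG' := L1_affine (h n) sp lG.
    rewrite /k -mulrA -iG -(intZ _ lG'); apply: eq_int => x.
    rewrite addrK Kev qE /f.
    rewrite (_ : t / p * (- (sg * p) * x) = - sg * (t * x)); last by field.
    rewrite (_ : h n - sg * p * x = - (sg * p) * x + h n); last by ring.
    symmetry; transitivity ((cosT phi 0 0)^-1 * cosT phi 0 (b * (p * x)) * res (- (sg * p) * x + h n) *
      (sg * v (t * x))); first by ring.
    by rewrite vw; ring.
  split.
  - apply: (fin cos cos sg) c1; [exact: continuous_cos | exact: continuous_cos |
      exact: norm_cos_le1 | exact: norm_cos_le1 |] => x.
    by case: hsg => ->; rewrite ?opprK ?mul1r ?mulN1r ?cosN.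
  - apply: (fin sin sin (- 1)) c2; [exact: continuous_sin | exact: continuous_sin |
      exact: norm_sin_le1 | exact: norm_sin_le1 |] => x.
    by case: hsg => ->; rewrite ?opprK ?mul1r ?mulN1r ?sinN ?opprK.
have lq : L1 q by apply: L1Z; exact: lKs.
have cq : {for 0, continuous q}.
  have cK : continuous (cosT phi 0) := smoothr_continuous (smoothr_cosT hc).
  have cm : continuous (fun x : R => a * (p * x)).
    by move=> x; apply: cvgM; [exact: cvg_cst | apply: cvgM; [exact: cvg_cst | exact: cvg_id]].
  apply: cvgM; first exact: cvg_cst.
  exact: (cvg_comp _ _ (cm 0) (cK _)).
have q0 : q 0 = 1 by rewrite /q !mulr0 mulVf // gt_eqF.
have q1 x : `|q x| <= 1.
  by rewrite /q ger0_norm ?mulr_ge0 ?invr_ge0 ?(ltW Kgt) // mulrC ler_pdivrMr // mul1r.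
have Mp0 : 0 <= M * p by rewrite mulr_ge0 // ltW.
have := beurling_bound Mp0 mf fC fM lq cq q0 q1 vq e0.
apply: filterS => n; rewrite /f mulr0 subr0 pE.
rewrite (_ : M * (2 * pi / l) / 2 = pi * M / l) //.
by move: pi0; move: pi => P _; field; rewrite gt_eqF.
Unshelve. all: by end_near.
Qed.

End direct_part.

(** * From the essential limit inferior to the limit superior *)

Section direct_inequality.
Context {R : realType}.
Notation mu := (@lebesgue_measure R).
Implicit Types (rho : R -> R).

Lemma ess_liminf_ae rho (M : R) : ((- M)%:E < ess_liminf rho)%E ->
  exists2 A, 0 <= A & {ae mu, forall x, A <= x -> - M <= rho x}.
Proof.
move=> /ereal_sup_gt[_ [A _ <-]] h.
exists (Num.max A 0); first by rewrite le_max lexx orbT.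
have [N [mN N0 hN]] := ess_inf_le (mrestr mu (measurable_itv `[A, +oo[)) (EFin \o rho).
exists (N `&` `[A, +oo[); split.
- by apply: measurableI => //; exact: measurable_itv.
- exact: N0.
- move=> x /= /not_implyP[Ax /negP]; rewrite -ltNge => rx.
  have Ax' : A <= x by move: Ax; rewrite ge_max => /andP[].
  split; last by rewrite in_itv /= Ax'.
  apply: hN => /= hle; have := lt_le_trans h hle.
  by rewrite lte_fin ltNge (ltW rx).
Qed.

Lemma ess_liminf_slow rho (M : R) : L1loc_nneg rho -> ((- M)%:E < ess_liminf rho)%E ->
  exists2 A, 0 <= A & forall x y, A <= x -> x <= y -> - M * (y - x) <= prim rho y - prim rho x.
Proof.
move=> hr /ess_liminf_ae[A A0 hA]; exists A => // x y Ax xy.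
have x0 : 0 <= x by exact: le_trans Ax.
rewrite (prim_sub hr x0 xy) intE.
pose I : R -> R := \1_(`]x, y]%classic).
have mI : measurable (`]x, y]%classic : set R) by exact: measurable_itv.
have I01 t : 0 <= I t by rewrite /I indicE; case: (_ \in _).
have lI : L1 I.
  have := L1_indic mI (L1_indic_cc x y); apply: eq_L1 => t.
  rewrite /I !indicE !mem_setE !in_itv /=.
  by case: (ltP x t) => /=; rewrite ?mulr0 // => xt; rewrite (ltW xt) /=; case: (t <= y); rewrite ?mulr0 ?mulr1.
have iI : \int[mu]_t I t = y - x.
  have c1 : continuous (fun _ : R => 1 : R) by move=> z; exact: cvg_cst.
  have := @ftc_itv R id (fun=> 1) x y xy (fun x => is_derive_id x 1) c1.
  rewrite -Rintegral_itv_obnd_cbnd; last first.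
    by apply/(L1_on _ mI); apply: eq_L1 lI => t; rewrite mul1r.
  by rewrite intE => <-; apply: eq_int => t; rewrite mul1r.
have lr : L1 (fun t => rho t * I t).
  have := L1_indic mI (L1loc_itv y hr); apply: eq_L1 => t.
  rewrite /I !indicE !mem_setE !in_itv /=.
  case: (ltP x t) => /=; rewrite ?mulr0 // => xt; rewrite (le_trans x0 (ltW xt)) /=.
  by case: (t <= y); rewrite ?mulr0 ?mulr1.
(* The lower bound holds almost everywhere only; taking the maximum with it changes the integrand on
   a null set and makes the comparison pointwise. *)
pose g t := Num.max (rho t * I t) (- M * I t).
have lMI : L1 (fun t => - M * I t) by exact: L1Z.
have mg : measurable_fun setT g by apply: measurable_maxr; exact: L1_measurable.
have lg : L1 g.
  apply: L1_le mg (L1D (L1_norm lr) (L1_norm lMI)) _ => t; rewrite /g.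
  move: (rho t * I t) (- M * I t) => u v.
  by case: (leP u v) => _; [rewrite lerDr | rewrite lerDl].
have -> : \int[mu]_t (rho t * I t) = \int[mu]_t g t.
  rewrite /Rintegral; congr fine; apply: ae_eq_integral => //.
  - by apply: (measurable_EFinP _ _).2; exact: L1_measurable lr.
  - by apply: (measurable_EFinP _ _).2.
  apply: (@filterS _ _ (ae_filter_ringOfSetsType mu) _ _ _ hA) => t ht _ /=.
  congr (_%:E); rewrite /g; apply/esym/max_l.
  rewrite /I indicE mem_setE in_itv /=; case: (boolP (x < t <= y)) => [/andP[xt _]|_].
    by rewrite !mulr1 ht // (le_trans Ax) // ltW.
  by rewrite !mulr0.
rewrite -iI -(intZ _ lI); apply: int_le => // t.
by rewrite /g le_max lexx orbT.
Qed.

(** The convergence theorems are sequential; by choice, a failure along the filter would produce a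
    sequence along which it persists. *)
Lemma near_pinfty_seq (P : R -> Prop) :
  (forall h : nat -> R, h n @[n --> \oo] --> +oo -> \forall n \near \oo, P (h n)) ->
  \forall x \near +oo, P x.
Proof.
move=> H; apply: contrapT => nP.
have ex (n : nat) : exists x : R, n%:R <= x /\ ~ P x.
  apply: contrapT => hn; apply: nP; near=> x; apply: contrapT => px; apply: hn.
  by exists x; split=> //; near: x; exact: nbhs_pinfty_ge.
have [h hh] := choice ex.
have hoo : h n @[n --> \oo] --> +oo.
  apply/cvgryPge => A; near=> n; have [h1 _] := hh n; apply: le_trans h1.
  by near: n; exact: nbhs_infty_ger.
have /= [N _ /(_ N (leqnn N))] := H h hoo.
by have [_] := hh N.
Unshelve. all: by end_near.
Qed.

Lemma limf_esup_le (f : R -> \bar R) (c : \bar R) :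
  (\forall x \near +oo, (f x <= c)%E) -> (limf_esup f +oo%R <= c)%E.
Proof.
move=> H; rewrite limf_esupE; apply: (@le_trans _ _ (ereal_sup [set f x | x in [set x | (f x <= c)%E]])).
  by apply: ereal_inf_lbound; exists [set x | (f x <= c)%E].
by apply: ge_ereal_sup => _ [x hx <-].
Qed.

Theorem tauberian_upper_bound (lambda : R) rho (b : R[i]) :
  tauberian_hypotheses lambda rho b -> tauberian_inequality pi lambda rho b.
Proof.
case: b => beta gamma [l0 hr hL hpf]; rewrite /tauberian_inequality.
have pi0 : 0 < pi :> R := pi_gt0 R.
have pl0 : 0 < pi / lambda by rewrite divr_gt0.
set L := ess_liminf rho.
(* If the essential limit inferior is [- oo], the right-hand side is [+ oo]. *)
case: (eqVneq L -oo%E) => [->|Lnoo].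
  by rewrite /= maxye mulry gtr0_sg // mul1e leey.
have [M0 M00 hM0] : exists2 M0 : R, 0 <= M0 & (maxe (- L) 0 = M0%:E)%E.
  move: Lnoo; case: L => [r| |] // _.
    by exists (Num.max (- r) 0); rewrite ?le_max ?lexx ?orbT // EFin_max EFinN.
  by exists 0 => //; rewrite /= maxNye.
have LM (d : R) : 0 < d -> ((- (M0 + d))%:E < L)%E.
  move=> d0; have : (- L <= M0%:E)%E by rewrite -hM0 le_max lexx.
  rewrite leeNl => /(lt_le_trans _); apply.
  by rewrite -EFinN lte_fin; lra.
rewrite hM0; apply/lee_addgt0Pr => e e0; apply: limf_esup_le.
(* Replacing [M0] by [M0 + d] and [1 / lambda] by [1 / lambda + d] costs
   [pi ((M0 + 1 / lambda) d + d ^ 2)], at most [pi k d] when [d <= 1]. *)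
pose k := M0 + 1 / lambda + 1.
have k0 : 0 < k by rewrite ltr_wpDl // addr_ge0 // divr_ge0 // ltW.
pose d := Num.min 1 (e / 2 / (pi * k)).
have d0 : 0 < d by rewrite lt_min ltr01 !divr_gt0 // mulr_gt0.
have d1 : d <= 1 by rewrite ge_min lexx.
have dk : pi * k * d <= e / 2.
  have : d <= e / 2 / (pi * k) by rewrite ge_min lexx orbT.
  by rewrite ler_pdivlMr ?mulr_gt0 // mulrC.
pose l := (lambda^-1 + d)^-1.
have li0 : 0 < lambda^-1 by rewrite invr_gt0.
have lid : 0 < lambda^-1 + d by rewrite addr_gt0.
have lp : 0 < l by rewrite invr_gt0.
have ll : l < lambda by rewrite -[X in _ < X]invrK ltf_pV2 ?posrE // ltrDl.
have [A A0 slow] := ess_liminf_slow hr (LM d d0).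
have M1 : 0 <= M0 + d by rewrite addr_ge0 // ltW.
have e2 : 0 < e / 2 by rewrite divr_gt0.
have bound : pi * (M0 + d) / l + e / 2 <= pi / lambda * M0 + e.
  rewrite /l invrK; have : d * d <= d by rewrite ler_piMl // ltW.
  move=> dd; have := ler_wpM2l (ltW pi0) dd; move: dk; rewrite /k mul1r.
  have -> : pi * (M0 + d) * (lambda^-1 + d) = pi / lambda * M0 + pi * (M0 + lambda^-1) * d + pi * (d * d) by ring.
  by rewrite (_ : pi * (M0 + lambda^-1 + 1) * d = pi * (M0 + lambda^-1) * d + pi * d); [lra|ring].
have up (sg : R) : sg = 1 \/ sg = - 1 ->
    \forall x \near +oo, sg * res rho beta x <= pi / lambda * M0 + e.
  move=> hsg; apply: near_pinfty_seq => h hh.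
  have := res_seq_bound hr hL hpf l0 A0 M1 slow lp ll e2 hsg hh.
  by apply: filterS => n hn; exact: le_trans hn bound.
near=> x.
have x0 : 0 <= x by near: x; exact: nbhs_pinfty_ge.
have u1 : 1 * res rho beta x <= pi / lambda * M0 + e by near: x; apply: up; left.
have u2 : - 1 * res rho beta x <= pi / lambda * M0 + e by near: x; apply: up; right.
rewrite -EFinM -EFinD lee_fin.
rewrite (gamma_eq0 hr hL hpf l0) cabsE /= subrr expr0n /= addr0 sqrtr_sqr.
move: u1 u2; rewrite res_ge0 // mul1r mulN1r => u1 u2.
by rewrite ler_norml; apply/andP; split; rewrite /prim in u1 u2 *; lra.
Unshelve. all: by end_near.
Qed.

End direct_inequality.

(** * Sharpness of the constant *)

Section model_pseudofunction.
Context {R : realType}.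
Notation mu := (@lebesgue_measure R).
Implicit Types (f p w : R -> R) (t x : R).

Lemma plateau_exists (c d : R) : 0 < c -> c < d ->
  exists2 chi, Cc d chi & (forall t, chi (- t) = chi t) /\ (forall t, `|t| <= c -> chi t = 1).
Proof.
(* Here [m - e = c] and [m + e = d]: smoothing the indicator of [[- m, m]] by a normalized bump of
   radius [e] leaves it 1 on [[- c, c]] and 0 beyond [d]. *)
move=> c0 cd; pose e := (d - c) / 2; pose m := (d + c) / 2.
have e0 : 0 < e by rewrite divr_gt0 // subr_gt0.
have [phi hphi] := @pos_kernel_exists R.
have [hc he _ gt0 _] := dilate_kernel e0 hphi; rewrite mulr1 in hc.
set f := dilate e phi in hc he gt0 *; pose I := cosT f 0 0.
have lf := Cc_L1 hc.
have IE : \int[mu]_t f t = I.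
  by apply: eq_int => t; rewrite mulr0 addr0 cos0 mulr1.
pose w : R -> R := \1_(`[- m, m]%classic).
have lw : L1 w by exact: L1_indic_cc.
have wN u : w (- u) = w u.
  by rewrite /w !indicE !mem_setE !in_itv /= lerN2 lerNl andbC.
exists (fun t => I^-1 * conv w f t); last split.
- apply: CcZ; rewrite (_ : d = e + m); last by rewrite /e /m; field.
  apply: Cc_conv => // u; rewrite /w indicE mem_setE in_itv /= -ler_norml.
  by rewrite ltNge => /negbTE ->.
- move=> t; congr (_ * _); rewrite /conv.
  have n10 : - 1 != 0 :> R by rewrite oppr_eq0 oner_eq0.
  have := int_affine 0 n10 (L1_conv t lw hc); rewrite normrN normr1 invr1 mul1r => <-.
  apply: eq_int => u; rewrite addr0 mulN1r wN -[in RHS]he; congr (_ * f _); ring.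
- move=> t tc; rewrite /conv; have -> : \int[mu]_u (w u * f (u + t)) = \int[mu]_u f (u + t).
    apply: eq_int => u; rewrite /w indicE mem_setE in_itv /= -ler_norml.
    case: (leP `|u| m) => um; first by rewrite mul1r.
    rewrite mul0r; case: hc => _ -> //.
    by have := ler_normB (u + t) t; rewrite addrK; rewrite /m in um; rewrite /e; lra.
  by rewrite (int_shift t lf) IE mulVf // gt_eqF.
Qed.

(* The denominator vanishes only where [w] does, so the junk value [0^-1 = 0]
   never occurs. *)
Lemma Cc_quotient (c k s : R) w : c < k -> `|s| <= 1 -> Cc c w ->
  Cc c (fun t => w t * (k + s * t)^-1).
Proof.
move=> ck s1 hw; split; last by move=> t tc; case: hw => _ -> //; rewrite mul0r.
(* Powers of the inverse close the class under differentiation: one derivative raises [n] by 1 and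
   keeps the numerator in [Cc c]. *)
apply: (@smoothr_class R (fun f => exists n w, Cc c w /\ f = fun t => w t * ((k + s * t)^-1) ^+ n)); last first.
  by exists 1%N, w; split.
move=> _ [n [{hw} w [hw ->]]].
pose w' t := derive1 w t * (k + s * t) + w t * (- (n%:R * s)).
have ca : smoothr (fun t : R => k + s * t).
  have := @smoothr_affine R s k _ (@smoothr_id R).
  by congr smoothr; apply/funext => t; rewrite addrC.
have hw' : Cc c w'.
  by apply: CcD; [apply: CcM => //; exact: Cc_derive1 | apply: CcM => //; exact: smoothr_cst].
exists (fun t => w' t * ((k + s * t)^-1) ^+ n.+1); first by exists n.+1, w'.
move=> x; case: (leP `|x| c) => xc.
  have sx : `|s * x| <= `|x| by rewrite normrM ler_piMl.
  have kx : k + s * x != 0.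
    by rewrite gt_eqF //; have := ler_norm (- (s * x)); rewrite normrN; lra.
  have d1 := smoothr_derive (Cc_smoothr hw) x.
  have d2 : is_derive x 1 (fun t : R => k + s * t) s.
    have := @is_derive_affine R s k id 1 x (is_derive_id _ _); rewrite mulr1.
    by congr is_derive; apply/funext => t; rewrite addrC.
  have d3 := @is_deriveV R (fun t : R => k + s * t) x s 1 kx d2.
  have d4 := is_deriveM d1 (is_deriveX n d3).
  have E : (fun t => w t * (k + s * t)^-1 ^+ n) = w * (fun t => (k + s * t)^-1) ^+ n.
    by apply/funext => t; rewrite exprfctE.
  rewrite E; apply: (is_derive_eq d4).
  rewrite exprfctE /GRing.scale /= /w'; move: (derive1 w x) (w x) => u v.
  case: n {hw' d4 w' E} => [|n] /=; first by rewrite !expr0 expr1; field.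
  rewrite !exprS; move: ((k + s * x)^-1 ^+ n) (n.+1%:R : R) => P N.
  by field.
have z0 : is_derive x 1 (fun t : R => w t * ((k + s * t)^-1) ^+ n) 0.
  have xc0 : 0 < `|x| - c by rewrite subr_gt0.
  apply: (@near_eq_is_derive R R R (cst 0) _ _ _ _ _ (is_derive_cst (0 : R) x 1)).
  apply: filterS (nbhsx_ballx x _ xc0) => t; rewrite /ball /= => xt.
  case: hw => _ ->; rewrite ?mul0r //.
  by have := ler_normD (x - t) t; rewrite subrK; lra.
have -> : w' x * ((k + s * x)^-1) ^+ n.+1 = 0.
  by case: hw' => _ -> //; rewrite mul0r.
exact: z0.
Qed.

Lemma schwartz_L1 (phi : R -> R[i]) : schwartz phi ->
  L1 (fun x => complex.Re (phi x)) /\ L1 (fun x => complex.Im (phi x)).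
Proof.
move=> [sm dec]; have [M0 h0] := dec 0%N 0%N; have [M2 h2] := dec 2%N 0%N.
have [lp _] := @poisson_int R.
have bd x : cabs (phi x) <= (M0 + M2) * (1 + x ^+ 2)^-1.
  have px : 0 < 1 + x ^+ 2 by rewrite ltr_pwDl // sqr_ge0.
  rewrite ler_pdivlMr // mulrDr mulr1.
  have e : cderiv 0 phi x = phi x by rewrite /cderiv /=; case: (phi x).
  have := h0 x; have := h2 x; rewrite e expr0 mul1r real_normK ?num_real // [_ * cabs _]mulrC.
  lra.
have mR : measurable_fun setT (fun x => complex.Re (phi x)).
  have s1 : smoothr (fun x => complex.Re (phi x)) by move=> n x; have [] := sm n x.
  exact: cts_measurable (smoothr_continuous s1).
have mI : measurable_fun setT (fun x => complex.Im (phi x)).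
  have s1 : smoothr (fun x => complex.Im (phi x)) by move=> n x; have [] := sm n x.
  exact: cts_measurable (smoothr_continuous s1).
split; [apply: (L1_le mR (L1Z (M0 + M2) lp)) | apply: (L1_le mI (L1Z (M0 + M2) lp))] => x.
- exact: le_trans (norm_Re_le _) (bd x).
- exact: le_trans (norm_Im_le _) (bd x).
Qed.

Lemma regular_realE p (phi : R -> R[i]) :
  regular (fun x => (p x)%:C) phi =
  (\int[mu]_x (p x * complex.Re (phi x))) +i* (\int[mu]_x (p x * complex.Im (phi x))).
Proof.
by rewrite /regular /cint; congr (_ +i* _); apply: eq_int => x;
   rewrite ?ReM ?ImM /= mul0r ?subr0 ?addr0.
Qed.

(** Fubini moves the Fourier transform from one factor to the other; the sine part vanishes because
    [p] is even. *)
Lemma regular_fourier p (phi : R -> R[i]) : L1 p -> (forall x, p (- x) = p x) -> schwartz phi ->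
  regular (fun x => (p x)%:C) (fourier phi) = regular (fun x => (cosT p 0 x)%:C) phi.
Proof.
move=> lp pe /schwartz_L1[lr li]; rewrite !regular_realE.
have mc : measurable_fun setT (fun z : R * R => cos (z.1 * z.2)).
  by apply: measurableT_comp; [exact: cts_measurable (@continuous_cos R) | exact: measurable_funM].
have ms : measurable_fun setT (fun z : R * R => sin (z.1 * z.2)).
  by apply: measurableT_comp; [exact: cts_measurable (@continuous_sin R) | exact: measurable_funM].
have mcx t : measurable_fun setT (fun x : R => cos (t * x)) := cts_measurable (@continuous_cos_lin R t).
have msx t : measurable_fun setT (fun x : R => sin (t * x)) := cts_measurable (@continuous_sin_lin R t).
have Fc w : L1 w -> \int[mu]_x (p x * \int[mu]_t (w t * cos (x * t))) =
    \int[mu]_x (cosT p 0 x * w x).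
  move=> lw; rewrite (fubini_mul lp lw mc (fun x t => norm_cos_le1 (x * t))).
  by apply: eq_int => t; rewrite mulrC; congr (_ * _); apply: eq_int => x; rewrite addr0.
have Fs w : L1 w -> \int[mu]_x (p x * \int[mu]_t (w t * sin (x * t))) = 0.
  move=> lw; rewrite (fubini_mul lp lw ms (fun x t => norm_sin_le1 (x * t))).
  rewrite -[RHS](mul0r (\int[mu]_t w t)) -(intZ 0 lw); apply: eq_int => t.
  rewrite mul0r int_odd ?mulr0 // => [x|]; first by rewrite pe mulNr sinN mulrN.
  by apply: eq_L1 (L1_sin t lp) => x; rewrite mulrC [t * x]mulrC mulrC.
have lc w : L1 w -> L1 (fun x => p x * \int[mu]_t (w t * cos (x * t))).
  move=> lw; apply: (L1_bdd lp (C := \int[mu]_t `|w t|)).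
    have := cts_measurable (@continuous_cos_int R w 0 lw).
    by congr measurable_fun; apply/funext => x; apply: eq_int => t; rewrite addr0.
  move=> x; apply: int_norm_le; [exact: L1_cos | exact: L1_norm |] => t.
  by rewrite normrM ler_piMr // norm_cos_le1.
have ls w : L1 w -> L1 (fun x => p x * \int[mu]_t (w t * sin (x * t))).
  move=> lw; apply: (L1_bdd lp (C := \int[mu]_t `|w t|)).
    have := cts_measurable (@continuous_cos_int R w (- (pi / 2)) lw).
    congr measurable_fun; apply/funext => x; apply: eq_int => t.
    by rewrite cosB cos_pihalf sin_pihalf mulr0 add0r mulr1.
  move=> x; apply: int_norm_le; [exact: L1_sin | exact: L1_norm |] => t.
  by rewrite normrM ler_piMr // norm_sin_le1.
have cE (x t : R) : cexp (0 -i* (x * t)) = cos (x * t) +i* - sin (x * t).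
  by rewrite /cexp /= expR0 !mul1r cosN sinN.
congr (_ +i* _).
- rewrite -(Fc _ lr) -[RHS]addr0 -(Fs _ li) -(intD (lc _ lr) (ls _ li)); apply: eq_int => x.
  rewrite -mulrDr; congr (_ * _); rewrite -(intD (L1_cos x lr) (L1_sin x li)).
  by apply: eq_int => t; rewrite cE ReM /=; ring.
- rewrite -(Fc _ li) -[RHS]subr0 -(Fs _ lr) -(intB (lc _ li) (ls _ lr)); apply: eq_int => x.
  rewrite -mulrBr; congr (_ * _); rewrite -(intB (L1_cos x li) (L1_sin x lr)).
  by apply: eq_int => t; rewrite cE ImM /=; ring.
Qed.

(** By inversion [psi] is the Fourier transform of the bounded function [cosT psi 0 / (2 pi)], hence
    a pseudomeasure; its own transform [cosT psi 0] decays at infinity. *)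
Lemma regular_global_pseudofunction (c : R) psi : Cc c psi -> (forall t, psi (- t) = psi t) ->
  global_pseudofunction (regular (fun t => (psi t)%:C)).
Proof.
move=> hc he; have lp := Cc_L1 hc; have [B hB] := Cc_bounded hc.
have mp := Cc_measurable hc.
have cK : continuous (cosT psi 0) := smoothr_continuous (smoothr_cosT hc).
have pi0 : 2 * pi != 0 :> R by rewrite mulf_neq0 // ?pnatr_eq0 ?pi_neq0.
have lpw w : L1 w -> L1 (fun x => psi x * w x).
  by move=> lw; apply: eq_L1 (L1_bdd lw mp hB) => x; rewrite mulrC.
have real_Linfty w (M : R) : continuous w -> (forall x, `|w x| <= M) -> Linfty (fun x => (w x)%:C).
  move=> cw wM; split; [exact: cts_measurable | exact: measurable_cst | exists M].
  by apply: aeW => x; rewrite cabsE /= expr0n addr0 sqrtr_sqr.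
split; [split|].
- split.
    move=> a p1 p2 /schwartz_L1[r1 i1] /schwartz_L1[r2 i2]; rewrite !regular_realE.
    have [lr1 li1] := (lpw _ r1, lpw _ i1); have [lr2 li2] := (lpw _ r2, lpw _ i2).
    case: a => a1 a2; apply: complexP; rewrite /= -!(intZ _ lr1) -!(intZ _ li1).
      rewrite -(intB (L1Z _ lr1) (L1Z _ li1)) -(intD (L1B (L1Z _ lr1) (L1Z _ li1)) lr2).
      by apply: eq_int => x; case: (p1 x) => u1 v1; case: (p2 x) => u2 v2 /=; ring.
    rewrite -(intD (L1Z _ li1) (L1Z _ lr1)) -(intD (L1D (L1Z _ li1) (L1Z _ lr1)) li2).
    by apply: eq_int => x; case: (p1 x) => u1 v1; case: (p2 x) => u2 v2 /=; ring.
  exists (2 * \int[mu]_t `|psi t|), 0%N => phi M sphi hM.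
  have pM x : cabs (phi x) <= M.
    have := hM 0%N 0%N x (leqnn 0) (leqnn 0); rewrite expr0 mul1r.
    by rewrite /cderiv /=; case: (phi x).
  have [lr li] := schwartz_L1 sphi.
  rewrite regular_realE; apply: (le_trans (cabs_le _)) => /=.
  rewrite -mulrA mulr2n mulrDl mul1r mulrC -(intZ _ (L1_norm lp)).
  by apply: lerD; apply: int_norm_le; [exact: lpw | exact: L1Z (L1_norm lp) | |
     exact: lpw | exact: L1Z (L1_norm lp) |] => x; rewrite normrM mulrC ler_wpM2r //;
     apply: le_trans (pM x); [exact: norm_Re_le | exact: norm_Im_le].
- exists (fun x => ((2 * pi)^-1 * cosT psi 0 x)%:C).
    apply: (real_Linfty _ (`|(2 * pi)^-1| * \int[mu]_t `|psi t|)).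
      by move=> x; apply: cvgM; [exact: cvg_cst | exact: cK].
    by move=> x; rewrite normrM ler_wpM2l // cosT_bound.
  move=> phi sphi; rewrite /fourier_dist regular_fourier //.
  + congr regular; apply/funext => t; congr (_%:C).
    have lK : L1 (fun x => cosT psi 0 x * cos (t * x)) by apply: L1_cos; exact: cosT_L1 hc.
    transitivity ((2 * pi)^-1 * \int[mu]_x (cosT psi 0 x * cos (t * x))).
      by rewrite (cosT_inversion _ hc he) mulKf.
    by rewrite -(intZ _ lK); apply: eq_int => x; rewrite addr0 [x * t]mulrC mulrA.
  + by apply: L1Z; exact: cosT_L1 hc.
  + by move=> x; rewrite cosT_even.
- exists (fun x => (cosT psi 0 x)%:C); split.
  + exact: (real_Linfty _ (\int[mu]_t `|psi t|) cK (fun x => cosT_bound _ _ lp)).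
  + by move=> phi sphi; rewrite /fourier_dist regular_fourier.
  + move=> e e0; have [D hD] := cosT_decay 1 0 hc.
    exists (`|D| / e + 1); apply: aeW => x hx.
    rewrite cabsE /= expr0n addr0 sqrtr_sqr.
    have x0 : 0 < `|x| by apply: lt_le_trans hx; rewrite ltr_wpDl // divr_ge0 // ltW.
    rewrite -(ler_pM2l x0); have := hD x; rewrite expr1 => /le_trans; apply.
    apply: (le_trans (ler_norm D)); rewrite -ler_pdivrMr //; apply: le_trans hx.
    by rewrite lerDl.
Qed.

(* [G s + i H s] are the values of an analytic function on the vertical line of
   abscissa [s], with smooth real boundary values [g] on [(-1, 1)]. *)
Record tame (G H : R -> R -> R) (g : R -> R) : Prop := Tame {
  tame_measurable : forall s, 0 < s -> measurable_fun setT (G s) /\ measurable_fun setT (H s);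
  tame_bounded : forall c, 0 < c -> c < 1 ->
    exists C, forall s t, 0 < s -> `|t| <= c -> `|G s t| <= C /\ `|H s t| <= C;
  tame_cvg : forall t, `|t| < 1 -> G s t @[s --> 0^'+] --> g t /\ H s t @[s --> 0^'+] --> (0 : R);
  tame_Cc : forall c w, c < 1 -> Cc c w -> Cc c (fun t => w t * g t) }.

Lemma tame0 : tame (fun _ _ => 0) (fun _ _ => 0) (fun=> 0).
Proof.
split.
- by move=> s _; split; exact: measurable_cst.
- by move=> c _ _; exists 0 => s t _ _; rewrite normr0.
- by move=> t _; split; exact: cvg_cst.
- by move=> c w c1 hw; apply: CcM => //; exact: smoothr_cst.
Qed.

Lemma tameD G1 H1 g1 G2 H2 g2 (a1 a2 : R) : tame G1 H1 g1 -> tame G2 H2 g2 ->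
  tame (fun s t => a1 * G1 s t + a2 * G2 s t) (fun s t => a1 * H1 s t + a2 * H2 s t)
    (fun t => a1 * g1 t + a2 * g2 t).
Proof.
move=> [m1 b1 l1 c1] [m2 b2 l2 c2]; split.
- move=> s s0; have [? ?] := m1 s s0; have [? ?] := m2 s s0.
  by split; apply: measurable_funD; apply: measurable_funM.
- move=> c c0 cl; have [C1 h1] := b1 c c0 cl; have [C2 h2] := b2 c c0 cl.
  exists (`|a1| * C1 + `|a2| * C2) => s t s0 tc.
  have [? ?] := h1 s t s0 tc; have [? ?] := h2 s t s0 tc.
  by split; apply: (le_trans (ler_normD _ _)); rewrite !normrM lerD // ler_wpM2l.
- move=> t t1; have [p1 q1] := l1 t t1; have [p2 q2] := l2 t t1; split.
    by apply: cvgD; apply: cvgM => //; exact: cvg_cst.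
  have h : a1 * H1 s t + a2 * H2 s t @[s --> 0^'+] --> a1 * 0 + a2 * 0.
    by apply: cvgD; apply: cvgM => //; exact: cvg_cst.
  by rewrite !mulr0 addr0 in h.
- move=> c w cl hw; have := CcD (CcZ a1 (c1 c w cl hw)) (CcZ a2 (c2 c w cl hw)).
  by congr Cc; apply/funext => t; ring.
Qed.

(** With [z = s + i t] these are the real and imaginary parts of [i / (z + i k)] for [s0 = 1] and of
    [- i / (z - i k)] for [s0 = - 1]; since [k >= 1], the pole lies outside the open segment. *)
Lemma tame_pole (k s0 : R) : 1 <= k -> `|s0| <= 1 ->
  tame (fun s t => (k + s0 * t) / (s ^+ 2 + (k + s0 * t) ^+ 2))
    (fun s t => s0 * (s / (s ^+ 2 + (k + s0 * t) ^+ 2))) (fun t => (k + s0 * t)^-1).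
Proof.
move=> k1 s01.
have den (s x : R) : 0 < s -> 0 < s ^+ 2 + x ^+ 2.
  by move=> s0'; rewrite ltr_pwDl ?exprn_gt0 // sqr_ge0.
have ca : continuous (fun t : R => k + s0 * t).
  by move=> t; apply: cvgD; [exact: cvg_cst | apply: cvgM; [exact: cvg_cst | exact: cvg_id]].
have kt c t : c < 1 -> `|t| <= c -> 1 - c <= k + s0 * t.
  move=> c1 tc; have : `|s0 * t| <= `|t| by rewrite normrM ler_piMl.
  by have := ler_norm (- (s0 * t)); rewrite normrN; lra.
split.
- move=> s sp.
  have cd : continuous (fun t : R => (s ^+ 2 + (k + s0 * t) ^+ 2)^-1).
    move=> t; apply: cvgV; first by rewrite gt_eqF ?den.
    by apply: cvgD; [exact: cvg_cst | apply: cvgM; exact: ca].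
  split; apply: cts_measurable => t.
    by apply: cvgM; [exact: ca | exact: cd].
  by apply: cvgM; [exact: cvg_cst | apply: cvgM; [exact: cvg_cst | exact: cd]].
- move=> c c0 c1; exists (1 - c)^-1 => s t sp tc.
  have x1 := kt c t c1 tc; move: (k + s0 * t) x1 => x x1.
  have c10 : 0 < 1 - c by rewrite subr_gt0.
  have x0 : 0 < x by exact: lt_le_trans x1.
  have xi : x^-1 <= (1 - c)^-1 by rewrite lef_pV2 ?posrE.
  have d := den s x sp; split.
    apply: le_trans xi; rewrite ger0_norm ?divr_ge0 ?(ltW x0) ?(ltW d) //.
    rewrite ler_pdivrMr // -[leLHS]mul1r -(mulVf (lt0r_neq0 x0)) -mulrA ler_wpM2l ?invr_ge0 ?(ltW x0) //.
    by rewrite -expr2 lerDr sqr_ge0.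
  rewrite normrM -[leRHS]mul1r; apply: ler_pM => //; apply: le_trans xi.
  rewrite ger0_norm ?divr_ge0 ?(ltW sp) ?(ltW d) //.
  rewrite ler_pdivrMr // -[leLHS]mul1r -(mulVf (lt0r_neq0 x0)) -mulrA ler_wpM2l ?invr_ge0 ?(ltW x0) //.
  by have := sqr_ge0 (s - x); rewrite sqrrB; have := sqr_ge0 s; have := sqr_ge0 x; lra.
- move=> t t1; have x0 : 0 < k + s0 * t.
    by apply: lt_le_trans (kt _ t t1 (lexx _)); rewrite subr_gt0.
  move: (k + s0 * t) x0 => x x0.
  have d0 : 0 ^+ 2 + x ^+ 2 != 0 by rewrite expr0n add0r expf_neq0 // gt_eqF.
  have cd : {for 0, continuous (fun s : R => (s ^+ 2 + x ^+ 2)^-1)}.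
    apply: cvgV => //; apply: cvgD; last exact: cvg_cst.
    by apply: cvgM; exact: cvg_id.
  have xn : x != 0 by rewrite gt_eqF.
  split.
    rewrite (_ : x^-1 = x * (0 ^+ 2 + x ^+ 2)^-1); last by rewrite expr0n add0r; field.
    by apply: cvg_at_right_filter; apply: cvgM; [exact: cvg_cst | exact: cd].
  rewrite [X in _ --> X](_ : (0 : R) = s0 * (0 * (0 ^+ 2 + x ^+ 2)^-1)); last by rewrite mul0r mulr0.
  apply: cvg_at_right_filter; apply: cvgM; first exact: cvg_cst.
  by apply: cvgM; [exact: cvg_id | exact: cd].
- by move=> c w c1 hw; apply: Cc_quotient => //; exact: lt_le_trans k1.
Qed.

End model_pseudofunction.

(** * Boundary distributions of tame functions *)

Section tame_boundary.
Context {R : realType}.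
Notation mu := (@lebesgue_measure R).
Implicit Types (phi : R -> R[i]) (t x : R).

Lemma compact_unit (K : set R) : compact K -> K `<=` `]- 1, 1[ ->
  exists2 c : R, 0 < c < 1 & forall x, K x -> `|x| <= c.
Proof.
move=> /compact_near_coveringP/(_ R (0 : R)^'+ (fun d x => `|x| <= 1 - d) _) H KU.
have {}H : \forall d \near (0 : R)^'+, K `<=` (fun x => `|x| <= 1 - d).
  apply: H => x /KU; rewrite /= in_itv /= -ltr_norml => x1.
  have d0 : 0 < (1 - `|x|) / 2 by rewrite divr_gt0 // subr_gt0.
  exists ([set y | `|x - y| < (1 - `|x|) / 2], [set e | e < (1 - `|x|) / 2]); first split.
  - exact: (nbhsx_ballx x _ d0).
  - exact: nbhs_right_lt.
  - move=> [y e] /= [h1 h2]; have := ler_normD (y - x) x; rewrite subrK distrC; lra.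
have H2 : \forall d \near (0 : R)^'+, [/\ 0 < d, d < 1 & K `<=` (fun x => `|x| <= 1 - d)].
  by near=> d; split; near: d; [exact: nbhs_right_gt | exact: nbhs_right_lt | exact: H].
have [d [d0 d1 Kd]] := @filter_ex _ _ (at_right_proper_filter (0 : R)) _ H2.
exists (1 - d); first by rewrite subr_gt0 d1 gtrBl.
by move=> x /Kd.
Unshelve. all: by end_near.
Qed.

Lemma smooth_Cc (c : R) phi : smooth phi -> (forall x, c < `|x| -> phi x = 0) ->
  Cc c (fun x => complex.Re (phi x)) /\ Cc c (fun x => complex.Im (phi x)).
Proof.
move=> sm z; split; split.
- by move=> n x; have [] := sm n x.
- by move=> x /z ->.
- by move=> n x; have [] := sm n x.
- by move=> x /z ->.
Qed.

Lemma test_function_Cc phi : test_function `]- 1, 1[ phi -> exists2 c : R, 0 < c < 1 &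
  Cc c (fun x => complex.Re (phi x)) /\ Cc c (fun x => complex.Im (phi x)).
Proof.
move=> [sm [K [cK KU sK]]]; have [c c01 Kc] := compact_unit cK KU.
exists c => //; apply: smooth_Cc => // x cx; apply: sK => /Kc.
by rewrite leNgt cx.
Qed.

Variables (G H : R -> R -> R) (g : R -> R) (F : R[i] -> R[i]).
Hypotheses (tm : tame G H g) (ge : forall t, g (- t) = g t)
  (FE : forall s t, 0 < s -> F (s +i* t) = G s t +i* H s t).

Lemma tame_dct (c : R) (r : R -> R) (u : nat -> R) : 0 < c -> c < 1 -> Cc c r ->
  (forall n, 0 < u n) -> u n @[n --> \oo] --> (0 : R) ->
  [/\ forall n, L1 (fun t => G (u n) t * r t), forall n, L1 (fun t => H (u n) t * r t),
    \int[mu]_t (G (u n) t * r t) @[n --> \oo] --> \int[mu]_t (g t * r t) &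
    \int[mu]_t (H (u n) t * r t) @[n --> \oo] --> (0 : R)].
Proof.
move=> c0 c1 hr u0 uc; have [mGH bd lim _] := tm; have [C hC] := bd c c0 c1.
have lr := Cc_L1 hr; have mr := Cc_measurable hr.
have dom (X : R -> R) : (forall t, `|t| <= c -> `|X t| <= C) ->
    forall t, `|X t * r t| <= `|C * r t|.
  move=> h t; case: (leP `|t| c) => tc; last by case: hr => _ ->; rewrite // !mulr0.
  by rewrite !normrM ler_wpM2r // (le_trans (h t tc)) // ler_norm.
have lC : L1 (fun t => `|C * r t|) by apply: L1_norm; exact: L1Z.
have mG n : measurable_fun setT (fun t => G (u n) t * r t).
  by apply: measurable_funM => //; have [] := mGH (u n) (u0 n).
have mH n : measurable_fun setT (fun t => H (u n) t * r t).
  by apply: measurable_funM => //; have [] := mGH (u n) (u0 n).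
have dG n t : `|G (u n) t * r t| <= `|C * r t|.
  by apply: (dom (G (u n))) => {}t tc; have [] := hC _ t (u0 n) tc.
have dH n t : `|H (u n) t * r t| <= `|C * r t|.
  by apply: (dom (H (u n))) => {}t tc; have [] := hC _ t (u0 n) tc.
have pw (X : R -> R -> R) (x : R -> R) : (forall t, `|t| < 1 -> X s t @[s --> 0^'+] --> x t) ->
    forall t, X (u n) t * r t @[n --> \oo] --> x t * r t.
  move=> h t; case: (leP `|t| c) => tc.
    apply: cvgM; last exact: cvg_cst.
    by have /cvg_at_rightP := h t (le_lt_trans tc c1); apply.
  case: hr => _ -> //; rewrite mulr0; apply: cvg_near_cst; apply: nearW => n.
  by rewrite mulr0.
have pG t : G (u n) t * r t @[n --> \oo] --> g t * r t.
  by apply: (pw G g) => {}t t1; have [] := lim t t1.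
have pH t : H (u n) t * r t @[n --> \oo] --> 0 * r t.
  by apply: (pw H (fun=> 0)) => {}t t1; have [] := lim t t1.
have mg : measurable_fun setT (fun t => g t * r t).
  by apply: (@measurable_fun_cvg _ _ _ _ (fun n t => G (u n) t * r t)) => // t _; exact: pG.
have m0 : measurable_fun setT (fun t => 0 * r t) by apply: measurable_funM.
have [_ cG] := dct mG mg pG lC dG; have [_ cH] := dct mH m0 pH lC dH.
split=> //.
- by move=> n; exact: L1_le (mG n) lC (dG n).
- by move=> n; exact: L1_le (mH n) lC (dH n).
- by rewrite -(mul0r (\int[mu]_t r t)) -(intZ 0 lr).
Qed.

Let gd phi := regular (fun t => (g t)%:C) phi.

(** [g] is controlled only inside [(-1, 1)]; a plateau equal to 1 on the support of [phi] localizes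
    it there without changing the pairing. *)
Lemma tame_regularE (c d : R) chi phi : Cc d chi -> (forall t, `|t| <= c -> chi t = 1) ->
  (forall t, c < `|t| -> phi t = 0) -> gd phi = regular (fun t => (chi t * g t)%:C) phi.
Proof.
move=> hc c1 pz; rewrite /gd !regular_realE; congr (_ +i* _); apply: eq_int => t.
  by case: (leP `|t| c) => tc; [rewrite c1 // mul1r | rewrite pz // !mulr0].
by case: (leP `|t| c) => tc; [rewrite c1 // mul1r | rewrite pz // !mulr0].
Qed.

Lemma tame_distribution : Defs.distribution `]- 1, 1[ gd.
Proof.
have [_ _ _ tCc] := tm; split.
- move=> a p1 p2 /test_function_Cc[c1 /andP[_ c11] [r1 i1]] /test_function_Cc[c2 /andP[_ c21] [r2 i2]].
  rewrite /gd !regular_realE.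
  have L c (c1' : c < 1) w (hw : Cc c w) : L1 (fun t => g t * w t).
    by apply: eq_L1 (Cc_L1 (tCc c w c1' hw)) => t; rewrite mulrC.
  have [lr1 li1] := (L _ c11 _ r1, L _ c11 _ i1); have [lr2 li2] := (L _ c21 _ r2, L _ c21 _ i2).
  case: a => a1 a2; apply: complexP; rewrite /= -!(intZ _ lr1) -!(intZ _ li1).
    rewrite -(intB (L1Z _ lr1) (L1Z _ li1)) -(intD (L1B (L1Z _ lr1) (L1Z _ li1)) lr2).
    by apply: eq_int => x; case: (p1 x) => u1 v1; case: (p2 x) => u2 v2 /=; ring.
  rewrite -(intD (L1Z _ li1) (L1Z _ lr1)) -(intD (L1D (L1Z _ li1) (L1Z _ lr1)) li2).
  by apply: eq_int => x; case: (p1 x) => u1 v1; case: (p2 x) => u2 v2 /=; ring.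
- move=> K cK KU; have [c /andP[c0 c1] Kc] := compact_unit cK KU.
  have cd : c < (c + 1) / 2 by lra.
  have d1 : (c + 1) / 2 < 1 by lra.
  have [chi hchi [_ chi1]] := plateau_exists c0 cd.
  have hg := tCc _ _ d1 hchi; have lg := Cc_L1 hg.
  exists (2 * \int[mu]_t `|chi t * g t|), 0%N => phi M sm sK hM.
  have pz t : c < `|t| -> phi t = 0 by move=> ct; apply: sK => /Kc; rewrite leNgt ct.
  have [hr hi] := smooth_Cc sm pz.
  have pM x : cabs (phi x) <= M.
    by have := hM 0%N x (leqnn 0); rewrite /cderiv /=; case: (phi x).
  have [Br hBr] := Cc_bounded hr; have [Bi hBi] := Cc_bounded hi.
  rewrite (tame_regularE hchi chi1 pz) regular_realE; apply: (le_trans (cabs_le _)) => /=.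
  rewrite -mulrA mulr2n mulrDl mul1r mulrC -(intZ _ (L1_norm lg)).
  apply: lerD; apply: int_norm_le.
  + exact: L1_bdd lg (Cc_measurable hr) hBr.
  + exact: L1Z (L1_norm lg).
  + by move=> x; rewrite normrM mulrC ler_wpM2r //; apply: le_trans (pM x); exact: norm_Re_le.
  + exact: L1_bdd lg (Cc_measurable hi) hBi.
  + exact: L1Z (L1_norm lg).
  + by move=> x; rewrite normrM mulrC ler_wpM2r //; apply: le_trans (pM x); exact: norm_Im_le.
Qed.

(** Near each point [g] agrees with its product by a plateau, a smooth even function of compact
    support and hence a global pseudofunction; dominated convergence gives the boundary limit. *)
Lemma tame_boundary : local_pseudofunction_boundary `]- 1, 1[ F.
Proof.
have [_ _ _ tCc] := tm; exists gd; first split; first exact: tame_distribution.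
- move=> t; rewrite /= in_itv /= -ltr_norml => t1.
  pose c := (`|t| + 1) / 2; have tc : `|t| < c by rewrite /c; lra.
  have c1 : c < 1 by rewrite /c; lra.
  have c0 : 0 < c by exact: le_lt_trans tc.
  have cd : c < (c + 1) / 2 by lra.
  have d1 : (c + 1) / 2 < 1 by lra.
  have [chi hchi [chie chi1]] := plateau_exists c0 cd.
  exists `]- c, c[%classic; split.
  + exact: itv_open.
  + by rewrite /= in_itv /= -ltr_norml.
  + by move=> x; rewrite /= !in_itv /= -!ltr_norml => /lt_trans; apply.
  + exists (regular (fun t => (chi t * g t)%:C)).
      apply: (regular_global_pseudofunction (tCc _ _ d1 hchi)) => x.
      by rewrite chie ge.
    move=> phi [sm [K [cK KV sK]]]; apply: (tame_regularE hchi chi1) => x cx.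
    by apply: sK => /KV; rewrite /= in_itv /= -ltr_norml ltNge (ltW cx).
- move=> phi /test_function_Cc[c /andP[c0 c1] [hr hi]].
  split; apply/cvg_at_rightP => u [u0 uc].
  + have [lGr lHr cGr cHr] := tame_dct c0 c1 hr u0 uc.
    have [lGi lHi cGi cHi] := tame_dct c0 c1 hi u0 uc.
    rewrite /gd regular_realE /=.
    have h : \int[mu]_t (G (u n) t * complex.Re (phi t)) - \int[mu]_t (H (u n) t * complex.Im (phi t))
      @[n --> \oo] --> \int[mu]_t (g t * complex.Re (phi t)) - 0 by exact: cvgB.
    rewrite subr0 in h; apply: cvg_trans h; apply: near_eq_cvg; apply: nearW => n.
    rewrite -(intB (lGr n) (lHi n)); apply: eq_int => t.
    by rewrite FE // ReM.
  + have [lGr lHr cGr cHr] := tame_dct c0 c1 hr u0 uc.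
    have [lGi lHi cGi cHi] := tame_dct c0 c1 hi u0 uc.
    rewrite /gd regular_realE /=.
    have h : \int[mu]_t (G (u n) t * complex.Im (phi t)) + \int[mu]_t (H (u n) t * complex.Re (phi t))
      @[n --> \oo] --> \int[mu]_t (g t * complex.Im (phi t)) + 0 by exact: cvgD.
    rewrite addr0 in h; apply: cvg_trans h; apply: near_eq_cvg; apply: nearW => n.
    rewrite -(intD (lGi n) (lHr n)); apply: eq_int => t.
    by rewrite FE // ImM.
Qed.

End tame_boundary.

(** * Trigonometric polynomials of mean zero *)

Section trigonometric_polynomials.
Context {R : realType}.
Notation mu := (@lebesgue_measure R).
Implicit Types (x t s : R) (a : nat -> R).

(** The coefficient [a k] sits at frequency [k + 1]: with no constant term the primitive is the
    periodic [sin_poly], and the poles of its Laplace transform are nonzero integer multiples of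
    [i]. *)
Definition cos_poly a (N : nat) (x : R) : R := \sum_(k < N) a k * cos (k.+1%:R * x).

Definition sin_poly a (N : nat) (x : R) : R :=
  \sum_(k < N) a k / k.+1%:R * sin (k.+1%:R * x).

Lemma cos_polyS a N x : cos_poly a N.+1 x = cos_poly a N x + a N * cos (N.+1%:R * x).
Proof. by rewrite /cos_poly big_ord_recr. Qed.

Lemma sin_polyS a N x :
  sin_poly a N.+1 x = sin_poly a N x + a N / N.+1%:R * sin (N.+1%:R * x).
Proof. by rewrite /sin_poly big_ord_recr. Qed.

Lemma is_derive_sin_poly a N x : is_derive x 1 (sin_poly a N) (cos_poly a N x).
Proof.
elim: N => [|N IH].
  have -> : sin_poly a 0 = cst 0 by apply/funext => y; rewrite /sin_poly big_ord0.
  by rewrite /cos_poly big_ord0; exact: is_derive_cst.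
have -> : sin_poly a N.+1 = (fun y => sin_poly a N y + a N / N.+1%:R * sin (N.+1%:R * y)).
  by apply/funext => y; rewrite sin_polyS.
have d := is_derive_sin_lin N.+1%:R x.
have n0 : N.+1%:R != 0 :> R by rewrite pnatr_eq0.
by apply: is_derive_eq; rewrite cos_polyS /GRing.scale /=; field.
Qed.

Lemma cos_poly_continuous a N : continuous (cos_poly a N).
Proof.
elim: N => [|N IH].
  have -> : cos_poly a 0 = cst 0 by apply/funext => y; rewrite /cos_poly big_ord0.
  by move=> x; exact: cvg_cst.
have -> : cos_poly a N.+1 = (fun y => cos_poly a N y + a N * cos (N.+1%:R * y)).
  by apply/funext => y; rewrite cos_polyS.
move=> x; apply: cvgD; first exact: IH.
by apply: cvgM; [exact: cvg_cst | exact: continuous_cos_lin].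
Qed.

Arguments cos_poly_continuous : clear implicits.

Lemma cos_poly_bounded a N : exists B, forall x, `|cos_poly a N x| <= B.
Proof.
exists (\sum_(k < N) `|a k|) => x; apply: (le_trans (ler_norm_sum _ _ _)).
by apply: ler_sum => k _; rewrite normrM ler_piMr // norm_cos_le1.
Qed.

Lemma sin_poly_bounded a N : exists B, forall x, `|sin_poly a N x| <= B.
Proof.
exists (\sum_(k < N) `|a k / k.+1%:R|) => x; apply: (le_trans (ler_norm_sum _ _ _)).
by apply: ler_sum => k _; rewrite normrM ler_piMr // norm_sin_le1.
Qed.

Lemma cos_poly_L1loc a N : L1loc_nneg (cos_poly a N).
Proof.
move=> A; apply/(@L1_on R `[0, A]%classic); first exact: measurable_itv.
exact: L1_cts_itv (cos_poly_continuous a N).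
Qed.

Lemma prim_cos_poly a N x : 0 <= x -> prim (cos_poly a N) x = sin_poly a N x.
Proof.
move=> x0; rewrite /prim (ftc_itv x0 (is_derive_sin_poly a N) (cos_poly_continuous a N)).
rewrite [X in _ - X](_ : _ = 0) ?subr0 // /sin_poly big1 // => k _.
by rewrite mulr0 sin0 mulr0.
Qed.

Lemma cvg_int_itv (f : R -> R) : L1 (fun x => f x * \1_`[0, +oo[ x) ->
  \int[mu]_x (f x * \1_`[0, A] x) @[A --> +oo] --> \int[mu]_x (f x * \1_`[0, +oo[ x).
Proof.
move=> lf; have fE (A : R) x : f x * \1_`[0, A] x = f x * \1_`[0, +oo[ x * \1_`[0, A] x.
  rewrite !indicE !mem_setE !in_itv /= andbT -mulrA; congr (_ * _).
  by case: (0 <= x); rewrite /= ?mul0r ?mul1r.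
apply/cvgrPdist_le => e e0; apply: near_pinfty_seq => h hh.
have lfh n : L1 (fun x => f x * \1_`[0, h n] x).
  by apply: eq_L1 (L1_indic (measurable_itv `[0, h n]) lf) => x; rewrite [RHS]fE.
have [_ c] : L1 (fun x => f x * \1_`[0, +oo[ x) /\
   \int[mu]_x (f x * \1_`[0, h n] x) @[n --> \oo] --> \int[mu]_x (f x * \1_`[0, +oo[ x).
  apply: (@dct R _ _ (fun x => `|f x * \1_`[0, +oo[ x|)).
  - by move=> n; exact: L1_measurable (lfh n).
  - exact: L1_measurable lf.
  - move=> x; apply: cvg_near_cst; near=> n.
    rewrite !indicE !mem_setE !in_itv /= andbT (_ : x <= h n) ?andbT //.
    by near: n; move/cvgryPge : hh; exact.
  - exact: L1_norm lf.
  - move=> n x; rewrite fE normrM ler_piMr // indicE.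
    by case: (_ \in _); rewrite ?normr1 ?normr0.
by move/cvgrPdist_le : c => /(_ e e0).
Unshelve. all: by end_near.
Qed.

Lemma cos_poly_laplace a N (z : R[i]) : 0 < complex.Re z ->
  laplace_converges (cos_poly a N) z.
Proof.
case: z => s t /= s0; have [B hB] := cos_poly_bounded a N.
have lE := L1_exp s0.
have key w : continuous w -> (forall x, `|w x| <= 1) ->
    L1 (fun x => cos_poly a N x * (expR (- s * x) * w x) * \1_`[0, +oo[ x).
  move=> cw w1; apply: eq_L1 (L1_bdd (L1_bdd lE (cts_measurable cw) w1)
    (cts_measurable (cos_poly_continuous a N)) hB) => x; ring.
have c1 := cvg_int_itv (key _ (@continuous_cos_lin R t) (fun x => norm_cos_le1 (t * x))).
have c2 : \int[mu]_x (cos_poly a N x * (expR (- s * x) * - sin (t * x)) * \1_`[0, A] x) @[A --> +oo]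
    --> \int[mu]_x (cos_poly a N x * (expR (- s * x) * - sin (t * x)) * \1_`[0, +oo[ x).
  apply: cvg_int_itv; apply: key => x; last by rewrite normrN norm_sin_le1.
  by apply: cvgN; exact: continuous_sin_lin.
exists ((\int[mu]_x (cos_poly a N x * (expR (- s * x) * cos (t * x)) * \1_`[0, +oo[ x)) +i*
  (\int[mu]_x (cos_poly a N x * (expR (- s * x) * - sin (t * x)) * \1_`[0, +oo[ x))); split.
- by apply: cvg_trans c1; apply: near_eq_cvg; apply: nearW => A; rewrite laplace_partialE.
- by apply: cvg_trans c2; apply: near_eq_cvg; apply: nearW => A; rewrite laplace_partialE.
Qed.

(** The partial fractions of [k / (z ^ 2 + k ^ 2)] at [z = s + i t], in the form handled by
    [tame_pole]. *)
Lemma sin_expi_int (k s t : R) : 0 < s ->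
  \int[mu]_x (sin (k * x) * expi s x * cos (t * x)) =
    2^-1 * ((k + 1 * t) / (s ^+ 2 + (k + 1 * t) ^+ 2)) +
    2^-1 * ((k + - 1 * t) / (s ^+ 2 + (k + - 1 * t) ^+ 2)) /\
  - (\int[mu]_x (sin (k * x) * expi s x * sin (t * x))) =
    2^-1 * (1 * (s / (s ^+ 2 + (k + 1 * t) ^+ 2))) +
    2^-1 * (- 1 * (s / (s ^+ 2 + (k + - 1 * t) ^+ 2))).
Proof.
move=> s0; have lE := L1_exp s0.
have [c1 s1] := laplace_cos_sin (k + 1 * t) s0.
have [c2 s2] := laplace_cos_sin (k + - 1 * t) s0.
have lc u : L1 (fun x => expi s x * cos (u * x)) := L1_cos u lE.
have ls u : L1 (fun x => expi s x * sin (u * x)) := L1_sin u lE.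
split.
- rewrite -s1 -s2 -(intZ _ (ls (k + 1 * t))) -(intZ _ (ls (k + - 1 * t))).
  rewrite -(intD (L1Z _ (ls _)) (L1Z _ (ls _))); apply: eq_int => x.
  by rewrite -/(expi s x) !mul1r mulN1r mulrDl mulrBl sinD sinB; field.
- rewrite [1 * (_ / _)]mul1r [- 1 * (_ / _)]mulN1r mulrN -c1 -c2 -(intZ _ (lc (k + 1 * t))) -(intZ _ (lc (k + - 1 * t))).
  have lss : L1 (fun x => sin (k * x) * expi s x * sin (t * x)).
    apply: L1_sin; have := ls k; apply: eq_L1 => x; exact: mulrC.
  rewrite -[LHS]mulN1r -(intZ _ lss) -(intB (L1Z _ (lc _)) (L1Z _ (lc _))); apply: eq_int => x.
  by rewrite -/(expi s x) !mul1r mulN1r mulrDl mulrBl cosD cosB; field.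
Qed.

Lemma sin_poly_tame a N : exists G H g, [/\ tame G H g, forall t, g (- t) = g t &
  forall s t, 0 < s ->
    \int[mu]_x (sin_poly a N x * expi s x * cos (t * x)) = G s t /\
    - (\int[mu]_x (sin_poly a N x * expi s x * sin (t * x))) = H s t].
Proof.
elim: N => [|N [G [H [g [tm ge GH]]]]].
  exists (fun _ _ => 0), (fun _ _ => 0), (fun=> 0); split => //; first exact: tame0.
  have z (w : R -> R) s : \int[mu]_x (sin_poly a 0 x * expi s x * w x) = 0.
    rewrite -[RHS](mul0r (\int[mu]_x (0 : R))) -(intZ 0 (@L10 R)); apply: eq_int => x.
    by rewrite /sin_poly big_ord0 !mul0r.
  by move=> s t _; rewrite (z (fun x => cos (t * x))) (z (fun x => sin (t * x))) oppr0.
have k1 : 1 <= N.+1%:R :> R by rewrite ler1n.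
have n1 : `|1 : R| <= 1 by rewrite normr1.
have n2 : `|- 1 : R| <= 1 by rewrite normrN normr1.
have tp := tameD 2^-1 2^-1 (tame_pole k1 n1) (tame_pole k1 n2).
have tq := tameD 1 (a N / N.+1%:R) tm tp.
eexists _, _, _; split; first exact: tq.
  move=> t /=; rewrite ge !mul1r !mulN1r opprK; congr (_ + _ * _); exact: addrC.
move=> s t s0 /=; have [<- <-] := GH s t s0; have [<- <-] := sin_expi_int N.+1%:R t s0.
have lE := L1_exp s0; have [B hB] := sin_poly_bounded a N.
have mS : measurable_fun setT (sin_poly a N).
  exact: cts_measurable (is_derive_continuous (is_derive_sin_poly a N)).
have lS : L1 (fun x => sin_poly a N x * expi s x).
  by apply: eq_L1 (L1_bdd lE mS hB) => x; rewrite mulrC.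
have lk : L1 (fun x => sin (N.+1%:R * x) * expi s x).
  by apply: eq_L1 (L1_sin N.+1%:R lE) => x; rewrite mulrC.
split.
- have l1 := L1_cos t lS; have l2 := L1_cos t lk.
  rewrite -(intZ 1 l1) -(intZ _ l2) -(intD (L1Z 1 l1) (L1Z _ l2)); apply: eq_int => x.
  by rewrite sin_polyS; ring.
- have l1 := L1_sin t lS; have l2 := L1_sin t lk.
  rewrite mul1r mulrN -opprD -(intZ _ l2) -(intD l1 (L1Z _ l2)); congr (- _).
  by apply: eq_int => x; rewrite sin_polyS; ring.
Qed.

Lemma cos_poly_hypotheses a N : tauberian_hypotheses 1 (cos_poly a N) 0.
Proof.
have hr := cos_poly_L1loc a N; have hL := @cos_poly_laplace a N.
split => //; have [G [H [g [tm ge GH]]]] := sin_poly_tame a N.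
apply: (tame_boundary tm ge) => s t s0.
rewrite (laplace_quotient hr hL 0 0 t s0); have [<- <-] := GH s t s0.
have pE (w : R -> R) : \int[mu]_x ((prim (cos_poly a N) x - 0) * expi s x * w x) =
    \int[mu]_x (sin_poly a N x * expi s x * w x).
  apply: eq_int => x; rewrite subr0 /expi indicE mem_setE in_itv /=.
  by case: (leP 0 x) => x0; rewrite ?mulr0 ?mul0r // prim_cos_poly.
by rewrite !mul0r !subr0 (pE (fun x => cos (t * x))) (pE (fun x => sin (t * x))).
Qed.

End trigonometric_polynomials.

(** * The Fejer kernel and sharpness *)

Section fejer.
Context {R : realType}.
Notation mu := (@lebesgue_measure R).
Implicit Types (x : R) (n : nat).

Definition dirichlet n x : R := 1 + 2 * \sum_(k < n) cos (k.+1%:R * x).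

(** The sum of the Dirichlet kernels of orders 0 to [n], that is, [n + 1] times the Fejer kernel;
    multiplication by [1 - cos x] makes the sum telescope. *)
Definition fejer_sum n x : R :=
  n.+1%:R + 2 * \sum_(k < n) (n%:R - k%:R) * cos (k.+1%:R * x).

Lemma cos_step n x : 2 * cos x * cos (n.+1%:R * x) = cos (n%:R * x) + cos (n.+2%:R * x).
Proof.
rewrite (_ : n%:R * x = n.+1%:R * x - x); last by rewrite -[n.+1%:R]natr1; ring.
rewrite (_ : n.+2%:R * x = n.+1%:R * x + x); last by rewrite -[n.+2%:R]natr1; ring.
by rewrite cosB cosD; ring.
Qed.

Lemma dirichletE n x : (1 - cos x) * dirichlet n x = cos (n%:R * x) - cos (n.+1%:R * x).
Proof.
elim: n => [|n IH]; first by rewrite /dirichlet big_ord0 !mul0r mul1r cos0; ring.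
have -> : dirichlet n.+1 x = dirichlet n x + 2 * cos (n.+1%:R * x).
  by rewrite /dirichlet big_ord_recr /=; ring.
rewrite mulrDr IH.
by have := cos_step n x; move: (cos _) (cos _) (cos _) (cos _) => *; lra.
Qed.

Lemma fejer_sumS n x : fejer_sum n.+1 x = fejer_sum n x + dirichlet n.+1 x.
Proof.
rewrite /fejer_sum /dirichlet !big_ord_recr /=.
rewrite (_ : \sum_(i < n) (n.+1%:R - i%:R) * cos (i.+1%:R * x) =
   \sum_(i < n) (n%:R - i%:R) * cos (i.+1%:R * x) + \sum_(i < n) cos (i.+1%:R * x)).
  by rewrite -[n.+2%:R]natr1 -[n.+1%:R]natr1; ring.
by rewrite -big_split; apply: eq_bigr => i _; rewrite -[n.+1%:R]natr1 /=; ring.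
Qed.

Lemma fejer_sumE n x : (1 - cos x) * fejer_sum n x = 1 - cos (n.+1%:R * x).
Proof.
elim: n => [|n IH]; first by rewrite /fejer_sum big_ord0 !mul1r; ring.
by rewrite fejer_sumS mulrDr IH dirichletE; ring.
Qed.

Lemma fejer_sum_ge0 n x : 0 <= fejer_sum n x.
Proof.
(* Where [cos x = 1] the closed form gives no information, and the terms are evaluated one by
   one. *)
case: (eqVneq (cos x) 1) => [c1|c1].
  have s0 : sin x = 0.
    by have := cos2Dsin2 x; rewrite c1 expr1n => h; apply/eqP; rewrite -sqrf_eq0; apply/eqP; lra.
  have ck k : cos (k%:R * x) = 1.
    elim: k => [|k IH]; first by rewrite mul0r cos0.
    by rewrite -natr1 mulrDl mul1r cosD IH c1 s0 mulr0 subr0 mulr1.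
  rewrite /fejer_sum addr_ge0 // mulr_ge0 // sumr_ge0 // => k _.
  by rewrite ck mulr1 subr_ge0 ler_nat ltnW.
have d : 0 < 1 - cos x by rewrite subr_gt0 lt_neqAle c1 cos_le1.
by rewrite -(pmulr_rge0 _ d) fejer_sumE subr_ge0 cos_le1.
Qed.

(* [cos_poly (fejer_coef N) N] is the Fejer kernel of order [N] minus [1]. *)
Definition fejer_coef (N k : nat) : R := 2 * (N%:R - k%:R) / N.+1%:R.

Lemma fejer_polyE N x :
  cos_poly (fejer_coef N) N x = fejer_sum N x / N.+1%:R - 1.
Proof.
have n0 : N.+1%:R != 0 :> R by rewrite pnatr_eq0.
rewrite /fejer_sum mulrDl divff // [1 + _]addrC addrK mulrAC mulr_sumr.
by apply: eq_bigr => k _; rewrite /fejer_coef; field.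
Qed.

Lemma fejer_poly_ge N x : - 1 <= cos_poly (fejer_coef N) N x.
Proof. by rewrite fejer_polyE -[leLHS]add0r lerD2r divr_ge0 // fejer_sum_ge0. Qed.

Lemma sin_natpi n : sin (n%:R * pi) = 0 :> R.
Proof.
elim: n => [|n IH]; first by rewrite mul0r sin0.
by rewrite -natr1 mulrDl mul1r sinDpi IH oppr0.
Qed.

(** On [[d, pi]] the Fejer kernel is at most [2 / ((N + 1) (1 - cos d))], so the derivative of
    [sin_poly] exceeds [- 1] by no more than that; as [sin_poly] vanishes at [pi], the mean value
    theorem bounds its value at [d] from below. *)
Lemma sin_poly_lower N (d : R) : 0 < d -> d < pi ->
  (1 - 2 / (N.+1%:R * (1 - cos d))) * (pi - d) <= sin_poly (fejer_coef N) N d.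
Proof.
move=> d0 dpi; have c1 : 0 < 1 - cos d.
  rewrite subr_gt0 -[X in _ < X]cos0 ltr_cos ?in_itv /= ?lexx ?(ltW d0) ?(ltW dpi) //.
  by rewrite pi_ge0.
have cs : {within `[d, pi], continuous (sin_poly (fejer_coef N) N)}.
  apply: continuous_subspaceT; exact: is_derive_continuous (is_derive_sin_poly _ N).
have [c] := MVT dpi (fun x _ => is_derive_sin_poly (fejer_coef N) N x) cs.
rewrite in_itv /= => /andP[dc cpi].
have -> : sin_poly (fejer_coef N) N pi = 0.
  by rewrite /sin_poly big1 // => k _; rewrite sin_natpi mulr0.
have n0 : 0 < N.+1%:R :> R by rewrite ltr0n.
have pd : 0 < pi - d by rewrite subr_gt0.
have cc : cos c <= cos d.
  rewrite leNgt ltr_cos ?in_itv /= ?(ltW d0) ?(ltW dpi) ?(ltW cpi) ?(ltW (lt_trans d0 dc)) //.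
  by rewrite -leNgt ltW.
have F2 : (1 - cos d) * fejer_sum N c <= 2.
  apply: (@le_trans _ _ ((1 - cos c) * fejer_sum N c)).
    by rewrite ler_wpM2r ?fejer_sum_ge0 // lerD2l lerN2.
  by rewrite fejer_sumE; have := cos_geN1 (N.+1%:R * c); lra.
have tp : cos_poly (fejer_coef N) N c <= 2 / (N.+1%:R * (1 - cos d)) - 1.
  rewrite fejer_polyE lerD2r ler_pdivlMr ?mulr_gt0 // mulrCA mulrC -mulrA mulrCA.
  by rewrite divfK ?gt_eqF.
have := ler_wpM2r (ltW pd) tp.
move=> h1 h2; rewrite -h2 sub0r in h1; rewrite -lerN2; apply: (le_trans h1).
by rewrite -mulNr opprB.
Qed.

Lemma sin_poly_periodic (a : nat -> R) N n x : sin_poly a N (x + pi *+ 2 *+ n) = sin_poly a N x.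
Proof.
rewrite /sin_poly; apply: eq_bigr => k _; congr (_ * _).
rewrite mulrDr [_ * (_ *+ _ *+ _)]mulr_natl -mulrnA; exact: periodicn (@sinD2pi R) _ _.
Qed.

Theorem tauberian_sharp (K : R) : K < pi ->
  ~ (forall (lambda : R) (rho : R -> R) (b : R[i]),
       tauberian_hypotheses lambda rho b -> tauberian_inequality K lambda rho b).
Proof.
move=> Kpi hK; have pi0 : 0 < pi :> R := pi_gt0 R.
(* Passing to the positive part of [K] keeps multiplication by the constant monotone. *)
pose K' := Num.max K 0.
have K'pi : K' < pi by rewrite gt_max Kpi.
have K'0 : 0 <= K' by rewrite le_max lexx orbT.
(* A third of the distance from [K'] to [pi]: the Fejer error costs less than one further [d], so
   [tau > pi - 2 d = K' + d]. *)
have [d dE] : exists d, d = (pi - K') / 3 by exists ((pi - K') / 3).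
have d0 : 0 < d by rewrite dE divr_gt0 // subr_gt0.
have dpi : d < pi by rewrite dE; lra.
have c1 : 0 < 1 - cos d.
  rewrite subr_gt0 -[X in _ < X]cos0 ltr_cos ?in_itv /= ?lexx ?(ltW d0) ?(ltW dpi) //.
  by rewrite pi_ge0.
(* Chosen so that the error coefficient [2 / ((N + 1) (1 - cos d))] times [pi] is below [d]. *)
pose N := Num.truncn (2 * pi / ((1 - cos d) * d)).
have [N0 hN] : 0 < N.+1%:R :> R /\ 2 / (N.+1%:R * (1 - cos d)) * pi < d.
  have n0 : 0 < N.+1%:R :> R by rewrite ltr0n.
  have q0 : 0 <= 2 * pi / ((1 - cos d) * d).
    by rewrite divr_ge0 // mulr_ge0 // ltW.
  split=> //; have /andP[_] := truncn_itv q0; rewrite -/N ltr_pdivrMr ?mulr_gt0 // => h.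
  by rewrite mulrAC ltr_pdivrMr ?mulr_gt0 // (lt_le_trans h) // mulrA mulrC.
pose tau := sin_poly (fejer_coef N) N d.
have tauK : K' < tau.
  apply: lt_le_trans (sin_poly_lower N d0 dpi).
  have e0 : 0 < 2 / (N.+1%:R * (1 - cos d)) by rewrite divr_gt0 // mulr_gt0.
  move: hN; set e := 2 / _ in e0 *; move=> hN.
  have := mulr_gt0 e0 d0; lra.
have := hK 1 _ 0 (cos_poly_hypotheses (fejer_coef N) N).
rewrite /tauberian_inequality divr1; set rho := cos_poly _ _; apply/negP; rewrite -ltNge.
have L1' : ((- 1)%:E <= ess_liminf rho)%E.
  apply: (@le_trans _ _ (ess_inf (mrestr mu (measurable_itv `[0, +oo[)) (EFin \o rho))).
    by apply: ess_inf_ler => t; rewrite lee_fin; exact: fejer_poly_ge.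
  by apply: ereal_sup_ubound; exists 0.
have rhs : (K%:E * maxe (- ess_liminf rho) 0 <= K'%:E)%E.
  have m1 : (maxe (- ess_liminf rho) 0 <= 1%:E)%E.
    by rewrite ge_max lee_fin ler01 andbT leeNl.
  have m0 : (0 <= maxe (- ess_liminf rho) 0)%E by rewrite le_max lexx orbT.
  apply: (@le_trans _ _ (K'%:E * maxe (- ess_liminf rho) 0)%E).
    by apply: lee_wpmul2r => //; rewrite lee_fin le_max lexx.
  by rewrite -[leRHS]mule1; apply: lee_wpmul2l.
apply: (le_lt_trans rhs); apply: (@lt_le_trans _ _ tau%:E); first by rewrite lte_fin.
(* Every neighborhood of [+oo] contains a translate of [d] by a multiple of the period [2 pi], where
   the primitive again equals [tau]; so the limit superior is at least [tau]. *)
rewrite limf_esupE; apply: le_ereal_inf_tmp => _ [V [A [_ hA]] <-].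
have [n hn] : exists n : nat, A < d + pi *+ 2 *+ n.
  exists (Num.truncn `|A|).+1.
  have /andP[_ h] := truncn_itv (normr_ge0 A).
  have := ler_norm A; set j := (Num.truncn `|A|).+1 in h *; move=> h2.
  have p1 : 1 <= pi *+ 2 :> R by have := pi_ge2 R; rewrite mulr2n; lra.
  have : j%:R <= pi *+ 2 *+ j :> R by rewrite -[X in _ <= X]mulr_natr ler_peMl.
  lra.
apply: (@le_trans _ _ (cabs ((\int[mu]_(u in `[0%R, d + pi *+ 2 *+ n]) rho u)%:C - 0))%:E).
  have y0 : 0 <= d + pi *+ 2 *+ n by rewrite addr_ge0 ?(ltW d0) // mulrn_wge0 // mulrn_wge0 // ltW.
  rewrite lee_fin subr0 cabsE /= expr0n addr0 sqrtr_sqr.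
  have -> : \int[mu]_(u in `[0%R, d + pi *+ 2 *+ n]) rho u = tau.
    by rewrite -/(prim rho _) prim_cos_poly // sin_poly_periodic.
  exact: ler_norm.
by apply: ereal_sup_ubound; exists (d + pi *+ 2 *+ n) => //; exact: hA.
Qed.

End fejer.

Theorem theorem1p3 (R : realType) :
  (forall (lambda : R) (rho : R -> R) (b : R[i]),
     tauberian_hypotheses lambda rho b -> tauberian_inequality pi lambda rho b) /\
  (forall K : R, K < pi ->
     ~ (forall (lambda : R) (rho : R -> R) (b : R[i]),
          tauberian_hypotheses lambda rho b ->
          tauberian_inequality K lambda rho b)).
Proof. by split; [exact: tauberian_upper_bound | exact: tauberian_sharp]. Qed.
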